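(* Let $p$ be a prime and $A \subseteq \mathbb{F}_p$ with $|A| = n$ and $|A + A| \leq Cn$, for some $C > 0$. Then the following hold. (i) If $2n < \log_2\log_8\log_{32} p - 1$ and $0 \notin A$, then $|A^{-1} + A^{-1}| > \exp\!\left(-C'\frac{\log n}{\log \log n}\right)n^2$, for some $C'$ depending only on $C$. (ii) Let $k$ be a positive integer and $f \in \mathbb{Z}[x]$ a $k$-bounded polynomial of degree at least $2$. If $n < \log_2\log_{8k}\log_{32k^2} p - 1$, then $|f(A) + f(A)| > \exp\!\left(-C'\frac{\log n}{\log \log n}\right)n^2$, for some $C' = C'(C, k)$ depending only on $C$ and $k$.
   Context: $A+A=\{a+b: a,b\in A\}$, $A^{-1}=\{a^{-1}:a\in A\}$, $f(A)=\{f(a):a\in A\}$. A polynomial $f\in\mathbb{Z}[x]$ is $k$-bounded if the sum of the absolute values of its coefficients is at most $k$ and its degree is at most $k$.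
   Formalization: The formal theorem assumes n ≥ 3: for n ≤ 1 the quantity log n / log log n is undefined, and for n = 2 log log n is negative, so the stated bound exceeds n² for every C' > 0 and fails. *)

(* Defs.v *)
From mathcomp Require Import all_boot all_order all_algebra.
From mathcomp Require Import reals sequences exp.

Set Implicit Arguments.
Unset Strict Implicit.
Unset Printing Implicit Defensive.

Import Order.TTheory GRing.Theory Num.Theory.
Local Open Scope ring_scope.

Definition sumset (V : finZmodType) (A B : {set V}) : {set V} :=
  [set a + b | a in A, b in B].

Definition invset (F : finFieldType) (A : {set F}) : {set F} :=
  [set a^-1 | a in A].

Definition polyset (F : finFieldType) (f : {poly int}) (A : {set F}) : {set F} :=
  [set (map_poly intr f).[a] | a in A].

Definition kbounded (k : nat) (f : {poly int}) : bool :=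
  (\sum_(i < size f) absz (f`_i)%R <= k)%N && (size f <= k.+1)%N.

(* As [ln x = 0] for [x <= 0], an iterated logarithm whose inner value is not
   positive is 0. *)
Definition logb (R : realType) (b x : R) : R := ln x / ln b.

(* Main.v *)
(* Plunnecke's inequality and Ruzsa's covering lemma provide a set X of at most
   C^4 elements of F_p such that every element of A + A - A is x + d - e with x
   in X and d, e in A; hence a bounded-height integer multiple of each element
   of A is a bounded-height integer combination of X.  Since X has bounded size
   and p is large compared with n = |A|, the elements of X can be lifted one at
   a time to algebraic numbers of bounded degree and height n^O(1), so that a
   polynomial expression of bounded complexity vanishes in F_p if and only if
   its lift vanishes.  The lifts of A then have a common denominator n^O(1).
   In a number field of bounded degree, an algebraic number of height n^O(1)
   has at most exp(O(log n / log log n)) divisors of height n^O(1): up to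
   boundedly many choices, a divisor is determined by its valuations, which divide a
   fixed power of a norm, and by the sizes of its conjugates.  So a nonzero m in
   F_p has at most that many factorizations m = x y with x, y expressions of
   bounded complexity in A.
   (i) If 1/a + 1/b = s/t with s = a0 + b0 and t = a0 b0 for a0, b0 in A, then
   (s a - t)(s b - t) = t^2, so every nonzero c has few representations in
   A^-1 + A^-1.
   (ii) f(a) - f(b) = (a - b) g(a, b), so a nonzero m is the difference of few
   pairs of values of f on A, and Cauchy-Schwarz bounds |f(A) + f(A)| below. *)
From HB Require Import structures.
Require Import Defs.
From mathcomp Require Import all_boot all_order all_algebra all_field.
From mathcomp Require Import boolp reals sequences exp.
From mathcomp Require classical_sets.
From mathcomp Require Import zify ring lra.

Set Implicit Arguments.
Unset Strict Implicit.
Unset Printing Implicit Defensive.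

Import Order.TTheory GRing.Theory Num.Theory.
Local Open Scope ring_scope.

(** No number field is ever fixed: the field morphisms of [algC] act as the embeddings, and the
    degree is replaced by a bound [D] on the number of distinct systems of conjugates, which grows
    by a factor of at most [s] when a root of a polynomial of size at most [s] is adjoined. Prime
    ideals are replaced by one valuation ring of [algC] over each rational prime, tested against all
    embeddings. When an element is lifted, a minimal polynomial makes sense only relative to a
    complexity: it has to stay minimal when more complex coefficients are allowed, because the
    Euclidean algorithm raises the complexity; hence the spare levels [W]. The lift of each element
    of [A] has its own denominator, and the product of all of these would be far too large; the
    covering relation is therefore used a second time, to bound the order of all the lifts modulo
    one fixed group. The size of [p] enters as [n ^ c0 < p] for large [n]; small [n] are absorbed by
    [C']. *)

Local Notation aut := {rmorphism algC -> algC}.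

(** * Conjugates and norms of algebraic integers *)

(** The number field generated by the roots of [minCpoly x] is a splitting field, hence normal, so
    its Galois group moves [x] to any other root; an element of this group extends to [algC]. *)
Lemma minCpoly_root_aut (x y : algC) :
  root (minCpoly x) y -> exists nu : aut, nu x = y.
Proof.
move=> y0.
have [rs Drs] := closed_field_poly_normal (minCpoly x).
rewrite (monicP (minCpoly_monic x)) scale1r in Drs.
have mem_rs z : root (minCpoly x) z = (z \in rs).
  by rewrite Drs root_prod_XsubC.
have [Qs [QsC [s1 Ds1 gen]]] := num_field_exists rs.
have [p [Dp mon_p] dv_p] := minCpolyP x.
have mapQ q : map_poly QsC (map_poly (in_alg Qs) q) = map_poly ratr q.
  rewrite -map_poly_comp; apply: eq_map_poly => a.
  by rewrite /= rmorphZ_num rmorph1 mulr1.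
have Dps : map_poly (in_alg Qs) p = \prod_(z <- s1) ('X - z%:P).
  apply: (map_poly_inj QsC); rewrite mapQ -Dp Drs -Ds1 big_map rmorph_prod /=.
  by apply: eq_bigr => i _; rewrite map_polyXsubC.
have split_Qs : SplittingField.axiom Qs.
  exists (map_poly (in_alg Qs) p).
    by apply/polyOverP=> i; rewrite coef_map /= memvZ ?mem1v.
  by exists s1; rewrite ?Dps ?eqpxx.
pose M := FieldExt_isSplittingField.Build rat Qs split_Qs.
pose Qn : splittingFieldType rat := HB.pack Qs M.
have [x1 Dx1 s1x] : exists2 x1 : Qs, QsC x1 = x & x1 \in s1.
  have: x \in rs by rewrite -mem_rs root_minCpoly.
  by rewrite -Ds1 => /mapP[x1 ? ->]; exists x1.
have [y1 Dy1 s1y] : exists2 y1 : Qs, QsC y1 = y & y1 \in s1.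
  have: y \in rs by rewrite -mem_rs.
  by rewrite -Ds1 => /mapP[y1 ? ->]; exists y1.
have ry : root (minPoly (1%AS : {subfield Qn}) x1) y1.
  have /polyOver1P[q Dq] := minPolyOver (1%AS : {subfield Qn}) (x1 : Qn).
  have: root (map_poly ratr q) x.
    by rewrite -Dx1 -mapQ -Dq fmorph_root root_minPoly.
  rewrite dv_p => /dvdpP[r Dr]; rewrite Dq Dr rmorphM rootM /= Dps.
  by rewrite root_prod_XsubC s1y orbT.
have [s _ sx] : exists2 s : gal_of {:Qn}%AS, s \in 'Gal({:Qn} / 1)%g & s (x1 : Qn) = y1.
  by apply: (@normalField_root_minPoly _ _ 1%AS {:Qn}%AS) => //;
     rewrite ?sub1v ?memvf ?normalFieldf.
have [nu Dnu] := extend_algC_subfield_aut QsC (s : {rmorphism Qn -> Qn}).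
by exists nu; rewrite -Dx1 -Dnu -Dy1; congr (QsC _); exact: sx.
Qed.

(** Separability: a repeated root would also be a root of the derivative of its rational minimal
    polynomial, which is nonzero and of smaller degree. *)
Lemma minCpoly_roots (x : algC) : exists rs : seq algC,
  [/\ uniq rs, minCpoly x = \prod_(r <- rs) ('X - r%:P)
    & forall r, r \in rs -> exists nu : aut, nu x = r].
Proof.
have [rs Drs] := closed_field_poly_normal (minCpoly x).
rewrite (monicP (minCpoly_monic x)) scale1r in Drs.
have conj_rs r : r \in rs -> exists nu : aut, nu x = r.
  by rewrite -root_prod_XsubC -Drs => /minCpoly_root_aut.
exists rs; split=> //; apply/(uniqP 0) => i j ltin ltjn Dij.
apply/eqP/negP => /negP neqij.
wlog ltij : i j ltin ltjn Dij neqij / (i < j)%N.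
  move=> IH; case: (ltngtP i j) => [|ltji|E]; first exact: IH.
    by apply: (IH j i); rewrite // eq_sym.
  by rewrite E eqxx in neqij.
set r := rs`_i in Dij.
have mr : r \in rs by apply: mem_nth.
have [nu Dnu] := conj_rs r mr.
have Dmr : minCpoly r = minCpoly x by rewrite -Dnu minCpoly_aut.
have [p [Dp mon_p] dv_p] := minCpolyP r.
have size_p : (1 < size p)%N.
  by rewrite -(size_map_poly (ratr : rat -> algC)) -Dp size_minCpoly.
have: root (map_poly ratr p^`()) r.
  have [t Dt] : exists t, minCpoly x = t * ('X - r%:P) ^+ 2.
    exists (\prod_(z <- take i rs ++ take (j - i.+1) (drop i.+1 rs) ++ drop j.+1 rs) ('X - z%:P)).
    rewrite Drs -{1}(cat_take_drop i rs) (drop_nth 0) //.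
    rewrite -{1}(cat_take_drop (j - i.+1) (drop i.+1 rs)).
    have ltj' : (j - i.+1 < size (drop i.+1 rs))%N 
      by rewrite size_drop ltn_sub2r // (leq_ltn_trans ltij).
    rewrite (drop_nth 0 ltj') nth_drop subnKC // -Dij !big_cat /= !big_cons !big_cat /= big_cons.
    have -> : drop (j - i.+1).+1 (drop i.+1 rs) = drop j.+1 rs.
      by rewrite drop_drop addSn subnK.
    by rewrite -/r expr2; ring.
  rewrite -deriv_map -Dp Dmr Dt expr2 !derivM derivXsubC rootE.
  rewrite !(hornerM, hornerD, hornerN, hornerX, hornerC) subrr.
  by rewrite !(mulr0, mul0r, addr0).
rewrite dv_p => /dvdp_leq.
have nz_p' : p^`() != 0.
  apply/eqP=> /polyP/(_ (size p).-2); rewrite coef_deriv coef0.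
  case: (size p) (lead_coefE p) size_p => [|[|m]] //= lp _.
  by rewrite -lp (monicP mon_p) => /eqP; rewrite pnatr_eq0.
by move/(_ nz_p'); rewrite leqNgt lt_size_deriv // -size_poly_gt0 (ltn_trans _ size_p).
Qed.

(** Stands for degree at most [D]: the list [mu] replaces the embeddings of a number field
    containing [v], and one list can serve many numbers. *)
Definition conj_bounded (D : nat) (mu : nat -> aut) (v : algC) :=
  forall nu : aut, exists2 i, (i < D)%N & nu v = mu i v.

Lemma minCpoly_roots_bounded D mu v : conj_bounded D mu v ->
  exists rs : seq algC,
  [/\ uniq rs, (size rs <= D)%N, minCpoly v = \prod_(r <- rs) ('X - r%:P),
      v \in rs & forall r, r \in rs -> exists nu : aut, nu v = r].
Proof.
move=> conj_v; have [rs [uniq_rs Drs conj_rs]] := minCpoly_roots v.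
exists rs; split=> //; last first.
  by rewrite -root_prod_XsubC -Drs root_minCpoly.
rewrite -(size_iota 0 D) -(size_map (fun i => mu i v)).
apply: uniq_leq_size => // r /conj_rs[nu <-].
have [i ltiD ->] := conj_v nu.
by apply/mapP; exists i; rewrite ?mem_iota.
Qed.

(** [N] is the absolute value of the product of the conjugates of [v]; up to sign, [N / v] is the
    product of the remaining ones, which gives its integrality and its size. *)
Lemma Aint_norm D mu v (b : nat) : (0 < b)%N -> v \in Aint -> v != 0 ->
  conj_bounded D mu v -> (forall nu : aut, `|nu v| <= b%:R) ->
  exists N : nat, [/\ (0 < N)%N, (N <= b ^ D)%N, N%:R / v \in Aint
    & forall nu : aut, `|nu (N%:R / v)| <= (b ^ D)%:R].
Proof.
move=> b0 Av v0 conj_v le_vb.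
have [rs [uniq_rs szrs Drs v_rs conj_rs]] := minCpoly_roots_bounded conj_v.
have Ars r : r \in rs -> r \in Aint.
  by move=> /conj_rs[nu <-]; rewrite Aint_aut.
have nz_r r : r \in rs -> r != 0.
  by move=> /conj_rs[nu <-]; rewrite fmorph_eq0.
have le_r r (nu : aut) : r \in rs -> `|nu r| <= b%:R.
  move=> /conj_rs[nu' <-]; exact: (le_vb [the aut of nu \o nu']).
pose P := \prod_(r <- rs) r.
have ZP : P \in Num.int.
  have : (minCpoly v)`_0 \in Num.int by move: Av; rewrite unfold_in => /polyOverP.
  rewrite Drs -horner_coef0 horner_prod.
  have -> : \prod_(i <- rs) ('X - i%:P).[0] = (-1) ^+ size rs * P.
    rewrite /P; elim: (rs) => [|r s IHs]; first by rewrite !big_nil expr0 mulr1.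
    by rewrite !big_cons IHs hornerXsubC sub0r exprS !mulNr mul1r mulrCA.
  by rewrite rpredMsign.
have nz_P : P != 0 by rewrite prodf_seq_neq0; apply/allP => r /nz_r.
have [N DN] : exists N, `|P| = N%:R by apply/natrP; rewrite natr_norm_int.
have [s Ds] : exists s : bool, N%:R = (-1) ^+ s * P.
  by exists (P < 0); rewrite -DN real_normrEsign // Rreal_int.
have DNv : N%:R / v = (-1) ^+ s * \prod_(r <- rem v rs) r.
  by rewrite Ds /P (perm_big _ (perm_to_rem v_rs)) big_cons /= [v * _]mulrC !mulrA mulfK.
have le_prod t (nu : aut) : {subset t <= rs} -> (size t <= D)%N ->
    `|nu (\prod_(r <- t) r)| <= (b ^ D)%:R.
  move=> trs szt; rewrite rmorph_prod normr_prod.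
  apply: le_trans (_ : b%:R ^+ size t <= _); last first.
    by rewrite -natrX ler_nat leq_pexp2l.
  elim: t trs {szt} => [|r t IHt] trs; first by rewrite big_nil expr0.
  rewrite big_cons exprS ler_pM ?prodr_ge0 ?le_r ?trs ?mem_head ?IHt //.
  by move=> x xt; rewrite trs // inE xt orbT.
exists N; split.
- by rewrite -(ltr_nat algC) -DN normr_gt0.
- by rewrite -(ler_nat algC) -DN; apply: (le_prod rs (idfun : aut)).
- rewrite DNv rpredMsign big_seq rpred_prod // => r /mem_rem; exact: Ars.
- move=> nu; rewrite DNv rmorphM rmorph_sign normrMsign.
  apply: le_prod; first exact: mem_rem.
  by rewrite size_rem // (leq_trans (leq_pred _)).
Qed.

Lemma coef_prod_XsubC_le (rs : seq algC) i :
  (forall r, r \in rs -> `|r| <= 2) ->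
  `|(\prod_(r <- rs) ('X - r%:P))`_i| <= 3 ^+ size rs.
Proof.
elim: rs i => [|r rs IHrs] i Hrs.
  by rewrite big_nil expr0 coef1; case: (i == 0%N); rewrite ?normr1 ?normr0.
have {}IHrs j : `|(\prod_(r <- rs) ('X - r%:P))`_j| <= 3 ^+ size rs.
  by apply: IHrs => x xrs; apply: Hrs; rewrite inE xrs orbT.
rewrite big_cons mulrBl coefB coefXM mul_polyC coefZ /= exprS.
have -> : 3 * 3 ^+ size rs = 3 ^+ size rs + 2 * 3 ^+ size rs :> algC by ring.
apply: le_trans (ler_normB _ _) _; apply: lerD.
  by case: (i == 0%N); rewrite ?IHrs // normr0 exprn_ge0.
by rewrite normrM ler_pM // Hrs ?mem_head.
Qed.

Lemma small_Aint_finite D : exists Kd : nat, forall (mu : nat -> aut) (s : seq algC),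
  uniq s ->
  (forall u, u \in s -> [/\ u \in Aint, conj_bounded D mu u
     & forall nu : aut, `|nu u| <= 2]) ->
  (size s <= Kd)%N.
Proof.
(* The value [t j] codes the integer [t j - 3 ^ D], so every integer of size at most [3 ^ D]
   occurs. *)
pose poly_of (t : {ffun 'I_D.+1 -> 'I_(2 * 3 ^ D).+1}) : {poly algC} :=
  \poly_(i < D.+1) (if insub i is Some j then (t j)%:R - (3 ^ D)%:R else 0).
pose roots_of (p : {poly algC}) : seq algC := sval (closed_field_poly_normal p).
exists (size (flatten
  [seq roots_of (poly_of t) | t <- enum {: {ffun 'I_D.+1 -> 'I_(2 * 3 ^ D).+1}}])).
move=> mu s uniq_s Hs; apply: uniq_leq_size => // u us.
have [Au conj_u le_u] := Hs u us.
have [rs [_ szrs Drs u_rs conj_rs]] := minCpoly_roots_bounded conj_u.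
have coef_le i : `|(minCpoly u)`_i| <= (3 ^ D)%:R.
  rewrite Drs; apply: le_trans (coef_prod_XsubC_le _ _) _.
    by move=> r /conj_rs[nu <-].
  by rewrite natrX ler_weXn2l // (ler_nat _ 1 3).
have coefP i : {k : 'I_(2 * 3 ^ D).+1 | (minCpoly u)`_i = k%:R - (3 ^ D)%:R}.
  have Zi : (minCpoly u)`_i \in Num.int.
    by move: Au; rewrite unfold_in => /polyOverP.
  have : (minCpoly u)`_i + (3 ^ D)%:R \in Num.nat.
    rewrite natrEint rpredD ?rpred_nat //= -lerBlDr sub0r.
    have := coef_le i; rewrite real_ler_norml ?Rreal_int //; by case/andP.
  move=> /natrP/cid[k Dk].
  have ltk : (k < (2 * 3 ^ D).+1)%N.
    rewrite ltnS -(ler_nat algC) -Dk mul2n -addnn natrD lerD2r.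
    by apply: le_trans (coef_le i); rewrite real_ler_norm ?Rreal_int.
  by exists (Ordinal ltk); rewrite -Dk addrK.
pose t := [ffun i : 'I_D.+1 => sval (coefP i)].
have Dt : poly_of t = minCpoly u.
  apply/polyP => i; rewrite coef_poly; case: ltnP => [ltiD|leDi].
    by rewrite insubT /= ffunE; case: (coefP _).
  rewrite nth_default // Drs size_prod_XsubC; exact: leq_ltn_trans szrs leDi.
apply/flattenP; exists (roots_of (poly_of t)).
  by apply/mapP; exists t => //; rewrite mem_enum.
rewrite /roots_of Dt; case: closed_field_poly_normal => r /= Dr.
have := root_minCpoly u; rewrite Dr rootZ ?root_prod_XsubC //.
by rewrite (monicP (minCpoly_monic u)) oner_eq0.
Qed.

(** * The divisor bound for natural numbers *)

Section DivisorBound.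
Local Open Scope nat_scope.

Lemma size_divisorsM m n : 0 < m -> 0 < n -> coprime m n ->
  size (divisors (m * n)) <= size (divisors m) * size (divisors n).
Proof.
move=> m0 n0 co_mn; rewrite -(size_allpairs muln).
apply: uniq_leq_size; first exact: divisors_uniq.
move=> d; rewrite -dvdn_divisors ?muln_gt0 ?m0 // => dmn.
apply/allpairsP; exists (gcdn d m, gcdn d n) => /=.
rewrite -!dvdn_divisors // !dvdn_gcdr; split=> //.
apply/eqP; rewrite eqn_dvd; apply/andP; split.
  by rewrite muln_gcdl !muln_gcdr !dvdn_gcd dmn dvdn_mulr // dvdn_mulr // dvdn_mull.
rewrite Gauss_dvd ?dvdn_gcdl //.
exact: coprime_dvdl (dvdn_gcdr _ _) (coprime_dvdr (dvdn_gcdr _ _) co_mn).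
Qed.

Lemma size_divisorsX p e : prime p -> size (divisors (p ^ e)) <= e.+1.
Proof.
move=> pr_p; rewrite -[X in _ <= X](size_iota 0) -[X in _ <= X](size_map (expn p)).
apply: uniq_leq_size; first exact: divisors_uniq.
move=> d; rewrite -dvdn_divisors ?expn_gt0 ?prime_gt0 //.
case/dvdn_pfactor=> // i le_ie ->; apply/mapP; exists i => //.
by rewrite mem_iota.
Qed.

(* Small primes contribute at most [L + 1] each; for a prime [p >= 2 ^ t] the
   local factor satisfies [(e + 1) ^ t <= 2 ^ (t e) <= p ^ e]. *)
Lemma divisor_bound_aux t L n : 0 < n -> n <= 2 ^ L ->
  size (divisors n) ^ t
    <= L.+1 ^ (t * count (fun p => p < 2 ^ t) (primes n)) * n.
Proof.
elim/ltn_ind: n => n IHn n0 nL.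
have [n1|n1] := leqP n 1.
  have -> : n = 1 by apply/eqP; rewrite eqn_leq n1.
  by rewrite (_ : divisors 1 = [:: 1]) // exp1n muln0.
set p := pdiv n; have pr_p : prime p := pdiv_prime n1.
have [m co_pm Dn] := pfactor_coprime pr_p n0.
set e := logn p n in Dn.
have e0 : 0 < e by rewrite logn_gt0 mem_primes pr_p n0 pdiv_dvd.
have m0 : 0 < m by move: n0; rewrite Dn muln_gt0 => /andP[].
have pe0 : 0 < p ^ e by rewrite expn_gt0 prime_gt0.
have pe1 : 1 < p ^ e by rewrite -(exp1n e) ltn_exp2r // prime_gt1.
have mn : m < n by rewrite Dn -[X in X < _]muln1 ltn_pmul2l.
have mL : m <= 2 ^ L by apply: leq_trans (ltnW mn) nL.
have eL : e <= L.
  rewrite -(leq_exp2l _ _ (isT : 1 < 2)); apply: leq_trans nL.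
  apply: leq_trans (_ : p ^ e <= _); first by rewrite leq_exp2r // prime_gt1.
  by rewrite Dn leq_pmull.
have Dpr : perm_eq (primes n) (p :: primes m).
  apply: uniq_perm; rewrite ?primes_uniq //=.
    by rewrite primes_uniq andbT mem_primes m0 pr_p /= -prime_coprime.
  move=> x; rewrite Dn primesM // primesX // (primes_prime pr_p).
  by rewrite mem_seq1 in_cons orbC.
have Hd : size (divisors n) <= e.+1 * size (divisors m).
  rewrite {1}Dn mulnC; apply: leq_trans (size_divisorsM _ _ _) _ => //.
    by rewrite coprime_pexpl.
  by rewrite leq_mul2r size_divisorsX ?orbT.
have IH := IHn m mn m0 mL.
rewrite (permP Dpr) /=.
apply: leq_trans (_ : (e.+1 * size (divisors m)) ^ t <= _).
  by case: (t) => // t'; rewrite leq_exp2r.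
rewrite expnMn mulnDr expnD.
have [pt|pt] := ltnP p (2 ^ t).
  rewrite muln1 -mulnA leq_mul //.
    by case: (t) => // t'; rewrite leq_exp2r.
  by apply: leq_trans IH _; rewrite leq_mul2l (ltnW mn) orbT.
rewrite muln0 expn0 mul1n Dn mulnA [X in _ <= X]mulnC leq_mul //.
apply: leq_trans (_ : (2 ^ e) ^ t <= _).
  by case: (t) => // t'; rewrite leq_exp2r // ltn_expl.
by rewrite -expnM mulnC expnM leq_exp2r.
Qed.

(** There are at most [2 ^ t] primes below [2 ^ t]. The parameter [t] stays free; it is chosen later
    with [4 ^ t] close to the logarithm of the size of [A]. *)
Lemma divisor_bound t L n : 0 < n -> n <= 2 ^ L ->
  size (divisors n) ^ t <= L.+1 ^ (t * 2 ^ t) * 2 ^ L.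
Proof.
move=> n0 nL; apply: leq_trans (divisor_bound_aux t n0 nL) _.
rewrite leq_mul // leq_pexp2l //.
rewrite leq_mul2l -size_filter -{2}(size_iota 0 (2 ^ t)); apply/orP; right.
apply: uniq_leq_size; first by rewrite filter_uniq ?primes_uniq.
by move=> p; rewrite mem_filter mem_iota => /andP[].
Qed.
End DivisorBound.

(** * Valuation rings of the algebraic numbers *)

Section ValuationRing.
Import classical_sets.
Local Open Scope classical_set_scope.
Local Open Scope ring_scope.
Variable q : nat.
Hypothesis pr_q : prime q.
Let qC : algC := q%:R.

Let qC0 : qC != 0. Proof. by rewrite pnatr_eq0 -lt0n prime_gt0. Qed.

Let is_ring (A : set algC) :=
  [/\ A 1, (forall x y, A x -> A y -> A (x - y))
    & forall x y, A x -> A y -> A (x * y)].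

Lemma max_subring_exists : exists B : subringClosed algC,
  qC^-1 \notin B /\
  forall A : set algC, is_ring A -> (forall x, x \in B -> A x) ->
    ~ A qC^-1 -> forall x, A x -> x \in B.
Proof.
pose P (A : set algC) := A = set0 \/ is_ring A /\ ~ A qC^-1.
have [|A [PA maxA]] := @Zorn_bigcup algC P.
  move=> F FP totF.
  have [[X FX [x Xx]]|noX] := pselect (exists2 X, F X & exists x, X x); last first.
    left; apply/seteqP; split=> // x [X FX Xx].
    by case: noX; exists X => //; exists x.
  have ringX Y : F Y -> (exists y, Y y) -> is_ring Y /\ ~ Y qC^-1.
    by move=> /FP[-> [y]|].
  have both x1 x2 : (\bigcup_(Y in F) Y) x1 -> (\bigcup_(Y in F) Y) x2 ->
      exists Y, [/\ F Y, Y x1 & Y x2].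
    move=> [Y1 FY1 Y1x] [Y2 FY2 Y2x].
    by have [H|H] := totF _ _ FY1 FY2; [exists Y2|exists Y1]; split=> //; apply: H.
  right; split; first split.
  - by exists X => //; have [|[]] := ringX X FX; first by exists x.
  - move=> x1 x2 /both H /H[Y [FY Y1 Y2]]; exists Y => //.
    by have [|[_ HB _] _] := ringX Y FY; [exists x1|apply: HB].
  - move=> x1 x2 /both H /H[Y [FY Y1 Y2]]; exists Y => //.
    by have [|[_ _ HM] _] := ringX Y FY; [exists x1|apply: HM].
  - by move=> [Y FY Yq]; have [|_] := ringX Y FY; first by exists qC^-1.
(* A maximal element cannot be empty, since the ring of integers satisfies [P]. *)
have [ringA Aq] : is_ring A /\ ~ A qC^-1.
  case: PA => // A0; exfalso.
  have ringZ : is_ring [set x | x \in Num.int].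
    by split=> [|x y /= Hx Hy|x y /= Hx Hy]; rewrite /= ?rpred1 ?rpredB ?rpredM.
  have Zq : ~ [set x : algC | x \in Num.int] qC^-1.
    move=> /= /intrP[z Dz].
    have: (z * q%:Z)%:~R == 1%:~R :> algC.
      by rewrite rmorphM /= -Dz mulVf.
    rewrite eqr_int => /eqP/(congr1 absz); rewrite abszM /= => /eqP.
    by rewrite muln_eq1 => /andP[_ /eqP q1]; move: (prime_gt1 pr_q); rewrite q1.
  apply: (maxA [set x | x \in Num.int]); last by right.
  by rewrite A0; split=> // /(_ 1); apply; rewrite /= rpred1.
have [A1 AB AM] := ringA.
have HS : subring_closed (fun x => `[< A x >]).
  split; rewrite ?unfold_in /=; first exact/asboolP.
    by move=> x y; rewrite !unfold_in => /asboolP Hx /asboolP Hy; apply/asboolP/AB.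
  by move=> x y; rewrite !unfold_in => /asboolP Hx /asboolP Hy; apply/asboolP/AM.
pose S : {pred algC} := fun x => `[< A x >].
pose SM := GRing.isSubringClosed.Build algC S HS.
pose B : subringClosed algC := HB.pack S SM.
have memB x : (x \in B) = `[< A x >] by [].
exists B; split; first by rewrite memB; apply/asboolP.
move=> A' ringA' sAA' A'q x A'x; rewrite memB; apply: contrapT => nAx.
apply: (maxA A'); last by right.
split; first by move=> y Ay; apply: sAA'; rewrite memB; apply/asboolP.
by move=> /(_ x A'x) Ax; apply: nAx; apply/asboolP.
Qed.

(** Chevalley's argument: if [x] and [x^-1] were both outside the maximal [B], then [1 / q] would be
    a polynomial over [B] in each of them, and these two relations would lower each other's degree
    indefinitely. *)
Lemma valuation_ring_exists : exists B : subringClosed algC,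
  qC^-1 \notin B /\ forall x, x \in B \/ x^-1 \in B.
Proof.
have [B [Bq maxB]] := max_subring_exists.
exists B; split=> //.
pose rep x n := exists p : {poly algC},
  [/\ p \is a polyOver B, (size p <= n)%N & p.[x] = qC^-1].
have adj x : x \notin B -> exists n, rep x n.
  move=> Bx; apply: contrapT => norep.
  pose A := [set y | exists2 p : {poly algC}, p \is a polyOver B & p.[x] = y].
  have ringA : is_ring A.
    split=> [|_ _ [p Bp <-] [r Br <-]|_ _ [p Bp <-] [r Br <-]].
    - by exists 1; rewrite ?rpred1 ?hornerE.
    - by exists (p - r); rewrite ?rpredB ?hornerE.
    - by exists (p * r); rewrite ?rpredM ?hornerE.
  move/negP: Bx; apply; apply: (maxB A) => //.
  - by move=> y By; exists y%:P; rewrite ?polyOverC ?hornerE.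
  - by move=> [p Bp Dp]; apply: norep; exists (size p), p.
  - by exists 'X; rewrite ?polyOverX ?hornerE.
(* Otherwise [1 / q] is a polynomial in [c^-1]; clearing denominators by a power of [c], which is 1
   modulo [q], puts [1 / q] in [B]. *)
have unit1 r : r \in B -> (1 - qC * r)^-1 \in B.
  move=> Br; apply: contrapT => /negP Bc; have [n [p [Bp _ Dp]]] := adj _ Bc.
  set c := 1 - qC * r in Bc Dp *.
  have c0 : c != 0 by apply: contraNneq Bc => ->; rewrite invr0 rpred0.
  have Bc' : c \in B by rewrite rpredB ?rpred1 ?rpredM ?rpred_nat.
  have [e Be De] : exists2 e, e \in B & c ^+ size p = 1 - qC * e.
    elim: (size p) => [|k [e Be De]]; first by exists 0; rewrite ?rpred0 // expr0 mulr0 subr0.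
    exists (e + r - qC * r * e); first by rewrite !(rpredB, rpredD, rpredM) ?rpred_nat.
    by rewrite exprS De /c; ring.
  pose d := \sum_(i < size p) p`_i * c ^+ (size p - i).
  have Bd : d \in B by apply: rpred_sum => i _; rewrite rpredM ?rpredX ?(polyOverP Bp).
  have Dd : d = c ^+ size p * qC^-1.
    rewrite -Dp horner_coef mulr_sumr; apply: eq_bigr => i _.
    by rewrite mulrCA exprVn -expfB_cond ?(negPf c0) ?add0n // ltnW.
  move/negP: Bq; apply; have -> : qC^-1 = d + e; last exact: rpredD.
  by rewrite Dd De mulrBl mul1r [qC * e]mulrC mulfK // subrK.
(* Divided by the unit [1 - q * r_0] and multiplied by [x ^ n], the relation in [x^-1] expresses
   [x ^ n] through lower powers, which replace the top term of [p]. *)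
have reduce x n m : x != 0 -> rep x n.+1 -> rep x^-1 m.+1 -> (m <= n)%N -> rep x n.
  move=> x0 [p [Bp szp Dp]] [r [Br szr Dr]] le_mn.
  have Bi s i : s \is a polyOver B -> s`_i \in B by move/polyOverP.
  set c := 1 - qC * r`_0; have Bc : c^-1 \in B by apply: unit1; apply: Bi.
  have c0 : c != 0.
    rewrite subr_eq0 eq_sym; apply: contraNneq Bq => H.
    by rewrite -[qC^-1]mulr1 -H mulKf // Bi.
  pose s := \sum_(j < m) (qC * r`_j.+1 / c) *: 'X^(n - j.+1).
  have Bs : s \is a polyOver B.
    apply: rpred_sum => j _; apply/polyOverP=> i; rewrite coefZ coefXn.
    by rewrite !rpredM ?rpred_nat ?Bi.
  have szs : (size s <= n)%N.
    apply: leq_trans (size_sum _ _ _) _; apply/bigmax_leqP => j _.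
    apply: leq_trans (size_scale_leq _ _) _; rewrite size_polyXn.
    by have := ltn_ord j; lia.
  have Ds : s.[x] = x ^+ n.
    rewrite horner_sum.
    transitivity (x ^+ n / c * \sum_(j < m) qC * r`_j.+1 * x^-1 ^+ j.+1).
      rewrite mulr_sumr; apply: eq_bigr => j _.
      rewrite hornerZ hornerXn exprVn expfB_cond ?(negPf x0) ?add0n; last first.
        by have := ltn_ord j; lia.
      by ring.
    have -> : \sum_(j < m) qC * r`_j.+1 * x^-1 ^+ j.+1 = c.
      have: qC * r.[x^-1] = 1 by rewrite Dr divff.
      rewrite (horner_coef_wide _ szr) big_ord_recl expr0 mulr1 mulrDr => H.
      rewrite /c -H addrC addKr mulr_sumr; apply: eq_bigr => j _.
      by rewrite mulrA.
    by rewrite divfK.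
  exists (p - p`_n *: 'X^n + p`_n *: s); split.
  - rewrite rpredD ?rpredB //.
      by apply/polyOverP=> i; rewrite coefZ coefXn rpredM ?rpred_nat ?Bi.
    by apply/polyOverP=> i; rewrite coefZ rpredM ?Bi.
  - apply: leq_trans (size_polyD _ _) _; rewrite geq_max; apply/andP; split.
      apply/leq_sizeP => j; rewrite coefB coefZ coefXn leq_eqVlt => /predU1P[<-|ltnj].
        by rewrite eqxx mulr1 subrr.
      by rewrite (gtn_eqF ltnj) mulr0 subr0 nth_default // (leq_trans szp).
    exact: leq_trans (size_scale_leq _ _) szs.
  - by rewrite !hornerE Ds subrK.
have norep k : forall x n m, x != 0 -> (n + m <= k)%N -> rep x n -> rep x^-1 m -> False.
  have rep0 x : ~ rep x 0%N.
    move=> [p [_]]; rewrite leqn0 size_poly_eq0 => /eqP ->; rewrite horner0 => /esym/eqP.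
    by rewrite invr_eq0 (negPf qC0).
  elim: k => [|k IHk] x [|n] [|m] x0 lek // Hn Hm; try by [case: (rep0 _ Hn)|case: (rep0 _ Hm)].
  have [le_mn|lt_nm] := leqP m n.
    by apply: (IHk x n m.+1) => //; apply: (reduce x n m).
  apply: (IHk x n.+1 m) => //; first by rewrite addSnnS.
  apply: (reduce _ m n); rewrite ?invr_eq0 ?invrK //; exact: ltnW.
move=> x; have [Bx|Bx] := boolP (x \in B); first by left.
right; apply: contrapT => /negP BVx.
have x0 : x != 0 by apply: contraNneq Bx => ->; rewrite rpred0.
have [[n Hn] [m Hm]] := (adj _ Bx, adj _ BVx).
exact: (norep (n + m)%N x n m).
Qed.
End ValuationRing.

Section Valuation.
Variables (q : nat) (B : subringClosed algC).
Hypotheses (pr_q : prime q) (Bq : (q%:R : algC)^-1 \notin B).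
Hypothesis Btot : forall x, x \in B \/ x^-1 \in B.

(** Nonvanishing is asked separately because [0^-1 = 0] lies in [B]. *)
Definition vunit (x : algC) := [&& x != 0, x \in B & x^-1 \in B].

Let qC0 : (q%:R : algC) != 0. Proof. by rewrite pnatr_eq0 -lt0n prime_gt0. Qed.

Lemma vunitM x y : vunit x -> vunit y -> vunit (x * y).
Proof.
move=> /and3P[x0 Bx Bx'] /and3P[y0 By By'].
by rewrite /vunit mulf_neq0 // invfM !rpredM.
Qed.

Lemma vunitV x : vunit x -> vunit x^-1.
Proof. by move=> /and3P[x0 Bx Bx']; rewrite /vunit invr_eq0 x0 invrK Bx Bx'. Qed.

Lemma vunitX x n : vunit x -> vunit (x ^+ n).
Proof.
move=> Ux; elim: n => [|n IHn]; last by rewrite exprS vunitM.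
by rewrite expr0 /vunit oner_neq0 invr1 rpred1.
Qed.

Lemma vunitX_mem x n : (0 < n)%N -> vunit (x ^+ n) -> x \in B.
Proof.
case: n => // n _ /and3P[_ BX _]; have [//|BVx] := Btot x.
have [->|x0] := eqVneq x 0; first exact: rpred0.
suff -> : x = x ^+ n.+1 * x^-1 ^+ n by exact: rpredM BX (rpredX _ BVx).
by rewrite exprS exprVn mulfK // expf_neq0.
Qed.

(** Valuation rings are local: if [a / c] is in [B] and [a + c] is a unit, then
    [c^-1 = (a / c + 1) / (a + c)] is in [B]. *)
Lemma nonvunitD x y : x \in B -> y \in B -> ~~ vunit x -> ~~ vunit y ->
  ~~ vunit (x + y).
Proof.
have wlog_ a c : a \in B -> c \in B -> ~~ vunit c -> c != 0 -> a / c \in B ->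
    ~~ vunit (a + c).
  move=> Ba Bc; rewrite /vunit Bc /= => nUc c0 Bac; apply: contra nUc.
  rewrite c0 /= => /and3P[s0 _ Bs].
  have -> : c^-1 = (a / c + 1) * (a + c)^-1; last by rewrite rpredM ?rpredD ?rpred1.
  have -> : a / c + 1 = (a + c) / c by rewrite mulrDl divff.
  by rewrite mulrAC divff // mul1r.
move=> Bx By nUx nUy.
have [->|x0] := eqVneq x 0; first by rewrite add0r.
have [->|y0] := eqVneq y 0; first by rewrite addr0.
have [Bxy|] := Btot (x / y); first exact: wlog_.
by rewrite invf_div => Byx; rewrite addrC wlog_.
Qed.

Lemma nonvunit_sum (I : Type) (r : seq I) (P : pred I) (F : I -> algC) :
  (forall i, P i -> F i \in B /\ ~~ vunit (F i)) ->
  ~~ vunit (\sum_(i <- r | P i) F i).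
Proof.
move=> HF; suff: \sum_(i <- r | P i) F i \in B /\ ~~ vunit (\sum_(i <- r | P i) F i) by case.
apply: (big_ind (fun x => x \in B /\ ~~ vunit x)) => //.
  by rewrite rpred0 /vunit eqxx.
by move=> x y [Bx Ux] [By Uy]; rewrite rpredD // nonvunitD.
Qed.

(** By Bezout, 1 is a combination of [c] and the nonunit [q]; were [c] a nonunit too, 1 would be
    one. *)
Lemma vunit_nat c : coprime c q -> vunit c%:R.
Proof.
move=> co_cq; apply: contrapT => /negP nUc.
have nUq : ~~ vunit q%:R by rewrite /vunit qC0 rpred_nat (negPf Bq).
have c0 : (0 < c)%N.
  rewrite lt0n; apply: contraTneq co_cq => ->.
  by rewrite /coprime gcd0n neq_ltn (prime_gt1 pr_q) orbT.
have mulN x n : x \in B -> ~~ vunit x -> ~~ vunit (x * n%:R).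
  move=> Bx; apply: contra => /and3P[]; rewrite mulf_eq0 negb_or => /andP[x0 n0] _.
  rewrite /vunit x0 Bx /= => BV; have -> : x^-1 = (x * n%:R)^-1 * n%:R by rewrite invfM mulfVK.
  by rewrite rpredM ?rpred_nat.
have [km kn Dk _] := egcdnP q c0.
rewrite (eqP co_cq) in Dk.
have Bqn n : - (q%:R * n%:R) \in B by rewrite rpredN -natrM rpred_nat.
have nUN x : ~~ vunit x -> ~~ vunit (- x).
  by rewrite /vunit oppr_eq0 invrN !rpredN.
have : ~~ vunit (c%:R * km%:R + - (q%:R * kn%:R)).
  by rewrite nonvunitD ?nUN ?mulN ?rpred_nat // -natrM rpred_nat.
rewrite -!natrM mulnC Dk natrD mulnC addrC addKr.
by rewrite /vunit oner_neq0 invr1 rpred1.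
Qed.

Lemma vunit_logn n : (0 < n)%N -> vunit (n%:R / q%:R ^+ logn q n).
Proof.
move=> n0; have [m co_qm Dn] := pfactor_coprime pr_q n0.
rewrite {1}Dn natrM natrX mulfK ?expf_neq0 //.
by rewrite vunit_nat // coprime_sym.
Qed.

Lemma vunit_int (z : int) : z != 0 -> vunit (z%:~R / q%:R ^+ logn q `|z|).
Proof.
move=> z0; have := vunit_logn (_ : (0 < `|z|)%N); rewrite absz_gt0 => /(_ z0).
have -> : z%:~R = (-1) ^+ (z < 0)%R * (`|z|%N)%:R :> algC.
  by rewrite {1}(intEsign z) rmorphM rmorph_sign.
move=> H; rewrite -mulrA vunitM //.
by case: (z < 0)%R; rewrite /vunit ?expr0 ?expr1 ?oppr_eq0 ?oner_neq0 ?invrN ?invr1 ?rpredN ?rpred1.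
Qed.

Lemma vring_integral (p : {poly algC}) x :
  p \is monic -> p \is a polyOver B -> root p x -> x \in B.
Proof.
move=> mon_p Bp px0; have [//|BVx] := Btot x.
have [->|x0] := eqVneq x 0; first exact: rpred0.
have szp := root_size_gt1 (monic_neq0 mon_p) px0.
have coefB i : p`_i \in B by apply/polyOverP.
have : p.[x] = 0 by apply/eqP.
rewrite horner_coef; have := monicP mon_p; rewrite lead_coefE.
case: (size p) szp => [|[|d]] //= _ pd; rewrite big_ord_recr /= pd mul1r addrC => /eqP.
rewrite addr_eq0 => /eqP Dx.
have -> : x = - \sum_(i < d.+1) p`_i * x^-1 ^+ (d - i).
  transitivity (x ^+ d.+1 * x^-1 ^+ d); first by rewrite exprS exprVn mulfK ?expf_neq0.
  rewrite Dx mulNr mulr_suml; congr (- _); apply: eq_bigr => i _.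
  rewrite -mulrA !exprVn; congr (_ * _).
  have led : (i <= d)%N by rewrite -ltnS.
  have -> : x ^+ d = x ^+ i * x ^+ (d - i) by rewrite -exprD subnKC.
  by rewrite invfM mulrA divff ?expf_neq0 // mul1r.
by rewrite rpredN rpred_sum // => i _; rewrite rpredM ?rpredX.
Qed.

Lemma Aint_vring x : x \in Aint -> x \in B.
Proof.
move=> Ax; apply: vring_integral (minCpoly_monic x) _ (root_minCpoly x).
move: Ax; rewrite unfold_in => /polyOverP Zp; apply/polyOverP => i.
by have /intrP[z ->] := Zp i; rewrite rpred_int.
Qed.

Lemma vmin_exists (s : seq algC) : s != [::] -> (forall x, x \in s -> x != 0) ->
  exists2 x, x \in s & forall y, y \in s -> y / x \in B.
Proof.
elim: s => // x [|x' s] IHs _ nz.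
  exists x; rewrite ?mem_head // => y; rewrite inE => /eqP ->.
  by rewrite divff ?rpred1 // nz ?mem_head.
have [|z zs Hz] := IHs isT; first by move=> y ys; rewrite nz // inE ys orbT.
have z0 : z != 0 by rewrite nz // inE zs orbT.
have x0 : x != 0 by rewrite nz // mem_head.
have [Bxz|] := Btot (x / z).
  exists z; first by rewrite inE zs orbT.
  by move=> y; rewrite inE => /predU1P[->|/Hz].
rewrite invf_div => Bzx; exists x; first exact: mem_head.
move=> y; rewrite inE => /predU1P[->|/Hz Byz]; first by rewrite divff ?rpred1.
suff -> : y / x = y / z * (z / x) by exact: rpredM.
by rewrite mulrA mulfVK.
Qed.

Lemma qexp_mem a c : q%:R ^+ a / q%:R ^+ c \in B -> (c <= a)%N.
Proof.
move=> H; rewrite leqNgt; apply/negP => lt_ac; move/negP: Bq; apply.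
have -> : (q%:R : algC)^-1 = q%:R ^+ a / q%:R ^+ c * q%:R ^+ (c - a.+1).
  have -> : (q%:R : algC) ^+ c = q%:R ^+ a * (q%:R * q%:R ^+ (c - a.+1)).
    by rewrite -exprS -exprD; congr (_ ^+ _); lia.
  by field; rewrite ?expf_neq0 ?qC0.
by rewrite rpredM // -natrX rpred_nat.
Qed.

(** Newton polygon argument: in [p.[x] = 0] the least valuation is attained twice, so some [x ^ e]
    with [0 < e <= D] has the valuation of a quotient of integers, hence of a power of [q]. As [e]
    divides [D!], one exponent serves every [x] of degree at most [D], and valuations become
    integers without describing a value group. *)
Lemma vexp_exists D x : x \in Aint -> x != 0 -> (size (minCpoly x) <= D.+1)%N ->
  exists s, vunit (x ^+ D`! / q%:R ^+ s).
Proof.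
move=> Ax x0 szD; have Bx := Aint_vring Ax.
have szp := size_minCpoly x; set p := minCpoly x in szp szD *.
have Zp i : exists z : int, p`_i = z%:~R.
  by apply/intrP; move: Ax; rewrite unfold_in => /polyOverP.
pose idx := [seq i <- iota 0 (size p) | p`_i != 0].
pose t i := p`_i * x ^+ i.
have idxP i : (i \in idx) = (p`_i != 0).
  rewrite mem_filter mem_iota /= add0n; case: (ltnP i (size p)) => [_|leps]; first by rewrite andbT.
  by rewrite nth_default // eqxx.
have nz_t i : i \in idx -> t i != 0.
  by rewrite idxP => pi0; rewrite mulf_neq0 ?expf_neq0.
have szp1 : (size p).-1 \in idx.
  by rewrite idxP -lead_coefE (monicP (minCpoly_monic x)) oner_neq0.
have nz_ts x' : x' \in map t idx -> x' != 0 by move=> /mapP[i ii ->]; apply: nz_t.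
have ne_ts : map t idx != [::] by case: (idx) szp1.
have [_ /mapP[i ii ->] Hi] := vmin_exists ne_ts nz_ts.
have ti0 := nz_t _ ii.
(* Otherwise the other terms divided by [t i] would all be nonunits, yet their sum is [-1]. *)
have [j ji /andP[neq_ij Uij]] : exists2 j, j \in idx & (j != i) && vunit (t j / t i).
  apply: contrapT => nex.
  have px0 : p.[x] = 0 by apply/eqP/root_minCpoly.
  have : \sum_(j <- idx) t j = 0.
    transitivity p.[x] => //; rewrite horner_coef -(big_mkord xpredT t) big_filter.
    rewrite [RHS](bigID (fun j => p`_j == 0)) /=.
    rewrite [X in _ = X + _]big1 ?add0r /index_iota ?subn0 // => j /eqP pj0.
    by rewrite /t pj0 mul0r.
  have uniq_idx : uniq idx by rewrite filter_uniq ?iota_uniq.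
  rewrite (bigD1_seq i) //= => /eqP; rewrite addr_eq0 => /eqP Dti.
  have : vunit (\sum_(j <- idx | j != i) - (t j / t i)).
    rewrite sumrN -mulr_suml -mulNr -Dti divff //.
    by rewrite /vunit oner_neq0 invr1 rpred1.
  rewrite big_seq_cond; apply/negP; apply: nonvunit_sum => j /andP[ji neq_ji].
  have Btj : t j / t i \in B by apply: Hi; apply: map_f.
  rewrite rpredN; split=> //; apply/negP => U; case: nex; exists j => //.
  by rewrite neq_ji /=; move: U; rewrite /vunit oppr_eq0 invrN !rpredN.
(* comparing the two terms of least valuation *)
have [e [a [c [e0 eD Ue]]]] : exists e a c, [/\ (0 < e)%N, (e <= D)%N
    & vunit (x ^+ e * q%:R ^+ a / q%:R ^+ c)].
  have ltD k : k \in idx -> (k <= D)%N.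
    rewrite mem_filter mem_iota /= add0n => /andP[_ ltk]; rewrite -ltnS.
    exact: leq_trans ltk szD.
  have aux k l : k \in idx -> l \in idx -> (k < l)%N -> vunit (t l / t k) ->
      exists e a c, [/\ (0 < e)%N, (e <= D)%N & vunit (x ^+ e * q%:R ^+ a / q%:R ^+ c)].
    move=> kI lI lt_kl U; have [[zk Dzk] [zl Dzl]] := (Zp k, Zp l).
    have zk0 : zk != 0 by rewrite -(intr_eq0 algC) -Dzk -idxP.
    have zl0 : zl != 0 by rewrite -(intr_eq0 algC) -Dzl -idxP.
    have [Uk Ul] := (vunit_int zk0, vunit_int zl0).
    exists (l - k)%N, (logn q `|zl|), (logn q `|zk|); split.
    - by rewrite subn_gt0.
    - by apply: leq_trans (ltD _ lI); rewrite leq_subr.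
    have := vunitM (vunitM U Uk) (vunitV Ul).
    rewrite /t Dzk Dzl; congr vunit.
    rewrite -{1}(subnKC (ltnW lt_kl)) exprD.
    by field; rewrite ?expf_neq0 ?qC0 ?x0 ?intr_eq0 ?zk0 ?zl0.
  have [ltij|ltji|E] := ltngtP i j; last by rewrite E eqxx in neq_ij.
    exact: (aux i j).
  by apply: (aux j i) => //; have := vunitV Uij; rewrite invf_div.
have le_ac : (a <= c)%N.
  have /and3P[_ _ BV] := Ue; apply: qexp_mem.
  have -> : (q%:R : algC) ^+ c / q%:R ^+ a = x ^+ e * (x ^+ e * q%:R ^+ a / q%:R ^+ c)^-1.
    by field; rewrite ?expf_neq0 ?qC0 ?x0.
  by rewrite rpredM ?rpredX.
have dv_eD : (e %| D`!)%N by apply: dvdn_fact; rewrite e0.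
exists ((c - a) * (D`! %/ e))%N; have := vunitX (D`! %/ e) Ue; congr vunit.
rewrite -{2}(divnK dv_eD) mulnC !exprM -expr_div_n; congr (_ ^+ _).
by rewrite -{1}(subnKC le_ac) exprD; field; rewrite ?expf_neq0 ?qC0.
Qed.

Lemma vexp_le w s x N : (0 < N)%N -> vunit (x ^+ w / q%:R ^+ s) ->
  N%:R / x \in B -> (s <= w * logn q N)%N.
Proof.
move=> N0 Ux BNx; apply: qexp_mem.
have UN := vunitX w (vunitV (vunit_logn N0)).
have /and3P[_ BN _] := vunitM UN Ux.
have x0 : x != 0 \/ w = 0%N.
  case: w Ux {UN BN} => [|w] Ux; [by right|left].
  apply: contraTneq Ux => ->; by rewrite /vunit expr0n mul0r eqxx.
have -> : (q%:R : algC) ^+ (w * logn q N) / q%:R ^+ s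
   = (N%:R / q%:R ^+ logn q N)^-1 ^+ w * (x ^+ w / q%:R ^+ s) * (N%:R / x) ^+ w.
  have NC0 : (N%:R : algC) != 0 by rewrite pnatr_eq0 -lt0n.
  rewrite invf_div !expr_div_n mulnC exprM.
  by case: x0 => [x0|->]; rewrite ?expr0; field; rewrite ?expf_neq0 ?qC0 ?x0.
by rewrite rpredM ?rpredX.
Qed.

(** If [q] divided the denominator, the numerator would be prime to [q], hence a unit, and dividing
    it out would leave [1 / q] in [B]. *)
Lemma rat_vring_den (a : rat) : ratr a \in B -> ~~ (q %| `|denq a|)%N.
Proof.
move=> Ba; apply/negP => qd.
have co_num : coprime `|numq a| q.
  by rewrite coprime_sym; apply: coprime_dvdl qd _; rewrite coprime_sym coprime_num_den.
have n0 : numq a != 0.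
  apply: contraTneq co_num => ->; rewrite /coprime gcd0n.
  by rewrite neq_ltn (prime_gt1 pr_q) orbT.
have := vunit_nat co_num => /and3P[_ _ BV].
move/negP: Bq; apply.
have d0 : (`|denq a|%:R : algC) != 0 by rewrite pnatr_eq0 absz_eq0 denq_neq0.
have BVi : (numq a)%:~R^-1 \in B.
  move: BV; rewrite {2}(intEsign (numq a)) rmorphM rmorph_sign /= invfM => BV.
  by rewrite rpredM // -exprVn invrN invr1 rpredX // rpredN rpred1.
have -> : (q%:R : algC)^-1 = ratr a * (numq a)%:~R^-1 * (`|denq a| %/ q)%:R.
  have -> : ratr a / (numq a)%:~R = (denq a)%:~R^-1 :> algC.
    by rewrite /ratr mulrAC divff ?mul1r ?intr_eq0.
  have Dd : (denq a)%:~R = (`|denq a| %/ q)%:R * q%:R :> algC.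
    by rewrite -natrM divnK // -[in LHS](gez0_abs (ltW (denq_gt0 a))).
  rewrite Dd invfM [_^-1 * _]mulrC mulfVK //.
  by apply: contraNneq d0 => H; rewrite -(divnK qd) natrM H mul0r.
exact: rpredM (rpredM Ba BVi) (rpred_nat _ _).
Qed.
End Valuation.

Definition vring (q : nat) (B : subringClosed algC) :=
  (q%:R : algC)^-1 \notin B /\ forall x, x \in B \/ x^-1 \in B.

(** The coefficients of the minimal polynomial are rational and are polynomials in the conjugates,
    so they lie in [B] and [q] divides none of their denominators. One ring over each prime is
    enough because all conjugates are tested. *)
Lemma Aint_vringP x :
  (forall q, prime q -> exists2 B, vring q B & forall nu : aut, nu x \in B) ->
  x \in Aint.
Proof.
move=> HB; rewrite unfold_in; apply/polyOverP => k.
have [p [Dp _] _] := minCpolyP x.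
rewrite Dp coef_map /=; apply/intrP.
have den1 : denq p`_k = 1.
  suff: `|denq p`_k|%N = 1%N by move=> H; rewrite -(gez0_abs (ltW (denq_gt0 _))) H.
  apply/eqP; apply: contrapT => /negP neq1.
  have gt1 : (1 < `|denq p`_k|)%N by rewrite ltn_neqAle eq_sym neq1 absz_gt0 denq_neq0.
  set q := pdiv `|denq p`_k|; have pr_q : prime q := pdiv_prime gt1.
  have [B [Bq Btot] HBx] := HB q pr_q.
  have : ratr p`_k \in B.
    rewrite -coef_map -Dp; have [rs [_ -> Hrs]] := minCpoly_roots x.
    apply/polyOverP; rewrite big_seq rpred_prod // => r /Hrs[nu <-].
    by rewrite polyOverXsubC.
  by move=> /(rat_vring_den pr_q Bq Btot); rewrite pdiv_dvd.
by exists (numq p`_k); rewrite /ratr den1 divr1.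
Qed.

(** Valuation rings are integrally closed, and each conjugate of [x] is a root of the conjugate of
    [p], whose coefficients are again algebraic integers. *)
Lemma Aint_integrally_closed (p : {poly algC}) x :
  p \is monic -> p \is a polyOver Aint -> root p x -> x \in Aint.
Proof.
move=> mon_p Ap px0; apply: Aint_vringP => q pr_q.
have [B [Bq Btot]] := valuation_ring_exists pr_q; exists B => // nu.
apply: (@vring_integral B Btot (map_poly nu p)); rewrite ?map_monic ?fmorph_root //.
apply/polyOverP => i; rewrite coef_map (Aint_vring Btot) // Aint_aut.
exact: (polyOverP Ap).
Qed.

(** * Divisors in a number field *)

Lemma size_le_fiber (X : eqType) (T : finType) (f : X -> T) (k : nat) (s : seq X) :
  (forall t, size [seq x <- s | f x == t] <= k)%N -> (size s <= k * #|T|)%N.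
Proof.
move=> le_k; have -> : size s = (\sum_(t : T) size [seq x <- s | f x == t])%N.
  under eq_bigr do rewrite size_filter.
  elim: s {le_k} => [|x s IHs]; first by rewrite big1.
  rewrite /= big_split /= -IHs (bigD1 (f x)) //= eqxx big1 ?addn0 // => t.
  by rewrite eq_sym => /negPf ->.
have -> : (k * #|T| = \sum_(t : T) k)%N by rewrite sum_nat_const mulnC.
by apply: leq_sum => t _; apply: le_k.
Qed.

Lemma logn_prod_primes (s : seq nat) (e : nat -> nat) q :
  uniq s -> (forall p, p \in s -> prime p) -> q \in s ->
  logn q (\prod_(p <- s) p ^ e p) = e q.
Proof.
elim: s => // p s IHs /= /andP[ps us] pr_s qs.
have pr_p : prime p by rewrite pr_s ?mem_head.
have pr_s' x : x \in s -> prime x by move=> xs; rewrite pr_s // inE xs orbT.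
have gt0 : (0 < \prod_(x <- s) x ^ e x)%N.
  by rewrite big_seq prodn_cond_gt0 // => x /pr_s' pr_x; rewrite expn_gt0 prime_gt0.
have pe0 : (0 < p ^ e p)%N by rewrite expn_gt0 prime_gt0.
rewrite big_cons (lognM _ pe0 gt0) lognX.
move: qs; rewrite inE => /predU1P[->|qs].
  rewrite logn_prime // eqxx muln1 -[RHS]addn0; congr (_ + _)%N.
  apply: logn_coprime; rewrite big_seq; elim/big_rec: _ => [|x y xs co]; first exact: coprimen1.
  rewrite coprimeMr co andbT coprimeXr // prime_coprime // (dvdn_prime2 pr_p (pr_s' _ xs)).
  by apply/negP => /eqP E; move: ps; rewrite E xs.
rewrite IHs // (logn_prime q pr_p) (_ : (q == p) = false) ?muln0 //.
by apply: contraNF ps => /eqP <-.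
Qed.

Lemma prod_primes_dvd (N w : nat) (e : nat -> nat) : (0 < N)%N ->
  (forall q, q \in primes N -> e q <= w * logn q N)%N ->
  (\prod_(q <- primes N) q ^ e q %| N ^ w)%N.
Proof.
move=> N0 le_e; rewrite {2}(prod_prime_decomp N0) prime_decompE big_map /=.
rewrite (big_morph (fun x => x ^ w)%N (fun x y => expnMn x y w) (exp1n w)).
rewrite big_seq [X in (_ %| X)%N]big_seq; apply: (big_ind2 (fun x y => x %| y)%N) => //.
  by move=> *; apply: dvdn_mul.
by move=> q qN; rewrite -expnM mulnC dvdn_exp2l ?le_e.
Qed.

Lemma divisors_number_field D : exists Kd : nat,
  forall (mu : nat -> aut) (b : nat) (m : algC) (Xi : seq algC),
  (0 < b)%N -> m != 0 -> uniq Xi ->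
  (forall nu : aut, exists2 i, (i < D)%N &
     forall x, x \in m :: Xi -> nu x = mu i x) ->
  (forall x, x \in Xi -> [/\ x != 0, x \in Aint, m / x \in Aint &
     forall nu : aut, `|nu x| <= b%:R /\ `|nu (m / x)| <= b%:R]) ->
  exists N, [/\ (0 < N)%N, (N <= b ^ (2 * D))%N &
    (size Xi <= Kd * ((trunc_log 2 (b ^ (2 * D + 2))).+1 *
                      size (divisors (N ^ D`!))) ^ D)%N].
Proof.
have [Kd HKd] := small_Aint_finite D; exists Kd => mu b m Xi b0 m0 uXi agree HXi.
have [XiE|[x0 x0X]] : Xi = [::] \/ exists x0, x0 \in Xi.
  by case: (Xi) => [|x s]; [left|right; exists x; rewrite mem_head].
  by exists 1%N; rewrite expn_gt0 b0 XiE.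
have nzX x : x \in Xi -> x != 0 by case/HXi.
have AX x : x \in Xi -> x \in Aint by case/HXi.
have AmX x : x \in Xi -> m / x \in Aint by case/HXi.
have mdiv x : x \in Xi -> m = x * (m / x) by move=> xX; rewrite mulrC divfK ?nzX.
have Am : m \in Aint.
  by have := rpredM (AX _ x0X) (AmX _ x0X); rewrite -(mdiv _ x0X).
have agX x : x \in m :: Xi -> conj_bounded D mu x.
  by move=> xX nu; have [i ltiD Hi] := agree nu; exists i => //; apply: Hi.
have agXi x : x \in Xi -> conj_bounded D mu x.
  by move=> xX; apply: agX; rewrite inE xX orbT.
have le_m (nu : aut) : `|nu m| <= (b * b)%:R.
  have [_ _ _ /(_ nu)[le1 le2]] := HXi _ x0X.
  by rewrite (mdiv _ x0X) rmorphM normrM natrM ler_pM.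
have bb0 : (0 < b * b)%N by rewrite muln_gt0 b0.
have [N [N0 leN ANm le_Nm]] := Aint_norm bb0 Am m0 (agX _ (mem_head _ _)) le_m.
have DbD : ((b * b) ^ D = b ^ (2 * D))%N by rewrite mulnn -expnM.
rewrite DbD in leN le_Nm.
exists N; split=> //; set w := D`!; set L := trunc_log _ _.
have w0 : (0 < w)%N := fact_gt0 D.
set divs := divisors (N ^ w).
have Nw0 : (0 < N ^ w)%N by rewrite expn_gt0 N0.
have HB0 q : exists B : subringClosed algC, prime q -> vring q B.
  have [pr_q|_] := boolP (prime q).
    by have [B HB] := valuation_ring_exists pr_q; exists B.
  by have [B HB] := valuation_ring_exists (isT : prime 2); exists B.
have [B HB] := boolp.choice HB0.
have HE0 (qx : nat * algC) : exists s, prime qx.1 -> qx.2 \in Aint ->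
    qx.2 != 0 -> (size (minCpoly qx.2) <= D.+1)%N ->
    vunit (B qx.1) (qx.2 ^+ w / qx.1%:R ^+ s).
  case: qx => q x /=.
  have [pr_q|npr] := boolP (prime q); last by exists 0%N.
  have [Ax|nAx] := boolP (x \in Aint); last by exists 0%N.
  have [->|x0'] := eqVneq x 0; first by exists 0%N.
  have [szx|szx] := leqP (size (minCpoly x)) D.+1; last by exists 0%N.
  have [Bq Btot] := HB q pr_q.
  by have [s Hs] := vexp_exists pr_q Bq Btot Ax x0' szx; exists s.
have [E HE] := boolp.choice HE0.
have {}HE q i x : prime q -> x \in Xi ->
    vunit (B q) (mu i x ^+ w / q%:R ^+ E (q, mu i x)).
  move=> pr_q xX; apply: (HE (q, mu i x)); rewrite //= ?Aint_aut ?AX ?fmorph_eq0 ?nzX //.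
  rewrite minCpoly_aut; have [rs [_ szrs -> _ _]] := minCpoly_roots_bounded (agXi _ xX).
  by rewrite size_prod_XsubC.
(* [x] divides [m], which divides the integer [N], so valuations of [x] are bounded by those of
   [N]. *)
have le_E q i x : prime q -> x \in Xi -> (E (q, mu i x) <= w * logn q N)%N.
  move=> pr_q xX; have [Bq Btot] := HB q pr_q.
  apply: (vexp_le pr_q Bq Btot N0 (HE q i x pr_q xX)).
  apply: (Aint_vring Btot); have -> : N%:R / mu i x = mu i ((N%:R / m) * (m / x)).
    by rewrite mulrA divfK // fmorph_div rmorph_nat.
  by rewrite Aint_aut rpredM ?AmX.
pose nn i x := (\prod_(q <- primes N) q ^ E (q, mu i x))%N.
have nnP i x : x \in Xi -> nn i x \in divs.
  move=> xX; rewrite -dvdn_divisors //; apply: (@prod_primes_dvd N w) => // q.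
  by rewrite mem_primes => /and3P[pr_q _ _]; apply: le_E.
(* In [N = x * (m / x) * (N / m)] the last two factors have conjugates at most [b] and
   [b ^ (2 * D)]; scaling by their product makes every size at least 1, so dyadic logarithms lie
   between 0 and [L]. *)
pose beta := (b ^ (2 * D).+1)%N.
have beta0 : 0 < (beta%:R : algC) by rewrite ltr0n expn_gt0 b0.
pose zz i x : algC := beta%:R * `|mu i x|.
have zz_ge1 i x : x \in Xi -> 1 <= zz i x.
  move=> xX; have [_ _ _ /(_ (mu i))[_ le2]] := HXi _ xX.
  have H1 : N%:R = mu i x * (mu i (m / x) * mu i (N%:R / m)).
    rewrite -!rmorphM mulrA [x * _]mulrC divfK ?nzX // mulrC divfK //.
    by rewrite rmorph_nat.
  have: 1 <= `|N%:R : algC| by rewrite normr_nat (ler_nat _ 1).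
  rewrite H1 !normrM => le1; apply: le_trans le1 _.
  rewrite /zz mulrC ler_pM ?mulr_ge0 //.
  by rewrite /beta expnS natrM ler_pM.
have zz_le i x : x \in Xi -> zz i x <= (b ^ (2 * D + 2))%:R.
  move=> xX; have [_ _ _ /(_ (mu i))[le1 _]] := HXi _ xX.
  rewrite /zz /beta addn2 [X in _ <= X%:R]expnS natrM mulrC.
  by rewrite ler_pM.
pose tr i x := Num.trunc (zz i x).
have trP i x : x \in Xi -> (tr i x)%:R <= zz i x < (tr i x).+1%:R.
  by move=> xX; apply: trunc_itv; apply: le_trans (zz_ge1 i x xX).
have tr0 i x : x \in Xi -> (0 < tr i x)%N.
  move=> xX; have /andP[_ lt] := trP i x xX.
  by have := le_lt_trans (zz_ge1 i x xX) lt; rewrite (ltr_nat _ 1).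
pose la i x := trunc_log 2 (tr i x).
have laL i x : x \in Xi -> (la i x < L.+1)%N.
  move=> xX; rewrite ltnS; apply: leq_trunc_log; rewrite -(ler_nat algC).
  by have /andP[le _] := trP i x xX; apply: le_trans le (zz_le i x xX).
pose f x := [ffun i : 'I_D => (inord (la i x) : 'I_L.+1,
   insubd (SeqSub (divisor1 (N ^ w))) (nn i x))].
have cardT : #|{ffun 'I_D -> 'I_L.+1 * seq_sub divs}| = ((L.+1 * size divs) ^ D)%N.
  by rewrite card_ffun card_prod !card_ord card_seq_sub ?divisors_uniq.
rewrite -cardT; apply: (@size_le_fiber _ _ f) => t.
set F := [seq x <- Xi | f x == t].
have [FE|[x1]] : F = [::] \/ exists x1, x1 \in F.
  by case: (F) => [|x s]; [left|right; exists x; rewrite mem_head].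
  by rewrite FE.
rewrite mem_filter => /andP[/eqP fx1 x1X].
have FP x : x \in F -> x \in Xi /\ forall i, (i < D)%N -> la i x = la i x1 /\ nn i x = nn i x1.
  rewrite mem_filter => /andP[/eqP fx xX]; split=> // i ltiD.
  have /ffunP/(_ (Ordinal ltiD)) : f x = f x1 by rewrite fx.
  rewrite !ffunE => -[/= /(congr1 val) /=]; rewrite !inordK ?laL // => -> /(congr1 val).
  by rewrite !insubdK //; apply: nnP.
have divx1_inj : injective (fun x => x / x1) by apply: mulIf; rewrite invr_eq0 nzX.
rewrite -(size_map (fun x => x / x1)); apply: (HKd mu).
  by rewrite map_inj_uniq // filter_uniq.
move=> _ /mapP[x /FP[xX Hx] ->].
have agu (nu : aut) : exists2 i, (i < D)%N & nu (x / x1) = mu i (x / x1).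
  have [i ltiD Hi] := agree nu; exists i => //.
  by rewrite !fmorph_div !Hi // inE ?xX ?x1X orbT.
have le2 (nu : aut) : `|nu (x / x1)| <= 2.
  have [i ltiD ->] := agu nu; have [Dla _] := Hx i ltiD.
  rewrite fmorph_div normf_div ler_pdivrMr ?normr_gt0 ?fmorph_eq0 ?nzX //.
  rewrite -(ler_pM2l beta0) mulrCA -/(zz i x) -/(zz i x1).
  have /andP[_ /ltW le_z] := trP i x xX; apply: le_trans le_z _.
  have /andP[le_z1 _] := trP i x1 x1X.
  (* Both truncations have the same dyadic logarithm, so [tr i x + 1] is at most twice [tr i x1]. *)
  apply: le_trans (_ : 2 * (tr i x1)%:R <= _); last by rewrite ler_pM2l.
  rewrite -natrM ler_nat.
  have /andP[_ lt1] := trunc_log_bounds (isT : (1 < 2)%N) (tr0 i x xX).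
  have /andP[le1 _] := trunc_log_bounds (isT : (1 < 2)%N) (tr0 i x1 x1X).
  rewrite -/(la i x) Dla in lt1; apply: leq_trans lt1 _.
  by rewrite expnS leq_mul2l.
split=> //; apply: Aint_vringP => q pr_q; have [Bq Btot] := HB q pr_q.
exists (B q) => // nu; have [i ltiD ->] := agu nu.
apply: (vunitX_mem Btot w0).
have := vunitM (HE q i x pr_q xX) (vunitV (HE q i x1 pr_q x1X)).
(* At primes not dividing [N] both exponents are 0; at the others they are read off from [nn] by
   unique factorization. *)
have -> : E (q, mu i x) = E (q, mu i x1).
  have [qN|qN] := boolP (q \in primes N); last first.
    have l0 : logn q N = 0%N by apply/eqP; rewrite -leqn0 leqNgt logn_gt0.
    have := le_E q i x pr_q xX; have := le_E q i x1 pr_q x1X.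
    by rewrite l0 muln0 !leqn0 => /eqP -> /eqP ->.
  have [_ /(congr1 (logn q))] := Hx i ltiD; rewrite /nn.
  have prP p : p \in primes N -> prime p by rewrite mem_primes => /and3P[].
  by rewrite !(@logn_prod_primes _ (fun q => E (q, mu i _))) ?primes_uniq.
congr vunit; rewrite fmorph_div expr_div_n.
have q0 : (q%:R : algC) != 0 by rewrite pnatr_eq0 -lt0n prime_gt0.
by field; rewrite ?expf_neq0 ?q0 ?fmorph_eq0 ?nzX.
Qed.

(** * Expressions of bounded complexity *)

Section Levels.
Variable T : comNzRingType.

(** The single fused operation [a * b + c * d] covers sums, differences and products, so that
    inductions on complexity have one case. *)
Fixpoint lev (S : T -> Prop) (k : nat) (z : T) : Prop :=
  if k is k'.+1 then
    exists a b c d, [/\ lev S k' a, lev S k' b, lev S k' c, lev S k' d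
                      & z = a * b + c * d]
  else S z.

Variable S : T -> Prop.
Hypotheses (S0 : S 0) (S1 : S 1) (SN1 : S (-1)).

Lemma lev_consts k : [/\ lev S k 0, lev S k 1 & lev S k (-1)].
Proof.
elim: k => [|k [H0 H1 HN]] //=; split.
- by exists 0, 0, 0, 0; split=> //; rewrite mul0r addr0.
- by exists 1, 1, 0, 0; split=> //; rewrite mul0r addr0 mulr1.
- by exists 1, (-1), 0, 0; split=> //; rewrite mul0r addr0 mul1r.
Qed.

Lemma lev0 k : lev S k 0. Proof. by case: (lev_consts k). Qed.
Lemma lev1 k : lev S k 1. Proof. by case: (lev_consts k). Qed.
Lemma levN1 k : lev S k (-1). Proof. by case: (lev_consts k). Qed.

Lemma lev_leq k l z : (k <= l)%N -> lev S k z -> lev S l z.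
Proof.
move=> /subnK <-; elim: (l - k)%N => // n IHn Hz.
exists z, 1, 0, 0; rewrite mulr1 mul0r addr0.
by split=> //; [apply: IHn | apply: lev1 | apply: lev0 | apply: lev0].
Qed.

Lemma levM k a b : lev S k a -> lev S k b -> lev S k.+1 (a * b).
Proof.
by move=> Ha Hb; exists a, b, 0, 0; rewrite mul0r addr0; split; rewrite ?lev0 //; apply: lev0.
Qed.

Lemma levD k a b : lev S k a -> lev S k b -> lev S k.+1 (a + b).
Proof.
by move=> Ha Hb; exists a, 1, b, 1; rewrite !mulr1; split=> //; apply: lev1.
Qed.

Lemma levB k a b : lev S k a -> lev S k b -> lev S k.+1 (a - b).
Proof.
move=> Ha Hb; exists a, 1, (-1), b; rewrite mulr1 mulN1r.
by split=> //; [apply: lev1 | apply: levN1].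
Qed.

Lemma levX k a n : lev S k a -> lev S (k + n) (a ^+ n).
Proof.
move=> Ha; elim: n => [|n IHn]; first by rewrite expr0; apply: lev1.
by rewrite exprS addnS; apply: levM => //; apply: lev_leq Ha; rewrite leq_addr.
Qed.

Lemma lev_sum k n (f : 'I_n -> T) :
  (forall i, lev S k (f i)) -> lev S (k + n) (\sum_i f i).
Proof.
elim: n f => [|n IHn] f Hf; first by rewrite big_ord0; apply: lev0.
rewrite big_ord_recr addnS; apply: levD; first exact: IHn.
by apply: lev_leq (Hf _); rewrite leq_addr.
Qed.

Definition polylev k (P : {poly T}) := forall i, lev S k P`_i.

Lemma polylev_leq k l P : (k <= l)%N -> polylev k P -> polylev l P.
Proof. by move=> kl HP i; apply: lev_leq (HP i). Qed.

Lemma polylev0 k : polylev k 0.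
Proof. by move=> i; rewrite coef0; apply: lev0. Qed.

Lemma polylevD k P Q : polylev k P -> polylev k Q -> polylev k.+1 (P + Q).
Proof. by move=> HP HQ i; rewrite coefD; apply: levD. Qed.

Lemma polylevM k n (P Q : {poly T}) : (size (P * Q)%R <= n)%N ->
  polylev k P -> polylev k Q -> polylev (k.+1 + n) (P * Q).
Proof.
move=> szn HP HQ i; have [ltin|leni] := ltnP i n; last first.
  by rewrite nth_default ?(leq_trans szn) //; apply: lev0.
rewrite coefM; apply: (@lev_leq (k.+1 + i.+1)); first by rewrite leq_add2l.
by apply: lev_sum => j; apply: levM.
Qed.

(** Level of the coefficients in [lev_adjoin]: a product of size at most [(2 ^ k).+1] costs one
    level for the products of coefficients and [(2 ^ k).+1] for their sum, and adding two such
    products costs one more. *)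
Fixpoint kappa (k : nat) : nat :=
  if k is k'.+1 then (kappa k' + (2 ^ k).+3)%N else 0.

Lemma lev_adjoin (g : T) k z : lev (fun x => S x \/ x = g) k z ->
  exists P, [/\ polylev (kappa k) P, (size P <= (2 ^ k).+1)%N & z = P.[g]].
Proof.
elim: k z => [|k IHk] z.
  move=> [Sz|->].
    exists z%:P; rewrite hornerC; split=> //; last exact: leq_trans (size_polyC_leq1 _) _.
    by move=> i; rewrite coefC; case: eqP => //= _; apply: S0.
  exists 'X; rewrite hornerX size_polyX; split=> // i.
  by rewrite coefX /=; case: (i == 1%N).
move=> [a [b [c [d [/IHk[Pa [Ha sa ->]] /IHk[Pb [Hb sb ->]]
  /IHk[Pc [Hc sc ->]] /IHk[Pd [Hd sd ->]] ->]]]]].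
have szM (P Q : {poly T}) : (size P <= (2 ^ k).+1 -> size Q <= (2 ^ k).+1 ->
    size (P * Q)%R <= (2 ^ k.+1).+1)%N.
  move=> sP sQ; apply: leq_trans (size_polyMleq _ _) _.
  by rewrite expnS; lia.
exists (Pa * Pb + Pc * Pd); split.
- rewrite /= -addSnnS addnS -addSn.
  by apply: polylevD; apply: polylevM => //; apply: szM.
- by apply: leq_trans (size_polyD _ _) _; rewrite geq_max !szM.
- by rewrite hornerD !hornerM.
Qed.

(** Inverses are not expressions over [S], so the leading coefficient is multiplied in instead of
    divided out; four levels are reserved for each elimination step. *)
Lemma pseudo_division k G : polylev k G -> forall n P, polylev k P ->
  (size P <= n)%N -> G != 0 -> exists m Q R,
  [/\ lead_coef G ^+ m *: P = Q * G + R, (size R < size G)%N,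
      polylev (k + 4 * n) R, polylev (k + 4 * n) Q
    & (m <= n)%N /\ (size Q <= (size P - size G).+1)%N].
Proof.
move=> HG n; elim: n k G HG => [|n IHn] k G HG P HP szP nzG.
  exists 0%N, 0, P; rewrite expr0 scale1r mul0r add0r size_poly0 addn0.
  split=> //; last exact: polylev0.
  by apply: leq_ltn_trans szP _; rewrite size_poly_gt0.
have [ltPG|leGP] := ltnP (size P) (size G).
  exists 0%N, 0, P; rewrite expr0 scale1r mul0r add0r size_poly0.
  by split=> //; [apply: polylev_leq HP; rewrite leq_addr|apply: polylev0].
have sG0 : (0 < size G)%N by rewrite size_poly_gt0.
set j := (size P - size G)%N.
pose P' := lead_coef G *: P - (lead_coef P *: 'X^j) * G.
have DP' i : P'`_i = lead_coef G * P`_i - lead_coef P * (if (i < j)%N then 0 else G`_(i - j)).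
  by rewrite coefB coefZ -scalerAl coefZ coefXnM.
have HP' : polylev k.+2 P'.
  move=> i; rewrite DP'; apply: levB; apply: levM; rewrite ?lead_coefE //.
  by case: ifP => _ //; apply: lev0.
have szP' : (size P' <= (size P).-1)%N.
  apply/leq_sizeP => i lei; rewrite DP'.
  have [Di|ltPi] : i = (size P).-1 \/ (size P <= i)%N by lia.
    rewrite ifF; last by rewrite Di /j; lia.
    have -> : P`_i = lead_coef P by rewrite lead_coefE Di.
    have -> : G`_(i - j) = lead_coef G.
      by rewrite lead_coefE; congr (_`_ _); rewrite Di /j; lia.
    by rewrite mulrC subrr.
  rewrite nth_default // mulr0 ifF; last by rewrite /j; lia.
  have leG : (size G <= i - j)%N by rewrite /j; lia.
  rewrite [G`_(i - j)]nth_default //.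
  by rewrite mulr0 subrr.
have HG2 : polylev k.+2 G by apply: polylev_leq HG; rewrite ltnW.
have szP'n : (size P' <= n)%N by lia.
have [m [Q [R [DE szR HR HQ [lemn szQ]]]]] := IHn k.+2 G HG2 P' HP' szP'n nzG.
exists m.+1, (Q + (lead_coef G ^+ m * lead_coef P) *: 'X^j), R; split=> //.
- rewrite mulrDl addrAC -DE /P' scalerBr !scalerA -!scalerAl scalerA exprSr.
  by rewrite subrK.
- by apply: polylev_leq HR; lia.
- apply: (@polylev_leq (k.+2 + 4 * n).+1); first by lia.
  apply: polylevD => // i; rewrite coefZ coefXn.
  apply: (@lev_leq (k + n).+2); first by lia.
  apply: levM; last by case: (i == j); [apply: lev1|apply: lev0].
  apply: levM; last by rewrite lead_coefE; apply: lev_leq (HP _); rewrite leq_addr.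
  apply: (@lev_leq (k + m)); first by rewrite leq_add2l.
  by apply: levX; rewrite lead_coefE; apply: HG.
- split=> //; apply: leq_trans (size_polyD _ _) _; rewrite geq_max; apply/andP; split.
    by apply: leq_trans szQ _; rewrite ltnS leq_sub2r // (leq_trans szP') // leq_pred.
  by apply: leq_trans (size_scale_leq _ _) _; rewrite size_polyXn.
Qed.
End Levels.

Lemma root_le_Cauchy (p : {poly algC}) (z M C : algC) : 1 <= M -> 1 <= C ->
  (forall i, `|p`_i| <= M) -> 1 <= C * `|lead_coef p| -> root p z ->
  `|z| <= (size p)%:R * M * C.
Proof.
move=> M1 C1 leM leC /eqP pz0.
have M0 : 0 <= M := le_trans ler01 M1; have C0 : 0 <= C := le_trans ler01 C1.
have nz_p : p != 0.
  by apply: contraTneq leC => ->; rewrite lead_coef0 normr0 mulr0 ler10.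
have szp : (1 <= size p)%N by rewrite size_poly_gt0.
have b1 : 1 <= (size p)%:R * M * C.
  by rewrite !mulr_ege1 // (ler_nat _ 1).
have [lez1|] := real_leP (normr_real z) (real1 _); first exact: le_trans lez1 b1.
move=> /ltW gez1.
have: `|lead_coef p * z ^+ (size p).-1| <= (size p)%:R * M * `|z| ^+ (size p).-2.
  move: pz0; rewrite horner_coef lead_coefE; case: (size p) szp => // d _.
  rewrite big_ord_recr /= addrC => /eqP; rewrite addr_eq0 => /eqP ->.
  rewrite normrN; apply: le_trans (ler_norm_sum _ _ _) _.
  apply: le_trans (_ : \sum_(i < d) M * `|z| ^+ d.-1 <= _).
    apply: ler_sum => i _; rewrite normrM normrX ler_pM ?exprn_ge0 //.
    by rewrite ler_weXn2l //; have := ltn_ord i; lia.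
  rewrite sumr_const card_ord -[X in X <= _]mulr_natl mulrA ler_wpM2r ?exprn_ge0 //.
  by rewrite ler_wpM2r // ler_nat.
rewrite normrM normrX => le1.
have : size p != 1%N.
  apply: contra_eq_neq pz0 => /eqP; rewrite size_poly_eq1 => H.
  have /size_poly1P[c c0 ->] : size p == 1%N by rewrite size_poly_eq1.
  by rewrite hornerC.
case: (size p) szp le1 => [|[|d]] //= _ le1 _.
have zd : 0 < `|z| ^+ d by rewrite exprn_gt0 // (lt_le_trans ltr01 gez1).
rewrite -(ler_pM2r zd); apply: le_trans (_ : C * (`|lead_coef p| * `|z| ^+ d.+1) <= _).
  by rewrite -exprS mulrA ler_peMl ?exprn_ge0.
by rewrite [_ * C]mulrC -mulrA ler_wpM2l // mulrC.
Qed.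

(** * Lifting to the algebraic numbers *)

(* [S] is a set of pairs (element of [F], lift): zero tests of expressions of
   level [K] agree on both sides, and the lifts have conjugates and a common
   denominator at most [b] and at most [D] distinct systems of conjugates. *)
Record good (F : fieldType) (S : F * algC -> Prop) (K D b : nat) : Prop := Good {
  good0 : S 0;
  good1 : S 1;
  goodN1 : S (-1);
  good_zero : forall z, lev S K z -> (z.1 == 0) = (z.2 == 0);
  good_bound : forall z, S z -> forall nu : aut, `|nu z.2| <= b%:R;
  good_den : exists Delta : nat, [/\ (0 < Delta)%N, (Delta <= b)%N
    & forall z, S z -> Delta%:R * z.2 \in Aint];
  good_conj : exists mu : nat -> aut, forall nu : aut,
    exists2 i, (i < D)%N & forall z, S z -> nu z.2 = mu i z.2 }.

(** [b ^ (2 ^ k + 2 * 3 ^ k)] bounds the conjugates of a level-[k] lift times its denominator, a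
    norm has at most [D] such factors, and the last [2 ^ k] pays for the denominator. *)
Definition cnorm (k D : nat) : nat := ((2 ^ k + 2 * 3 ^ k) * D + 2 ^ k)%N.

Section Good.
Variables (F : fieldType) (S : F * algC -> Prop) (K D b : nat).
Hypotheses (hb : (2 <= b)%N) (hS : good S K D b).

Let b0 : (0 < b)%N. Proof. exact: leq_trans hb. Qed.

(** One level turns a bound [M] into [2 * M ^ 2], which is at most [M ^ 3] since [M >= 2]. *)
Lemma lev_bound k z (nu : aut) : lev S k z -> `|nu z.2| <= (b ^ (2 * 3 ^ k))%:R.
Proof.
elim: k z => [|k IHk] z.
  move=> Sz; apply: le_trans (good_bound hS Sz nu) _.
  by rewrite ler_nat expn0 muln1 -[X in (X <= _)%N]expn1 leq_pexp2l.
move=> [a [a' [c [c' [/IHk Ha /IHk Ha' /IHk Hc /IHk Hc' ->]]]]] /=.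
set M := (b ^ (2 * 3 ^ k))%N in Ha Ha' Hc Hc'.
have -> : (b ^ (2 * 3 ^ k.+1) = M * (M * M))%N.
  by rewrite -!expnD; congr (_ ^ _)%N; rewrite expnS; lia.
rewrite rmorphD !rmorphM; apply: le_trans (ler_normD _ _) _; rewrite !normrM.
have M2 : (2 <= M)%N.
  by apply: leq_trans hb _; rewrite -[X in (X <= _)%N]expn1 leq_pexp2l // muln_gt0 expn_gt0.
apply: le_trans (_ : 2 * (M%:R * M%:R) <= _); last first.
  by rewrite -!natrM ler_nat leq_mul2r M2 orbT.
by rewrite mulr_natl mulr2n lerD // ler_pM.
Qed.

Lemma lev_den (Delta : nat) k z : (forall y, S y -> Delta%:R * y.2 \in Aint) ->
  lev S k z -> (Delta ^ 2 ^ k)%:R * z.2 \in Aint.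
Proof.
move=> HD; elim: k z => [|k IHk] z; first by rewrite expn0 expn1; apply: HD.
move=> [a [a' [c [c' [/IHk Ha /IHk Ha' /IHk Hc /IHk Hc' ->]]]]] /=.
set d := (Delta ^ 2 ^ k)%N in Ha Ha' Hc Hc'.
have -> : (Delta ^ 2 ^ k.+1)%:R = d%:R * d%:R :> algC.
  by rewrite -natrM -expnD addnn -mul2n -expnS.
rewrite mulrDr !(mulrACA d%:R d%:R).
by rewrite rpredD // rpredM.
Qed.

Lemma lev_conj (nu nu' : aut) k z : (forall y, S y -> nu y.2 = nu' y.2) ->
  lev S k z -> nu z.2 = nu' z.2.
Proof.
move=> HS; elim: k z => [|k IHk] z; first exact: HS.
move=> [a [a' [c [c' [/IHk Ha /IHk Ha' /IHk Hc /IHk Hc' ->]]]]] /=.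
by rewrite !rmorphD !rmorphM Ha Ha' Hc Hc'.
Qed.

(** Liouville's inequality: a nonzero norm is at least 1 and the cofactor of each conjugate is
    bounded above, so no conjugate of [z.2] is small. *)
Lemma lev_norm (Delta : nat) k z : (0 < Delta)%N -> (Delta <= b)%N ->
  (forall y, S y -> Delta%:R * y.2 \in Aint) -> lev S k z -> z.2 != 0 ->
  exists N : nat, [/\ (0 < N)%N, (N <= b ^ cnorm k D)%N,
    N%:R / ((Delta ^ 2 ^ k)%:R * z.2) \in Aint
    & forall nu : aut, 1 <= (b ^ cnorm k D)%:R * `|nu z.2|].
Proof.
move=> D0 Db HD Hz z0; have [mu Hmu] := good_conj hS.
set d := (Delta ^ 2 ^ k)%N; set v := d%:R * z.2.
have d0 : (0 < d)%N by rewrite expn_gt0 D0.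
have led : (d <= b ^ 2 ^ k)%N by rewrite leq_exp2r // expn_gt0.
have v0 : v != 0 by rewrite mulf_neq0 // pnatr_eq0 -lt0n.
have conj_v : conj_bounded D mu v.
  move=> nu; have [i ltiD Hi] := Hmu nu; exists i => //.
  by rewrite /v !rmorphM !rmorph_nat (lev_conj Hi Hz).
set beta := (b ^ (2 ^ k + 2 * 3 ^ k))%N.
have beta0 : (0 < beta)%N by rewrite expn_gt0 b0.
have le_v (nu : aut) : `|nu v| <= beta%:R.
  rewrite /v rmorphM rmorph_nat normrM normr_nat /beta expnD natrM.
  by rewrite ler_pM ?ler_nat ?lev_bound.
have [N [N0 leN AN HN]] := Aint_norm beta0 (lev_den HD Hz) v0 conj_v le_v.
have Dc : (b ^ cnorm k D = beta ^ D * b ^ 2 ^ k)%N.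
  by rewrite /cnorm expnD expnM.
exists N; split=> //.
  by rewrite Dc (leq_trans leN) // leq_pmulr // expn_gt0 b0.
move=> nu; apply: le_trans (_ : N%:R <= _); first by rewrite (ler_nat _ 1).
have -> : N%:R = `|nu (N%:R / v)| * (d%:R * `|nu z.2|) :> algC.
  rewrite -[d%:R]normr_nat -normrM -normrM.
  have <- : nu v = d%:R * nu z.2 by rewrite rmorphM rmorph_nat.
  by rewrite -rmorphM divfK // rmorph_nat normr_nat.
by rewrite Dc natrM -mulrA ler_pM ?mulr_ge0 // ler_wpM2r // ler_nat.
Qed.

(** The relation is imposed on the side of [F] only; the lifted coefficients then provide the
    polynomial of which the lift of [x] is to be a root. *)
Definition annihilator (x : F) k s (P : {poly F * algC}) :=
  [/\ polylev S k P, (size P <= s)%N, P != 0 & (map_poly fst P).[x] = 0].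

(** [F * algC] has zero divisors, but by the zero test an expression of level [K] is zero as soon as
    one of its components is. *)
Lemma lead_coef_neq0 (P : {poly F * algC}) : polylev S K P -> P != 0 ->
  (lead_coef P).1 != 0 /\ (lead_coef P).2 != 0.
Proof.
move=> HP P0; have /(good_zero hS) E : lev S K (lead_coef P) by rewrite lead_coefE; apply: HP.
suff H1 : (lead_coef P).1 != 0 by rewrite H1 -E.
apply/negP => H1; move: P0; rewrite -lead_coef_eq0.
move: H1 (H1); rewrite {2}E; case: (lead_coef P) => u v /= /eqP -> /eqP ->.
by rewrite eqxx.
Qed.

Lemma size_map_snd (P : {poly F * algC}) : polylev S K P -> P != 0 ->
  size (map_poly snd P) = size P.
Proof. by move=> HP P0; apply: size_map_poly_id0; case: (lead_coef_neq0 HP P0). Qed.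

Lemma size_map_fst (P : {poly F * algC}) : polylev S K P -> P != 0 ->
  size (map_poly fst P) = size P.
Proof. by move=> HP P0; apply: size_map_poly_id0; case: (lead_coef_neq0 HP P0). Qed.

Let S0 := good0 hS. Let S1 := good1 hS. Let SN1 := goodN1 hS.

Section MinimalPolynomial.
Variables (x : F) (tau : algC) (l s W : nat) (G : {poly F * algC}).
Hypotheses (annG : annihilator x l s G) (leWK : (l + W <= K)%N).
Hypothesis minG : forall P, annihilator x (l + W) s P -> (size G <= size P)%N.
Hypothesis rootG : root (map_poly snd G) tau.

Let g : F * algC := (x, tau).

Lemma hornerE1 (P : {poly F * algC}) : P.[g].1 = (map_poly fst P).[x].
Proof. by rewrite (horner_map (fst : {rmorphism _ -> _}) P g). Qed.

Lemma hornerE2 (P : {poly F * algC}) : P.[g].2 = (map_poly snd P).[tau].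
Proof. by rewrite (horner_map (snd : {rmorphism _ -> _}) P g). Qed.

Lemma horner_min : G.[g] = 0.
Proof.
have [_ _ _ Gx] := annG; apply: injective_projections.
  by rewrite hornerE1 Gx.
by rewrite hornerE2; apply/eqP.
Qed.

Lemma fst_neq0_small R k : polylev S k R -> (k <= l + W)%N -> R != 0 ->
  (size R < size G)%N -> (map_poly fst R).[x] != 0.
Proof.
move=> HR kW R0 szR; apply/eqP => Rx.
have [_ szG _ _] := annG.
have := minG (P := R); rewrite leqNgt szR => H; apply: notF; apply: H; split=> //.
  by apply: (polylev_leq S0 S1 SN1) kW HR.
exact: leq_trans (ltnW szR) szG.
Qed.

(* Were [tau] a root of a smaller [R], the Euclidean algorithm applied to [G]
   and [R] would split [G] and produce a smaller annihilator of [x]. *)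
Lemma snd_neq0_small t R k : polylev S k R -> (l <= k)%N ->
  (k + 4 * s * t <= l + W)%N -> R != 0 -> (size R <= t)%N ->
  (size R < size G)%N -> (map_poly snd R).[tau] != 0.
Proof.
elim: t R k => [|t IHt] R k HR lk kW R0 szR ltR.
  by move: R0; rewrite -size_poly_eq0 -leqn0 szR.
apply/eqP => Rtau; have [HG szG G0 Gx] := annG.
have HGk : polylev S k G by apply: (polylev_leq S0 S1 SN1) lk HG.
have [m [Q [R' [DE szR' HR' HQ [_ szQ]]]]] := pseudo_division S0 S1 SN1 HR HGk szG R0.
have k'W : (k + 4 * s + 4 * s * t <= l + W)%N by rewrite mulnS addnA in kW.
have kW' : (k + 4 * s <= l + W)%N by apply: leq_trans k'W; rewrite leq_addr.
have kK : (k <= K)%N by apply: leq_trans leWK; apply: leq_trans kW'; rewrite leq_addr.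
have HRK : polylev S K R by apply: (polylev_leq S0 S1 SN1) kK HR.
have [r1 r2] := lead_coef_neq0 HRK R0.
have szR2 : (1 < size R)%N.
  rewrite -(size_map_snd HRK R0); apply: (@root_size_gt1 _ tau); last exact/eqP.
  by rewrite -size_poly_eq0 (size_map_snd HRK R0) size_poly_eq0.
have [R'0|nzR'] := eqVneq R' 0; last first.
  have : (map_poly snd R').[tau] != 0.
    by apply: (IHt R' (k + 4 * s)%N) => //; [lia|lia|apply: ltn_trans szR' ltR].
  rewrite -hornerE2 => /eqP; apply.
  have := congr1 (fun P : {poly F * algC} => P.[g].2) DE => /=.
  rewrite hornerZ hornerD hornerM horner_min mulr0 /= (hornerE2 R) Rtau mulr0 add0r.
  by move=> <-.
rewrite R'0 addr0 in DE.
have Qx : (map_poly fst Q).[x] = 0.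
  have := congr1 (fun P : {poly F * algC} => P.[g].1) DE => /=.
  rewrite hornerZ hornerM horner_min mulr0 /= => /esym/eqP.
  rewrite mulf_eq0 !hornerE1 => /orP[/eqP //|].
  by rewrite (negPf (fst_neq0_small HR _ R0 ltR)) //; lia.
have HGK : polylev S K G by apply: (polylev_leq S0 S1 SN1) kK HGk.
have [g1 g2] := lead_coef_neq0 HGK G0.
have Q0 : Q != 0.
  apply/eqP => Q0; move: DE; rewrite Q0 mul0r => DE.
  have : (lead_coef R ^+ m *: G)`_(size G).-1 = 0 by rewrite DE coef0.
  rewrite coefZ -lead_coefE => /(congr1 fst) /= /eqP.
  by rewrite mulf_eq0 (negPf g1) orbF rmorphXn expf_eq0 /= (negPf r1) andbF.
have szQG : (size Q < size G)%N.
  apply: leq_ltn_trans szQ _; move: szR2 ltR.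
  by move: (size R) (size G) => r r'; lia.
have annQ : annihilator x (l + W) s Q.
  split=> //; first by apply: (polylev_leq S0 S1 SN1) kW' HQ.
  exact: leq_trans (ltnW szQG) szG.
by have := minG annQ; rewrite leqNgt szQG.
Qed.

(** Modulo [G], [P] may be replaced by its pseudo-remainder, which is shorter than [G] and
    therefore, unless it is zero, vanishes on neither side. Of the levels in [W], [4 * s] pay for
    this division and [4 * s * s] for the Euclidean chain in [snd_neq0_small]. *)
Lemma min_zero_iff P : polylev S l P -> (size P <= s)%N ->
  (4 * s * s.+1 <= W)%N -> (P.[g].1 == 0) = (P.[g].2 == 0).
Proof.
rewrite mulnS => HP szP sW; have [HG szG G0 Gx] := annG.
have [m [Q [R [DE szR HR HQ _]]]] := pseudo_division S0 S1 SN1 HG HP szP G0.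
have lK : (l <= K)%N by lia.
have [g1 g2] : (lead_coef G).1 != 0 /\ (lead_coef G).2 != 0.
  by apply: lead_coef_neq0 => //; apply: (polylev_leq S0 S1 SN1) lK HG.
have Eg : lead_coef G ^+ m * P.[g] = R.[g].
  by rewrite -hornerZ DE hornerD hornerM horner_min mulr0 add0r.
have E1 : (P.[g].1 == 0) = (R.[g].1 == 0).
  by rewrite -Eg /= mulf_eq0 rmorphXn expf_eq0 /= (negPf g1) andbF.
have E2 : (P.[g].2 == 0) = (R.[g].2 == 0).
  by rewrite -Eg /= mulf_eq0 rmorphXn expf_eq0 /= (negPf g2) andbF.
rewrite E1 E2; have [->|R0] := eqVneq R 0; first by rewrite horner0 !eqxx.
rewrite hornerE1 hornerE2 (negPf (fst_neq0_small HR _ R0 szR)); last by lia.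
have c1 : (l <= l + 4 * s)%N by rewrite leq_addr.
have c2 : (l + 4 * s + 4 * s * s <= l + W)%N by rewrite -addnA leq_add2l.
have c3 : (size R <= s)%N := ltnW (leq_trans szR szG).
by rewrite (negPf (snd_neq0_small HR c1 c2 R0 c3 szR)).
Qed.
End MinimalPolynomial.

(** Allowing [W] more levels may reveal a shorter annihilator; as the size drops each time, this
    happens at most [t] times before minimality holds with [W] levels to spare. *)
Lemma minimal_annihilator x s W t l P : annihilator x l s P -> (size P <= t)%N ->
  exists l' G, [/\ (l <= l' <= l + t * W)%N, annihilator x l' s G
    & forall P', annihilator x (l' + W) s P' -> (size G <= size P')%N].
Proof.
elim: t l P => [|t IHt] l P annP szP.
  by have [_ _ + _] := annP; rewrite -size_poly_eq0 -leqn0 szP.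
have [[P' annP' ltP']|noP'] := pselect (exists2 P', annihilator x (l + W) s P'
    & (size P' < size P)%N).
  have [|l' [G [/andP[l1 l2] annG minG]]] := IHt _ _ annP' _.
    by rewrite -ltnS (leq_trans ltP').
  exists l', G; split=> //.
  by rewrite (leq_trans _ l1) ?leq_addr //= mulSn addnA.
exists l, P; split=> //; first by rewrite leqnn leq_addr.
by move=> P' annP'; rewrite leqNgt; apply/negP => lt; apply: noP'; exists P'.
Qed.

(** In Cauchy's root bound, [s] pays for the number of coefficients, [2 * 3 ^ K] for their size and
    [cnorm K D] for the inverse of the leading one; the successor puts [b ^ cext s] strictly beyond
    every root. *)
Definition cext s := (s + 2 * 3 ^ K + cnorm K D).+1.

Lemma cauchy_lev (P : {poly F * algC}) (nu : aut) s z : polylev S K P -> P != 0 ->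
  (size P <= s)%N -> root (map_poly nu (map_poly snd P)) z -> `|z| <= (b ^ (cext s).-1)%:R.
Proof.
move=> HP P0 szP rz; have [Delta [D0 Db HD]] := good_den hS.
have [l1 l2] := lead_coef_neq0 HP P0.
have Hl : lev S K (lead_coef P) by rewrite lead_coefE.
have [N [_ _ _ HN]] := lev_norm D0 Db HD Hl l2.
have lc : lead_coef (map_poly nu (map_poly snd P)) = nu (lead_coef P).2.
  by rewrite lead_coef_map_eq ?lead_coef_map_eq ?fmorph_eq0.
have H1 n : 1 <= (b ^ n)%:R :> algC by rewrite (ler_nat _ 1) expn_gt0 b0.
have := root_le_Cauchy (H1 (2 * 3 ^ K)%N) (H1 (cnorm K D)) _ _ rz.
rewrite lc => /(_ _ (HN nu)) H; apply: le_trans (H _) _.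
  by move=> i; rewrite !coef_map /= lev_bound.
rewrite size_map_poly (size_map_snd HP P0) -!natrM ler_nat /cext /= !expnD.
rewrite !leq_mul //; apply: leq_trans szP (leq_trans (ltnW (ltn_expl s (isT : 1 < 2)%N)) _).
by case: (s) => // s'; rewrite leq_exp2r.
Qed.

Let adjoin (g : F * algC) z := S z \/ z = g.

(** An integer beyond the roots of all lifted polynomials of this complexity is a root of none of
    them, just as [x] is a root of none on the side of [F]. *)
Lemma extend_transcendental x K' : (kappa K' <= K)%N ->
  (forall P, ~ annihilator x (kappa K') (2 ^ K').+1 P) ->
  exists tau, good (adjoin (x, tau)) K' (D * (2 ^ K').+1) (b ^ cext (2 ^ K').+1).
Proof.
set s := (2 ^ K').+1 => leK noP; set c := cext s.
have leb : (b <= b ^ c)%N by rewrite -[X in (X <= _)%N]expn1 leq_pexp2l.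
exists (b ^ c)%:R; split; try by left.
- move=> z /(lev_adjoin S0 S1 SN1)[P [HP szP ->]].
  have [->|P0] := eqVneq P 0; first by rewrite horner0 !eqxx.
  rewrite hornerE1 hornerE2; have HPK := polylev_leq S0 S1 SN1 leK HP.
  have -> : ((map_poly fst P).[x] == 0) = false.
    by apply/eqP => Px; apply: (noP P); split.
  apply/esym/negbTE/negP => Pz.
  have := @cauchy_lev P (idfun : aut) s (b ^ c)%:R HPK P0 szP.
  rewrite map_poly_id // => /(_ Pz); rewrite normr_nat ler_nat leqNgt.
  by rewrite ltn_exp2l // /c /cext /= ltnSn.
- move=> z [Sz|->] nu; first by apply: le_trans (good_bound hS Sz nu) _; rewrite ler_nat.
  by rewrite /= rmorph_nat normr_nat.
- have [Delta [D0 Db HD]] := good_den hS; exists Delta; split=> //.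
    exact: leq_trans Db leb.
  by move=> z [/HD //|->] /=; rewrite -natrM Aint_Cnat ?natr_nat.
- have [mu Hmu] := good_conj hS; exists mu => nu; have [i ltiD Hi] := Hmu nu.
  exists i; first by apply: leq_trans ltiD _; rewrite leq_pmulr.
  by move=> z [/Hi //|->] /=; rewrite !rmorph_nat.
Qed.

Lemma extend_algebraic x K' l W (G : {poly F * algC}) :
  let s := (2 ^ K').+1 in
  annihilator x l s G -> (kappa K' <= l)%N -> (l + W <= K)%N ->
  (4 * s * s.+1 <= W)%N ->
  (forall P, annihilator x (l + W) s P -> (size G <= size P)%N) ->
  exists tau, good (adjoin (x, tau)) K' (D * s) (b ^ cext s).
Proof.
move=> s annG kl leWK sW minG; set c := cext s.
have [HG szG G0 Gx] := annG.
have lK : (l <= K)%N by apply: leq_trans leWK; rewrite leq_addr.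
have HGK : polylev S K G := polylev_leq S0 S1 SN1 lK HG.
have [g1 g2] := lead_coef_neq0 HGK G0.
have szG1 : (1 < size G)%N.
  rewrite -(size_map_fst HGK G0); apply: (@root_size_gt1 _ x); last exact/eqP.
  by rewrite -size_poly_eq0 (size_map_fst HGK G0) size_poly_eq0.
(* [fst G] has the root [x], so [G] is not constant, and [snd G] has the same size. *)
have [tau rtau] : exists tau, root (map_poly snd G) tau.
  by apply/closed_rootP; rewrite (size_map_snd HGK G0) neq_ltn szG1 orbT.
have leb n : (0 < n)%N -> (b <= b ^ n)%N by move=> n0; rewrite -[X in (X <= _)%N]expn1 leq_pexp2l.
have le_tau (nu : aut) : `|nu tau| <= (b ^ c)%:R.
  have := @cauchy_lev G nu s (nu tau) HGK G0 szG; rewrite fmorph_root => /(_ rtau) H.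
  by apply: le_trans H _; rewrite ler_nat leq_pexp2l ?leq_pred.
exists tau; split; try by left.
- move=> z /(lev_adjoin S0 S1 SN1)[P [HP szP ->]].
  apply: (min_zero_iff annG leWK minG rtau) => //.
  exact: (polylev_leq S0 S1 SN1 kl HP).
- move=> z [Sz|->] nu //; apply: le_trans (good_bound hS Sz nu) _.
  by rewrite ler_nat leb.
- have [Delta [D0 Db HD]] := good_den hS.
  have Hl : lev S K (lead_coef G) by rewrite lead_coefE.
  have [N [N0 leN AN _]] := lev_norm D0 Db HD Hl g2.
  exists (Delta * N)%N; split; first by rewrite muln_gt0 D0.
    apply: leq_trans (leq_mul Db leN) _; rewrite -expnS leq_pexp2l //.
    by rewrite /c /cext ltnS leq_addl.
  move=> z [/HD HDz|->] /=; rewrite natrM.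
    by rewrite mulrAC rpredM // Aint_Cnat ?natr_nat.
  rewrite -mulrA; apply: rpredM; first by rewrite Aint_Cnat ?natr_nat.
  set d := (Delta ^ 2 ^ K)%N in AN; set w := d%:R * (lead_coef G).2 in AN.
  have d0 : (d%:R : algC) != 0 by rewrite pnatr_eq0 -lt0n expn_gt0 D0.
  have w0 : w != 0 by rewrite mulf_neq0.
  (* The leading coefficient times a root is an algebraic integer, and [w] divides [N]. *)
  suff Aw : w * tau \in Aint.
    by have -> : N%:R * tau = (N%:R / w) * (w * tau); [rewrite mulrA divfK|rewrite rpredM].
  pose cf i := d%:R * (G`_i).2.
  have Acf i : cf i \in Aint by apply: lev_den (HGK i).
  pose e := (size G).-1.
  have szGe : size G = e.+1 by rewrite /e prednK // ltnW.
  have e0 : (0 < e)%N by rewrite -ltnS -szGe.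
  have Dw : w = cf e by rewrite /w lead_coefE.
  (* The monic equation of [w * tau], obtained by multiplying that of [tau] by [d * w ^ (e - 1)]. *)
  pose q := 'X^e + \poly_(i < e) (cf i * w ^+ (e.-1 - i)).
  apply: (@Aint_integrally_closed q).
  + rewrite monicE lead_coefDl ?lead_coefXn // size_polyXn ltnS; exact: size_poly.
  + rewrite rpredD ?polyOverXn //; apply/polyOverP => i; rewrite coef_poly.
    case: ifP => _; last exact: rpred0.
    by apply: rpredM => //; apply: rpredX; rewrite Dw.
  rewrite rootE hornerD hornerXn horner_poly.
  have : w ^+ e.-1 * d%:R * (map_poly snd G).[tau] = 0 by rewrite (eqP rtau) mulr0.
  rewrite horner_coef (size_map_snd HGK G0) szGe mulr_sumr big_ord_recr /= => /eqP.
  rewrite addrC; congr (_ + _ == 0).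
    rewrite coef_map -mulrA [d%:R * (_ * _)]mulrA -/(cf e) -Dw [(w * tau) ^+ e]exprMn.
    by rewrite mulrA -exprSr prednK.
  apply: eq_bigr => i _; rewrite coef_map [(w * tau) ^+ i]exprMn -mulrA.
  rewrite [d%:R * (_ * _)]mulrA -/(cf i).
  have lei : (i <= e.-1)%N by rewrite -ltnS prednK.
  have -> : w ^+ e.-1 = w ^+ (e.-1 - i) * w ^+ i by rewrite -exprD subnK.
  move: (cf i) (w ^+ (e.-1 - i)) (w ^+ i) (tau ^+ i) => u1 u2 u3 u4.
  by rewrite mulrACA [u2 * u1]mulrC.
- have [mu Hmu] := good_conj hS.
  have rts_ex i : exists rs : seq algC, map_poly (mu i) (map_poly snd G) =
      lead_coef (map_poly (mu i) (map_poly snd G)) *: \prod_(z <- rs) ('X - z%:P).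
    by have [rs] := closed_field_poly_normal (map_poly (mu i) (map_poly snd G)); exists rs.
  have [rts Hrts] := boolp.choice rts_ex.
  have lc i : lead_coef (map_poly (mu i) (map_poly snd G)) != 0.
    rewrite lead_coef_eq0 map_poly_eq0 -size_poly_eq0 (size_map_snd HGK G0).
    by rewrite size_poly_eq0.
  have sz_rts i : (size (rts i) < s)%N.
    rewrite -(size_prod_XsubC _ id) -(size_scale _ (lc i)) -Hrts size_map_poly.
    by rewrite (size_map_snd HGK G0).
  (* The number [n = j * D + i] codes the system [i] of conjugates on [S] together with the [j]-th
     root of the corresponding conjugate of [G]; a code that no morphism realizes gets an arbitrary
     one. *)
  have sel_ex n : exists nu' : aut,
      (exists nu : aut, (forall z, S z -> nu z.2 = mu (n %% D)%N z.2) /\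
         nu tau = (rts (n %% D)%N)`_(n %/ D)) ->
      (forall z, S z -> nu' z.2 = mu (n %% D)%N z.2) /\
         nu' tau = (rts (n %% D)%N)`_(n %/ D).
    have [[nu Hnu]|no] := pselect (exists nu : aut,
      (forall z, S z -> nu z.2 = mu (n %% D)%N z.2) /\
         nu tau = (rts (n %% D)%N)`_(n %/ D)); first by exists nu.
    by exists (mu 0%N).
  have [mu' Hmu'] := boolp.choice sel_ex.
  exists mu' => nu; have [i ltiD Hi] := Hmu nu.
  have D0 : (0 < D)%N by apply: leq_ltn_trans ltiD.
  have tau_rts : nu tau \in rts i.
    have : root (map_poly (mu i) (map_poly snd G)) (nu tau).
      have <- : map_poly nu (map_poly snd G) = map_poly (mu i) (map_poly snd G).
        by apply/polyP => j; rewrite !coef_map /= (lev_conj Hi (HGK j)).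
      by rewrite fmorph_root.
    by rewrite Hrts rootZ // root_prod_XsubC.
  have lt_idx : (index (nu tau) (rts i) < s)%N.
    by apply: leq_trans (sz_rts i); rewrite ltnS ltnW // index_mem.
  exists (index (nu tau) (rts i) * D + i)%N.
    rewrite [(D * s)%N]mulnC; apply: leq_trans (_ : (index (nu tau) (rts i)).+1 * D <= _)%N.
      by rewrite mulSn addnC ltn_add2r.
    by rewrite leq_mul2r lt_idx orbT.
  have := Hmu' (index (nu tau) (rts i) * D + i)%N.
  rewrite modnMDl modn_small // divnMDl // divn_small // addn0 nth_index //.
  move=> [|H1 H2]; first by exists nu.
  by move=> z [Sz|->] //=; rewrite H1 ?Hi.
Qed.
End Good.

(** [k] is the level of the coefficients of an expression of level [K'] in the new element; the
    search for a minimal annihilator may add [s] times [W], and one more [W] must remain. *)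
Lemma extend_model K' : exists K, forall D, exists D' c, (0 < c)%N /\
  forall (F : fieldType) (S : F * algC -> Prop) b x, (2 <= b)%N -> good S K D b ->
  exists tau, good (fun z => S z \/ z = (x, tau)) K' D' (b ^ c).
Proof.
set s := (2 ^ K').+1; set W := (4 * s * s.+1)%N; set k := kappa K'.
exists (k + s.+1 * W)%N => D; exists (D * s)%N, (cext (k + s.+1 * W) D s).
split=> // F S b x hb hS.
have leK : (k <= k + s.+1 * W)%N by rewrite leq_addr.
have [[P annP]|noP] := pselect (exists P, annihilator S x k s P); last first.
  apply: (extend_transcendental hb hS) => // P annP; by apply: noP; exists P.
have szP : (size P <= s)%N by case: annP.
have [l [G [/andP[l1 l2] annG minG]]] := minimal_annihilator W annP szP.
apply: (extend_algebraic hb hS annG l1 _ _ minG) => //.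
by move: l2; rewrite mulSn; move: (s * W)%N => y; move: (W) => W'; lia.
Qed.

(** * Sets with small doubling *)

Section Sumsets.
Variable V : finZmodType.
Implicit Types (A B S X Y Z : {set V}).

Lemma sumsetP A B z :
  reflect (exists a b, [/\ a \in A, b \in B & z = a + b]) (z \in sumset A B).
Proof.
apply: (iffP imset2P) => [[a b aA bB ->]|[a [b [aA bB ->]]]].
  by exists a, b.
by exists a b.
Qed.

Lemma mem_sumset A B a b : a \in A -> b \in B -> a + b \in sumset A B.
Proof. by move=> aA bB; apply/sumsetP; exists a, b. Qed.

Lemma sumsetC A B : sumset A B = sumset B A.
Proof.
by apply/setP => z; apply/sumsetP/sumsetP => -[a [b [aA bB ->]]];
   exists b, a; rewrite addrC.
Qed.

Lemma sumsetA A B S : sumset A (sumset B S) = sumset (sumset A B) S.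
Proof.
apply/setP => z; apply/sumsetP/sumsetP.
  move=> [a [_ [aA /sumsetP[b [c [bB cC ->]]] ->]]].
  by exists (a + b), c; rewrite mem_sumset // addrA.
move=> [_ [c [/sumsetP[a [b [aA bB ->]]] cC ->]]].
by exists a, (b + c); rewrite mem_sumset // addrA.
Qed.

Lemma card_shift A x : #|sumset A [set x]| = #|A|.
Proof.
have -> : sumset A [set x] = [set a + x | a in A].
  apply/setP => z; apply/sumsetP/imsetP.
    by move=> [a [_ [aA /set1P -> ->]]]; exists a.
  by move=> [a aA ->]; exists a, x; rewrite set11.
by rewrite card_imset //; apply: addIr.
Qed.

(** When [s] joins [S], let [B'] collect the [b] with [A + b + s] already covered. The left side
    then gains at most [#|A + B| - #|A + B'|] and the right side at least [#|B| - #|B'|]; minimality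
    of the ratio at [B] compares the two. *)
Lemma petridis A B :
  (forall B', B' \subset B -> #|sumset A B| * #|B'| <= #|sumset A B'| * #|B|)%N ->
  forall S, (#|sumset A (sumset B S)| * #|B| <= #|sumset A B| * #|sumset B S|)%N.
Proof.
move=> minB S; have [n] := ubnP #|S|; elim: n S => // n IHn S ltS.
have [->|[s sS]] := set_0Vmem S.
  suff -> : sumset A (sumset B set0) = set0 by rewrite cards0.
  apply/setP => z; rewrite inE; apply/sumsetP.
  by move=> [a [y [_ /sumsetP[b [c [_ c0 _]]] _]]]; move: c0; rewrite inE.
pose S' := S :\ s.
have DS : S = s |: S' by rewrite setD1K.
have {}IHn := IHn S' (leq_trans (_ : #|S'| < #|S|)%N _).
have {}IHn : (#|sumset A (sumset B S')| * #|B| <= #|sumset A B| * #|sumset B S'|)%N.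
  by apply: IHn => //; rewrite [X in (_ < X)%N](cardsD1 s) sS.
pose B' := [set b in B | sumset A [set b + s] \subset sumset A (sumset B S')].
have sB : B' \subset B by apply/subsetP => b; rewrite inE => /andP[].
pose Bs := sumset B [set s]; pose B's := sumset B' [set s].
have DBS : sumset B S = sumset B S' :|: Bs.
  apply/setP => z; rewrite inE; apply/sumsetP/orP.
    move=> [b [c [bB cS ->]]]; have [->|neq_cs] := eqVneq c s; [right|left].
      by rewrite mem_sumset ?set11.
    by rewrite mem_sumset // in_setD1 neq_cs.
  case=> /sumsetP[b [c [bB cS ->]]]; exists b, c; split=> //.
    by move: cS; rewrite in_setD1 => /andP[].
  by rewrite (set1P cS).
have DABS : sumset A (sumset B S) = sumset A (sumset B S') :|: sumset A Bs.
  apply/setP => z; rewrite DBS inE; apply/sumsetP/orP.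
    move=> [a [c [aA]]]; rewrite inE => /orP[cB|cB] ->; [left|right]; exact: mem_sumset.
  by case=> /sumsetP[a [c [aA cB ->]]]; exists a, c; rewrite inE cB ?orbT.
have sB's : sumset A B's \subset sumset A (sumset B S') :&: sumset A Bs.
  apply/subsetP => z /sumsetP[a [_ [aA /sumsetP[b [_ [bB' /set1P -> ->]]] ->]]].
  rewrite inE; apply/andP; split; last first.
    by rewrite mem_sumset // mem_sumset ?set11 // (subsetP sB).
  by move: bB'; rewrite inE => /andP[_ /subsetP]; apply; rewrite mem_sumset ?set11.
have sBB : sumset B S' :&: Bs \subset B's.
  apply/subsetP => z; rewrite inE => /andP[zS /sumsetP[b [_ [bB /set1P -> Dz]]]].
  rewrite Dz mem_sumset ?set11 // inE bB; apply/subsetP => y.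
  move=> /sumsetP[a [_ [aA /set1P -> ->]]].
  by rewrite mem_sumset // -Dz.
have cABs : #|sumset A Bs| = #|sumset A B| by rewrite /Bs sumsetA card_shift.
have cAB's : #|sumset A B's| = #|sumset A B'| by rewrite /B's sumsetA card_shift.
have cBs : #|Bs| = #|B| by rewrite card_shift.
have cB's : #|B's| = #|B'| by rewrite card_shift.
have H1 := subset_leq_card sB's; have H2 := subset_leq_card sBB.
have H3 := minB B' sB.
have := cardsUI (sumset A (sumset B S')) (sumset A Bs); rewrite -DABS cABs => E1.
have := cardsUI (sumset B S') Bs; rewrite -DBS cBs => E2.
rewrite cAB's in H1; rewrite cB's in H2.
move: E1 E2 H1 H2 H3 IHn.
move: (#|_ :&: sumset A Bs|) (#|_ :&: Bs|) => i1 i2.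
move: #|sumset A (sumset B S)| #|sumset B S| #|sumset A (sumset B S')| #|sumset B S'|.
move: #|sumset A B| #|sumset A B'| #|B| #|B'| => u1 u2 u3 u4 x1 x2 x3 x4.
nia.
Qed.

(** Once a representation [d = y - z] is chosen for each difference, the map from [(d, b)] to
    [(y + b, z + b)] is injective, since [d] is the difference of the two coordinates. *)
Lemma ruzsa_triangle Y Z B : (#|sumset Y (-%R @: Z)| * #|B| <= #|sumset Y B| * #|sumset Z B|)%N.
Proof.
pose f (d : V) := odflt (0, 0)
  [pick yz : V * V | (yz.1 \in Y) && (yz.2 \in Z) && (d == yz.1 - yz.2)].
have fP d : d \in sumset Y (-%R @: Z) ->
    [/\ (f d).1 \in Y, (f d).2 \in Z & d = (f d).1 - (f d).2].
  move=> /sumsetP[y [_ [yY /imsetP[z zZ ->] Dd]]]; rewrite /f.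
  case: pickP => [[y' z'] /= /andP[/andP[? ?] /eqP ?]|/(_ (y, z))] //=.
  by rewrite yY zZ Dd eqxx.
rewrite -!cardsX.
pose g (db : V * V) := ((f db.1).1 + db.2, (f db.1).2 + db.2).
rewrite -(card_in_imset (f := g)); last first.
  move=> [d b] [d' b']; rewrite !inE /= => /andP[/fP[_ _ Dd] _] /andP[/fP[_ _ Dd'] _].
  rewrite /g /= => -[E1 E2].
  have Ed : d = d'.
    rewrite Dd Dd'; have := congr2 (fun x y => x - y) E1 E2.
    by rewrite !opprD ![_ + b + _]addrACA ![_ + b' + _]addrACA !subrr !addr0.
  by move: E1; rewrite Ed => /addrI ->.
apply/subset_leq_card/subsetP => z /imsetP[[d b]]; rewrite inE /= => /andP[/fP[H1 H2 _] bB] ->.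
by rewrite inE /= !mem_sumset.
Qed.

(** For [B] in [A] minimizing the ratio, [petridis] bounds [A + A + A + B] by [C ^ 3 * #|B|]; the
    triangle inequality through [B] brings in the subtracted copy of [A] and the fourth factor
    [C]. *)
Lemma plunnecke A (C : nat) : (0 < #|A|)%N -> (#|sumset A A| <= C * #|A|)%N ->
  (#|sumset (sumset A (sumset A A)) (-%R @: A)| <= C ^ 4 * #|A|)%N.
Proof.
move=> A0 leC.
pose ratio B : rat := #|sumset A B|%:R / #|B|%:R.
pose P B := (B \subset A) && (B != set0).
have PA : P A by rewrite /P subxx -card_gt0.
case: (Order.TotalTheory.arg_minP ratio PA) => B /andP[sBA B0] minB.
have B0' : (0 < #|B|)%N by rewrite card_gt0.
have cross B' : B' \subset A -> (#|sumset A B| * #|B'| <= #|sumset A B'| * #|B|)%N.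
  move=> sB'; have [->|B'0] := eqVneq B' set0; first by rewrite cards0 muln0.
  have := minB B'; rewrite /P sB' B'0 /ratio => /(_ isT).
  rewrite ler_pdivrMr ?ltr0n // mulrAC ler_pdivlMr ?ltr0n ?card_gt0 //.
  by rewrite -!natrM ler_nat.
have pet := @petridis A B (fun B' sB' => cross B' (subset_trans sB' sBA)).
have leAB : (#|sumset A B| <= C * #|B|)%N.
  rewrite -(leq_pmul2r A0); apply: leq_trans (cross A (subxx _)) _.
  by rewrite mulnAC leq_mul2r leC orbT.
have step S : (#|sumset A (sumset B S)| <= C * #|sumset B S|)%N.
  rewrite -(leq_pmul2r B0'); apply: leq_trans (pet S) _.
  by rewrite mulnAC leq_mul2r leAB orbT.
have le2 : (#|sumset A (sumset B A)| <= C ^ 2 * #|B|)%N.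
  apply: leq_trans (step A) _; rewrite expnS expn1 -mulnA leq_mul2l.
  by rewrite (sumsetC B A) leAB orbT.
have le3 : (#|sumset (sumset A (sumset A A)) B| <= C ^ 3 * #|B|)%N.
  have -> : sumset (sumset A (sumset A A)) B = sumset A (sumset B (sumset A A)).
    by rewrite -sumsetA (sumsetC (sumset A A) B).
  apply: leq_trans (step _) _; rewrite (sumsetC B) -sumsetA (sumsetC A B).
  by rewrite expnS -mulnA leq_mul2l le2 orbT.
rewrite -(leq_pmul2r B0'); apply: leq_trans (ruzsa_triangle _ _ _) _.
apply: leq_trans (leq_mul le3 leAB) _.
have := subset_leq_card sBA; move: #|A| #|B| => u v leuv.
by rewrite mulnACA -expnSr -mulnA leq_mul2l leq_mul2r leuv !orbT.
Qed.

(** [X] is a maximal subset of [A + A - A] with pairwise disjoint translates [A + x]. These all lie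
    in [A + A + A - A], which bounds [X]; by maximality every [A + y] meets one of them. *)
Lemma ruzsa_covering A (C : nat) : (0 < #|A|)%N -> (#|sumset A A| <= C * #|A|)%N ->
  exists X, (#|X| <= C ^ 4)%N /\ forall a b c, a \in A -> b \in A -> c \in A ->
    exists x d e, [/\ x \in X, d \in A, e \in A & a + b - c = x + d - e].
Proof.
move=> A0 leC; pose W := sumset (sumset A A) (-%R @: A).
pose P X := (X \subset W) && [forall x in X, forall y in X, (x != y) ==>
   [disjoint sumset A [set x] & sumset A [set y]]].
have P0 : P set0 by rewrite /P sub0set; apply/forall_inP => x; rewrite inE.
have [X /maxsetP[/andP[sXW /forall_inP disX] maxX] _] := maxset_exists P0.
exists X; split.
  rewrite -(leq_pmul2r A0); apply: leq_trans (plunnecke A0 leC).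
  rewrite -cardsX -(card_in_imset (f := fun xa : V * V => xa.1 + xa.2)); last first.
    move=> [x a] [x' a']; rewrite !inE /= => /andP[xX aA] /andP[x'X a'A] E.
    suff Ex : x = x' by move: E; rewrite Ex => /addrI ->.
    apply: contrapT => /eqP neq; have /forall_inP/(_ _ x'X) := disX x xX.
    rewrite neq /= => /pred0P/(_ (x + a)) /=.
    by rewrite {2}E !(addrC _ a) !(addrC _ a') !mem_sumset ?set11.
  apply/subset_leq_card/subsetP => z /imsetP[[x a]]; rewrite inE /= => /andP[xX aA] ->.
  have /sumsetP[y [t [yAA tA ->]]] := subsetP sXW x xX.
  by rewrite addrAC mem_sumset // addrC mem_sumset.
move=> a b c aA bA cA; set y := a + b - c.
have yW : y \in W by rewrite !mem_sumset // imset_f.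
have [x xX /pred0Pn[z /andP[zx zy]]] : exists2 x, x \in X &
    ~~ [disjoint sumset A [set x] & sumset A [set y]].
  apply: contrapT => nox.
  have yX : y \notin X.
    apply/negP => yX; apply: nox; exists y => //; apply/pred0Pn; exists (a + y).
    by rewrite /= andbb mem_sumset ?set11.
  have dis x : x \in X -> [disjoint sumset A [set x] & sumset A [set y]].
    by move=> xX; apply: contrapT => H; apply: nox; exists x => //; apply/negP.
  have: y |: X = X.
    apply: maxX; last exact: subsetUr.
    apply/andP; split; first by rewrite subUset sub1set yW.
    apply/forall_inP => u /setU1P[->|uX]; apply/forall_inP => v /setU1P[->|vX].
    - by rewrite eqxx.
    - by apply/implyP => _; rewrite disjoint_sym dis.
    - by apply/implyP => _; rewrite dis.
    - by have /forall_inP := disX u uX; apply.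
  by move/setP/(_ y); rewrite setU11 (negPf yX).
move: zx zy => /sumsetP[d [_ [dA /set1P -> ->]]] /sumsetP[e [_ [eA /set1P -> E]]].
exists x, d, e; split=> //.
by rewrite [x + d]addrC E addrC addKr.
Qed.

(** With [a] fixed, [a + d - e = x + d' - e'] sends the pair [(d, e)] to [(d', e')]. Among
    [#|A| ^ 2 + 1] iterates two coincide, and between them the differences telescope, leaving a
    multiple of [a] equal to a sum of elements of [X]. *)
Lemma small_multiple A X :
  (forall a b c, a \in A -> b \in A -> c \in A ->
    exists x d e, [/\ x \in X, d \in A, e \in A & a + b - c = x + d - e]) ->
  forall a, a \in A -> exists q (f : V -> nat), [/\ (0 < q <= #|A| ^ 2)%N,
    (forall x, f x <= #|A| ^ 2)%N & a *+ q = \sum_(x in X) x *+ f x].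
Proof.
move=> cov a aA.
have step_ex (s : V * V) : exists t : V * (V * V), s.1 \in A -> s.2 \in A ->
    [/\ t.1 \in X, t.2.1 \in A, t.2.2 \in A & a + s.1 - s.2 = t.1 + t.2.1 - t.2.2].
  have [s1|] := boolP (s.1 \in A); last by exists (0, (0, 0)).
  have [s2|] := boolP (s.2 \in A); last by exists (0, (0, 0)).
  by have [x [d [e H]]] := cov a s.1 s.2 aA s1 s2; exists (x, (d, e)).
have [step stepP] := boolp.choice step_ex.
pose st k := iter k (fun s => (step s).2) (a, a).
pose xs k := (step (st k)).1.
have stA k : (st k).1 \in A /\ (st k).2 \in A.
  by elim: k => [|k [H1 H2]] //; have [] := stepP (st k) H1 H2.
have xsX k : xs k \in X by have [H1 H2] := stA k; have [] := stepP _ H1 H2.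
pose dif k := (st k).1 - (st k).2.
have stepE k : a = xs k + dif k.+1 - dif k.
  have [H1 H2] := stA k; have [_ _ _ E] := stepP _ H1 H2.
  by rewrite /dif addrA -E -(addrA a) addrK.
set n := (#|A| ^ 2)%N.
have : ~~ uniq [seq st k | k <- iota 0 n.+1].
  apply/negP => un; have : (size [seq st k | k <- iota 0 n.+1] <= #|setX A A|)%N.
    rewrite cardE; apply: uniq_leq_size => // _ /mapP[k _ ->].
    by rewrite mem_enum inE; have [-> ->] := stA k.
  by rewrite size_map size_iota cardsX mulnn ltnn.
move=> /(uniqPn (0, 0))[i [j [ltij]]]; rewrite size_map size_iota => ltjn.
have ltin : (i < n.+1)%N := ltn_trans ltij ltjn.
rewrite !(nth_map 0%N) ?size_iota // !nth_iota // !add0n => Eij.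
exists (j - i)%N, (fun x => count (fun k => xs k == x) (index_iota i j)); split.
- by rewrite subn_gt0 ltij (leq_trans (leq_subr _ _)).
- move=> x; apply: leq_trans (count_size _ _) _; rewrite size_iota.
  by rewrite (leq_trans (leq_subr _ _)).
have -> : a *+ (j - i) = \sum_(i <= k < j) a by rewrite big_const_nat iter_addr_0.
have -> : \sum_(i <= k < j) a = \sum_(i <= k < j) xs k + (dif j - dif i).
  rewrite -(telescope_sumr _ (ltnW ltij)) -big_split /=.
  by apply: eq_bigr => k _; rewrite addrA -stepE.
rewrite /dif Eij subrr addr0.
rewrite (partition_big xs (mem X)) //=; apply: eq_bigr => x _.
elim: (index_iota i j) => [|k r IHr]; first by rewrite big_nil.
by rewrite big_cons /= IHr mulrnDr; case: eqP => [->|_]; rewrite ?mulr1n ?mulr0n ?add0r.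
Qed.
End Sumsets.

(** * Algebraic models of subsets of the prime field *)

Lemma intr_Fp_eq0 p (m : int) : prime p -> (`|m| < p)%N ->
  ((m%:~R : 'F_p) == 0) = (m == 0).
Proof.
move=> pr_p ltmp; apply/idP/idP => [|/eqP ->]; last by rewrite rmorph0.
rewrite {1}(intEsign m) rmorphM rmorph_sign /= mulf_eq0 signr_eq0 /=.
rewrite -(dvdn_pcharf (pchar_Fp pr_p)) => pm.
rewrite -absz_eq0; apply/eqP; case: (posnP `|m|) => // m0.
by have := dvdn_leq m0 pm; rewrite leqNgt ltmp.
Qed.

(** Expressions of level [K] in integers of size at most [H] stay below [p], so they vanish modulo
    [p] only if they vanish. *)
Lemma base_model K p H : prime p -> (2 <= H)%N -> (H ^ (2 * 3 ^ K) < p)%N ->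
  good (fun z : 'F_p * algC => exists2 m : int, (`|m| <= H)%N & z = (m%:~R, m%:~R)) K 1 H.
Proof.
move=> pr_p H2 ltp; have H0 : (0 < H)%N by apply: leq_trans H2.
set S := fun z : 'F_p * algC => _.
have levE k z : lev S k z -> exists2 m : int, (`|m| <= H ^ (2 * 3 ^ k))%N & z = (m%:~R, m%:~R).
  elim: k z => [|k IHk] z.
    move=> [m le_m ->]; exists m => //; apply: leq_trans le_m _.
    by rewrite expn0 muln1 -[X in (X <= _)%N]expn1 leq_pexp2l.
  move=> [a [a' [c [c' [/IHk[m1 l1 ->] /IHk[m2 l2 ->] /IHk[m3 l3 ->] /IHk[m4 l4 ->] ->]]]]].
  exists (m1 * m2 + m3 * m4); last by rewrite !rmorphD !rmorphM.
  have -> : (H ^ (2 * 3 ^ k.+1) = H ^ (2 * 3 ^ k) * (H ^ (2 * 3 ^ k) * H ^ (2 * 3 ^ k)))%N.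
    by rewrite -!expnD; congr (_ ^ _)%N; rewrite expnS; lia.
  have M2 : (2 <= H ^ (2 * 3 ^ k))%N.
    by apply: leq_trans H2 _; rewrite -[X in (X <= _)%N]expn1 leq_pexp2l // muln_gt0 expn_gt0.
  have tri (u v : int) : (`|(u + v)%R| <= `|u| + `|v|)%N by lia.
  apply: leq_trans (tri _ _) _; rewrite !abszM.
  apply: leq_trans (leq_add (leq_mul l1 l2) (leq_mul l3 l4)) _.
  by rewrite addnn -mul2n leq_mul2r M2 orbT.
split.
- by exists 0.
- by exists 1.
- by exists (-1) => //; rewrite rmorphN.
- move=> z /levE[m le_m ->] /=; rewrite intr_Fp_eq0 ?intr_eq0 //.
  exact: leq_ltn_trans le_m ltp.
- move=> z [m le_m ->] nu /=; rewrite rmorph_int -intr_norm -abszE.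
  by rewrite -pmulrn ler_nat.
- exists 1%N; split=> // z [m _ ->] /=; rewrite mul1r; exact: Aint_int.
- exists (fun=> (idfun : aut)) => nu; exists 0%N => // z [m _ ->] /=.
  by rewrite rmorph_int.
Qed.

(** The levels are chosen backwards: reaching level [K] after the last adjunction requires a model
    of a higher level [K1] of the other elements. *)
Lemma model_exists r K : exists D c c0, (0 < c)%N /\
  forall p H, prime p -> (2 <= H)%N -> (H ^ c0 < p)%N ->
  forall xs : seq 'F_p, size xs = r -> exists S, [/\ good S K D (H ^ c),
    forall m : int, (`|m| <= H)%N -> S (m%:~R, m%:~R)
  & forall x, x \in xs -> exists tau, S (x, tau)].
Proof.
elim: r K => [|r IHr] K.
  exists 1%N, 1%N, (2 * 3 ^ K)%N; split=> // p H pr_p H2 ltp [|//] _.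
  exists (fun z : 'F_p * algC => exists2 m : int, (`|m| <= H)%N & z = (m%:~R, m%:~R)).
  by split=> // [|m le_m]; [rewrite expn1; apply: base_model | exists m].
have [K1 ext] := extend_model K; have [D [c [c0 [cpos mod]]]] := IHr K1.
have [D' [c' [c'pos {}ext]]] := ext D.
exists D', (c * c')%N, c0; split; first by rewrite muln_gt0 cpos.
move=> p H pr_p H2 ltp [//|x xs] [szxs].
have [S [gS Sint Sxs]] := mod p H pr_p H2 ltp xs szxs.
have H0 : (0 < H)%N by apply: ltnW.
have b2 : (2 <= H ^ c)%N.
  by apply: (leq_trans H2); rewrite -[X in (X <= _)%N]expn1 leq_pexp2l.
have [tau gS'] := ext _ S (H ^ c)%N x b2 gS.
exists (fun z => S z \/ z = (x, tau)); rewrite expnM; split=> //.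
  by move=> m le_m; left; apply: Sint.
move=> y; rewrite inE => /predU1P[->|/Sxs[t St]]; first by exists tau; right.
by exists t; left.
Qed.

(* Summing [u + val i - val (f i)] over a transversal of [P] modulo [M], which
   translation by [u] permutes, is Lagrange's theorem for the quotient. *)
Lemma common_multiple (I : finType) (P : {set I}) (val : I -> algC)
    (M : zmodClosed algC) (U : algC -> Prop) : (0 < #|P|)%N ->
  (forall u, U u -> forall i, i \in P -> exists2 j, j \in P & u + val i - val j \in M) ->
  exists s : nat, (0 < s <= #|P|)%N /\ forall u, U u -> u *+ s \in M.
Proof.
move=> P0 HU; pose eqv i j := val i - val j \in M.
have eqv_sym i j : eqv i j -> eqv j i by rewrite /eqv -opprB rpredN.
pose Q (X : {set I}) := (X \subset P) &&
  [forall i in X, forall j in X, (i != j) ==> ~~ eqv i j].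
have Q0 : Q set0 by rewrite /Q sub0set; apply/forall_inP => x; rewrite inE.
have [X /maxsetP[/andP[sXP /forall_inP disX] maxX] _] := maxset_exists Q0.
have eqX i j : i \in X -> j \in X -> eqv i j -> i = j.
  move=> iX jX; apply: contraTeq => neq.
  by have /forall_inP/(_ j jX) := disX i iX; rewrite neq.
have covX i : i \in P -> exists2 j, j \in X & eqv i j.
  move=> iP; apply: contrapT => noj.
  have iX : i \notin X.
    by apply/negP => iX; apply: noj; exists i => //; rewrite /eqv subrr rpred0.
  have nj j : j \in X -> ~~ eqv i j by move=> jX; apply/negP => e; apply: noj; exists j.
  have : i |: X = X.
    apply: maxX; last exact: subsetUr.
    apply/andP; split; first by rewrite subUset sub1set iP.
    apply/forall_inP => u /setU1P[->|uX]; apply/forall_inP => v /setU1P[->|vX].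
    - by rewrite eqxx.
    - by rewrite nj ?implybT.
    - by apply/implyP => _; apply: contra (nj u uX); apply: eqv_sym.
    - by have /forall_inP := disX u uX; apply.
  by move/setP/(_ i); rewrite setU11 (negPf iX).
exists #|X|; split.
  rewrite subset_leq_card // andbT card_gt0; apply/set0Pn.
  have [i iP] : exists i, i \in P by apply/set0Pn; rewrite -card_gt0.
  by have [j jX _] := covX i iP; exists j.
move=> u Uu.
have f_ex i : exists j, i \in X -> j \in X /\ u + val i - val j \in M.
  have [iX|] := boolP (i \in X); last by exists i.
  have [j jP Mj] := HU u Uu i (subsetP sXP i iX); have [j' j'X Mj'] := covX j jP.
  exists j' => _; split=> //.
  by rewrite -[u + val i](subrK (val j)) -addrA rpredD.
have [f fP] := boolp.choice f_ex.
have f_inj : {in X &, injective f}.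
  move=> i i' iX i'X E; apply: eqX => //; rewrite /eqv.
  have [_ M1] := fP i iX; have [_ M2] := fP i' i'X.
  have := rpredB M1 M2; rewrite E; congr (_ \in M).
  by rewrite !opprD !opprK; ring.
have fX : f @: X = X.
  apply/eqP; rewrite eqEcard card_in_imset // leqnn andbT.
  by apply/subsetP => z /imsetP[i iX ->]; have [] := fP i iX.
have : \sum_(i in X) (u + val i - val (f i)) \in M.
  by apply: rpred_sum => i iX; have [] := fP i iX.
rewrite sumrB big_split /= sumr_const.
have -> : \sum_(i in X) val (f i) = \sum_(i in X) val i.
  by rewrite -[in RHS]fX big_imset.
by rewrite addrK.
Qed.

Lemma lev_sum_seq (T : comNzRingType) (S : T -> Prop) k (I : eqType) (r : seq I) (f : I -> T) :
  S 0 -> S 1 -> S (-1) -> (forall i, i \in r -> lev S k (f i)) ->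
  lev S (k + size r) (\sum_(i <- r) f i).
Proof.
move=> S0 S1 SN1; elim: r => [|i r IHr] Hf; first by rewrite big_nil; apply: lev0.
rewrite big_cons /= addnS; apply: levD => //.
  by apply: lev_leq (Hf i (mem_head _ _)) => //; rewrite leq_addr.
by apply: IHr => j jr; apply: Hf; rewrite inE jr orbT.
Qed.

Lemma common_denominator (T : comNzRingType) (q1 q2 q3 q4 a b c d : T) :
  q1 * q2 * (q3 * q4) * (a * b + c * d) =
  q1 * a * (q2 * b) * (q3 * q4) + q3 * c * (q4 * d) * (q1 * q2).
Proof. by ring. Qed.

(** For [d > 0] this is the additive group of algebraic integers divided by [d], made a predicate so
    that it can serve as [M] in [common_multiple]. *)
Definition scaled_Aint (d : nat) : {pred algC} := fun v => d%:R * v \in Aint.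

Fact scaled_Aint_zmod_closed d : zmod_closed (scaled_Aint d).
Proof.
have memE v : (v \in scaled_Aint d) = (d%:R * v \in Aint) by [].
split=> [|x y]; rewrite !memE ?mulr0 ?Aint0 // => Ax Ay.
by rewrite mulrBr rpredB.
Qed.
HB.instance Definition _ d :=
  GRing.isZmodClosed.Build algC (scaled_Aint d) (scaled_Aint_zmod_closed d).

Lemma model_of_small_doubling (C K : nat) : exists D c c0, (0 < c)%N /\
  forall p (A : {set 'F_p}), prime p -> (2 <= #|A|)%N ->
  (#|sumset A A| <= C * #|A|)%N -> (#|A| ^ c0 < p)%N ->
  exists S : 'F_p * algC -> Prop, [/\ good S K D (#|A| ^ c),
    forall m : int, (`|m| <= #|A|)%N -> S (m%:~R, m%:~R)
  & forall a, a \in A -> exists alpha, S (a, alpha)].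
Proof.
(* Clearing denominators costs three levels per level above [r + 1]. It is done up to level [K + 4],
   whatever [K], so that the level-3 covering relation can be transferred: [r + 1 + 3 * (K + 4)]. *)
set r := (C ^ 4)%N; set K0 := (r + 3 * K + 13)%N.
have [D [c [c0 [cpos mod]]]] := model_exists r K0.
exists D, (2 * (c + r + 1))%N, (2 * c0)%N; split; first by rewrite muln_gt0 /= addn1.
move=> p A pr_p A2 leC ltp; set n := #|A| in A2 leC ltp *; set H := (n ^ 2)%N.
have n0 : (0 < n)%N by apply: leq_trans A2.
have nH : (n <= H)%N by rewrite -[X in (X <= _)%N]expn1 leq_pexp2l.
have H2 : (2 <= H)%N by apply: leq_trans nH.
have H0 : (0 < H)%N by apply: leq_trans H2.
have [X [leX cov]] := ruzsa_covering n0 leC.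
have mult := small_multiple cov.
(* Padding with zeros gives exactly the [r] elements that [model_exists] expects. *)
pose xs := enum X ++ nseq (r - #|X|) 0.
have szxs : size xs = r by rewrite size_cat size_nseq -cardE subnKC.
have ltp' : (H ^ c0 < p)%N by rewrite -expnM.
have [S [gS Sint Sxs]] := mod p H pr_p H2 ltp' xs szxs.
have [S0 S1 SN1] : [/\ S 0, S 1 & S (-1)]
  by split; [apply: (good0 gS)|apply: (good1 gS)|apply: (goodN1 gS)].
have tau_ex x : exists t, x \in X -> S (x, t).
  have [xX|] := boolP (x \in X); last by exists 0.
  have [|t St] := Sxs x; first by rewrite mem_cat mem_enum xX.
  by exists t.
have [tau tauP] := boolp.choice tau_ex.
have qf_ex a : exists qf : nat * ('F_p -> nat), a \in A -> [/\ (0 < qf.1 <= H)%N,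
    (forall x, qf.2 x <= H)%N & a *+ qf.1 = \sum_(x in X) x *+ qf.2 x].
  have [aA|] := boolP (a \in A); last by exists (0%N, fun=> 0%N).
  by have [q [f Hqf]] := mult a aA; exists (q, f).
have [qf qfP] := boolp.choice qf_ex.
pose al a : algC := (\sum_(x in X) ((qf a).2 x)%:R * tau x) / (qf a).1%:R.
pose S' (z : 'F_p * algC) := S z \/ exists2 a, a \in A & z = (a, al a).
have qC0 a : a \in A -> ((qf a).1%:R : algC) != 0.
  by case/qfP => /andP[q0 _] _ _; rewrite pnatr_eq0 -lt0n.
(* The new lifts are fractions over [S]; multiplying by a [q] that is nonzero on both sides turns an
   expression in them into one over [S], so that zero tests carry over. *)
have lift k z : lev S' k z -> exists q : 'F_p * algC,
    [/\ lev S (r + 1 + 3 * k) q, q.1 != 0, q.2 != 0 & lev S (r + 1 + 3 * k) (q * z)].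
  elim: k z => [|k IHk] z.
    rewrite muln0 addn0; move=> [Sz|[a aA ->]].
      exists 1; rewrite mul1r !oner_neq0; split=> //; first exact: lev1.
      by apply: (lev_leq S0 S1 SN1) (_ : lev S 0 z).
    have [/andP[q0 leq] lef Ea] := qfP a aA.
    pose q : 'F_p * algC := ((qf a).1%:R, (qf a).1%:R).
    have Sq : S q by apply: (Sint (qf a).1).
    have q2 : q.2 != 0 by apply: qC0.
    exists q; split=> //.
    - exact: (lev_leq S0 S1 SN1) (_ : lev S 0 q).
    - by rewrite (good_zero gS) //; apply: (lev_leq S0 S1 SN1) (_ : lev S 0 q).
    have -> : q * (a, al a) = \sum_(x <- enum X)
        (((qf a).2 x)%:R, ((qf a).2 x)%:R) * (x, tau x).
      apply: injective_projections.
        rewrite [RHS](rmorph_sum (fst : {rmorphism _ -> _})) /= mulr_natl Ea.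
        by rewrite big_enum; apply: eq_bigr => x _; rewrite /= mulr_natl.
      rewrite [RHS](rmorph_sum (snd : {rmorphism _ -> _})) /= mulrC divfK ?qC0 //.
      by rewrite big_enum.
    apply: (@lev_leq _ _ S0 S1 SN1 (1 + size (enum X))).
      by rewrite addnC -cardE leq_add2r.
    apply: lev_sum_seq => // x; rewrite mem_enum => xX; apply: levM => //.
      by apply: (Sint ((qf a).2 x)); apply: lef.
    exact: tauP.
  move=> [a [b [c' [d [/IHk[qa [la a1 a2 La]] /IHk[qb [lb b1 b2 Lb]]
     /IHk[qc [lc c1 c2 Lc]] /IHk[qd [ld d1 d2 Ld]] ->]]]]].
  have -> : (r + 1 + 3 * k.+1 = (r + 1 + 3 * k).+3)%N by rewrite mulnS [(3 + _)%N]addnC addnA addn3.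
  exists ((qa * qb) * (qc * qd)); split.
  - by apply: lev_leq (leqnSn _) _ => //; do 2!apply: levM => //; apply: levM.
  - by rewrite /= !mulf_neq0.
  - by rewrite /= !mulf_neq0.
  have -> : qa * qb * (qc * qd) * (a * b + c' * d) =
     (qa * a) * (qb * b) * (qc * qd) + (qc * c') * (qd * d) * (qa * qb).
    exact: common_denominator.
  by apply: levD => //; apply: levM => //; apply: levM.
have zeroS' k z : (k <= K + 4)%N -> lev S' k z -> (z.1 == 0) = (z.2 == 0).
  move=> lekK /lift[q [lq q1 q2 lqz]].
  have : ((q * z).1 == 0) = ((q * z).2 == 0).
    by apply: (good_zero gS); apply: lev_leq lqz => //; rewrite /K0; lia.
  by rewrite /= !mulf_eq0 (negPf q1) (negPf q2).
have SS' z : S z -> S' z by left.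
have S'A a : a \in A -> S' (a, al a) by move=> aA; right; exists a.
have S'0 := SS' _ S0; have S'1 := SS' _ S1; have S'N1 := SS' _ SN1.
have DH : (n ^ (2 * (c + r + 1)) = H ^ (c + r + 1))%N by rewrite expnM.
rewrite DH.
have leHc e : (e <= c + r + 1)%N -> (H ^ e <= H ^ (c + r + 1))%N by move=> le; rewrite leq_pexp2l.
have lec : (c <= c + r + 1)%N by rewrite -addnA leq_addr.
have ler_ : (r <= H ^ r)%N.
  apply: leq_trans (ltnW (ltn_expl r (isT : 1 < 2)%N)) _.
  by case: (r) => // r'; rewrite leq_exp2r.
exists S'; split; [split=> // | by move=> m lem; left; apply: Sint; apply: leq_trans nH
   | by move=> a aA; exists (al a); apply: S'A].
- by move=> z; apply: zeroS'; rewrite leq_addr.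
- move=> z [Sz|[a aA ->]] nu.
    by apply: le_trans (good_bound gS Sz nu) _; rewrite ler_nat leHc.
  have [/andP[q0 leq] lef Ea] := qfP a aA.
  rewrite /= /al fmorph_div normf_div rmorph_nat normr_nat ler_pdivrMr ?ltr0n //.
  apply: le_trans (_ : (H ^ (c + r + 1))%:R <= _); last first.
    by rewrite ler_peMr ?ler0n // (ler_nat _ 1).
  rewrite rmorph_sum; apply: le_trans (ler_norm_sum _ _ _) _.
  apply: le_trans (_ : \sum_(x in X) (H * H ^ c)%:R <= _).
    apply: ler_sum => x xX; rewrite rmorphM rmorph_nat normrM normr_nat natrM.
    by rewrite ler_pM ?ler_nat ?lef //; apply: (good_bound gS (tauP x xX)).
  rewrite sumr_const -[X in X <= _]mulr_natr -natrM ler_nat addnAC addn1 expnD expnS leq_mul //.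
  exact: leq_trans leX ler_.
- have [Delta [D0 Db HD]] := good_den gS.
  (* The covering relation lifts to [al a + (al d' - al e') = tau x + (al d - al e)] with
     [Delta * tau x] integral, so adding [al a] sends classes of differences to classes of
     differences. This yields one multiplier [s <= n ^ 2] for all [a], where a product of the
     separate denominators would be too large. *)
  pose U u := exists2 a, a \in A & u = al a.
  have PA0 : (0 < #|setX A A|)%N by rewrite cardsX muln_gt0 n0.
  have [|s [/andP[s0 les] HsU]] := @common_multiple _ (setX A A)
      (fun i => al i.1 - al i.2) (scaled_Aint Delta) U PA0.
    move=> u [a aA ->] [d' e'] /setXP[/= d'A e'A].
    have [x [d [e [xX dA eA E]]]] := cov a d' e' aA d'A e'A.
    exists (d, e); first by rewrite inE /= dA eA.
    have LA k a' : a' \in A -> lev S' k (a', al a').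
      by move=> a'A; apply: (@lev_leq _ S' S'0 S'1 S'N1 0) => //; apply: S'A.
    have Sx : S' (x, tau x) by left; apply: tauP.
    have L1 : lev S' 2 ((a, al a) + (d', al d') - (e', al e')).
      by apply: (levB S'0 S'1 S'N1); [apply: (levD S'0 S'1 S'N1)|]; apply: LA.
    have L2 : lev S' 2 ((x, tau x) + (d, al d) - (e, al e)).
      apply: (levB S'0 S'1 S'N1); last exact: LA.
      by apply: (levD S'0 S'1 S'N1); [|apply: LA].
    have := levB S'0 S'1 S'N1 L1 L2.
    move=> /(zeroS' 3) -/(_ _)/esym; rewrite addn4 => /(_ isT).
    rewrite /= E subrr eqxx subr_eq0 => /eqP Ez.
    have -> : al a + (al d' - al e') - (al d - al e) = tau x.
      by rewrite addrA Ez -(addrA (tau x)) addrK.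
    exact: (HD (x, tau x) (tauP x xX)).
  exists (Delta * s)%N; split; first by rewrite muln_gt0 D0.
    apply: leq_trans (leq_mul Db les) _; rewrite cardsX -/n mulnn -/H -expnSr.
    by rewrite leHc // -addn1 addnAC leq_addr.
  move=> z [Sz|[a aA ->]] /=; rewrite natrM.
    by rewrite mulrAC rpredM ?HD // Aint_Cnat ?natr_nat.
  have HsU' : al a *+ s \in scaled_Aint Delta by apply: HsU; exists a.
  by rewrite -mulrA [s%:R * _]mulr_natl; exact: HsU'.
- have [mu Hmu] := good_conj gS; exists mu => nu; have [i ltiD Hi] := Hmu nu.
  exists i => // z [/Hi //|[a aA ->]] /=.
  rewrite /al !fmorph_div !rmorph_nat !rmorph_sum; congr (_ / _).
  by apply: eq_bigr => x xX; rewrite !rmorphM !rmorph_nat; congr (_ * _); apply: (Hi _ (tauP x xX)).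
Qed.

(** The zero test makes the products [xi x * eta x] equal for all [x] and keeps the [xi x] distinct,
    so factorizations of [m] become divisors of one algebraic number; the factor [Delta ^ 2 ^ k]
    makes them integral. *)
Lemma divisor_pairs D k : exists Kd, forall (F : fieldType) (S : F * algC -> Prop) K b,
  let e := (2 ^ k + 2 * 3 ^ k)%N in
  (2 <= b)%N -> good S K D b -> (k + 2 <= K)%N -> forall (m : F) (xs : seq F),
  m != 0 -> uniq xs ->
  (forall x, x \in xs -> exists y xi eta,
     [/\ lev S k (x, xi), lev S k (y, eta) & x * y = m]) ->
  exists N, [/\ (0 < N)%N, (N <= b ^ (e * (2 * D)))%N &
    (size xs <= Kd * ((trunc_log 2 (b ^ (e * (2 * D + 2)))).+1 *
                      size (divisors (N ^ D`!))) ^ D)%N].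
Proof.
have [Kd HKd] := divisors_number_field D; exists Kd => F S K b e b2 gS kK m xs m0 uxs Hxs.
have b0 : (0 < b)%N by apply: leq_trans b2.
have [S0 S1 SN1] : [/\ S 0, S 1 & S (-1)]
  by split; [apply: (good0 gS)|apply: (good1 gS)|apply: (goodN1 gS)].
have [xsE|[x0 x0s]] : xs = [::] \/ exists x0, x0 \in xs.
  by case: (xs) => [|x s]; [left|right; exists x; rewrite mem_head].
  by exists 1%N; rewrite expn_gt0 b0 xsE.
have lift_ex x : exists t : F * (algC * algC), x \in xs ->
    [/\ lev S k (x, t.2.1), lev S k (t.1, t.2.2) & x * t.1 = m].
  have [xX|] := boolP (x \in xs); last by exists (0, (0, 0)).
  by have [y [xi [eta H]]] := Hxs x xX; exists (y, (xi, eta)).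
have [t tP] := boolp.choice lift_ex.
pose xi x := (t x).2.1; pose eta x := (t x).2.2; pose y x := (t x).1.
have Lx x : x \in xs -> lev S k (x, xi x) by case/tP.
have Ly x : x \in xs -> lev S k (y x, eta x) by case/tP.
have Exy x : x \in xs -> x * y x = m by case/tP.
have zeroS l z : (l <= K)%N -> lev S l z -> (z.1 == 0) = (z.2 == 0).
  by move=> lK Lz; apply: (good_zero gS); apply: lev_leq Lz.
have kK0 : (k <= K)%N by apply: leq_trans kK; rewrite leq_addr.
have nzx x : x \in xs -> x != 0 by move=> /Exy E; apply: contraNneq m0 => x0E; rewrite -E x0E mul0r.
have nzxi x : x \in xs -> xi x != 0.
  by move=> xX; have /= <- := zeroS k _ kK0 (Lx x xX); apply: nzx.
have nzy x : x \in xs -> eta x != 0.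
  move=> xX; have /= <- := zeroS k _ kK0 (Ly x xX); apply: contraNneq m0 => yE.
  by rewrite -(Exy x xX) yE mulr0.
pose mC := xi x0 * eta x0.
have ExyC x : x \in xs -> xi x * eta x = mC.
  move=> xX; apply/eqP; rewrite -subr_eq0.
  have L : lev S k.+2 ((x, xi x) * (y x, eta x) - (x0, xi x0) * (y x0, eta x0)).
    by apply: levB => //; apply: levM => //; [apply: Lx|apply: Ly|apply: Lx|apply: Ly].
  have := zeroS _ _ _ L; rewrite -addn2 => /(_ kK) /= <-.
  by rewrite !Exy // subrr.
have xi_inj : {in xs &, injective xi}.
  move=> x x' xX x'X E; apply/eqP; rewrite -subr_eq0.
  have L : lev S k.+1 ((x, xi x) - (x', xi x')) by apply: levB => //; apply: Lx.
  have -> := zeroS _ _ _ L; last by lia.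
  by rewrite /= E subrr.
have [Delta [D0 Db HD]] := good_den gS; have [mu Hmu] := good_conj gS.
set d := (Delta ^ 2 ^ k)%N.
have d0 : (d%:R : algC) != 0 by rewrite pnatr_eq0 -lt0n expn_gt0 D0.
have led : (d <= b ^ 2 ^ k)%N by rewrite leq_exp2r // expn_gt0.
pose Xi := [seq d%:R * xi x | x <- xs].
have uXi : uniq Xi.
  rewrite map_inj_in_uniq // => x x' xX x'X /(mulfI d0); exact: xi_inj.
pose M := d%:R * d%:R * mC.
have M0 : M != 0 by rewrite !mulf_neq0 ?nzxi ?nzy.
have be0 : (0 < b ^ e)%N by rewrite expn_gt0 b0.
have bnd (z : F * algC) (nu : aut) : lev S k z -> `|nu (d%:R * z.2)| <= (b ^ e)%:R.
  move=> Lz; rewrite rmorphM rmorph_nat normrM normr_nat /e expnD natrM.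
  by rewrite ler_pM ?ler_nat //; apply: lev_bound b2 gS _ _ _ Lz.
have divM x : x \in xs -> M / (d%:R * xi x) = d%:R * eta x.
  move=> xX; rewrite /M -(ExyC x xX) mulrACA [LHS]mulrAC divff ?mul1r //.
  by rewrite mulf_neq0 ?nzxi.
have [||N [N0 leN szN]] := HKd mu (b ^ e)%N M Xi be0 M0 uXi.
- move=> nu; have [i ltiD Hi] := Hmu nu; exists i => // z.
  have agx x : x \in xs -> nu (xi x) = mu i (xi x).
    by move=> xX; apply: (lev_conj Hi (Lx x xX)).
  have agy x : x \in xs -> nu (eta x) = mu i (eta x).
    by move=> xX; apply: (lev_conj Hi (Ly x xX)).
  rewrite inE => /predU1P[->|/mapP[x xX ->]].
    by rewrite /M /mC !rmorphM !rmorph_nat agx ?agy.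
  by rewrite !rmorphM !rmorph_nat agx.
- move=> z /mapP[x xX ->]; rewrite divM //; split.
  + by rewrite mulf_neq0 ?nzxi.
  + exact: lev_den HD (Lx x xX).
  + exact: lev_den HD (Ly x xX).
  + by move=> nu; split; [apply: (bnd _ _ (Lx x xX))|apply: (bnd _ _ (Ly x xX))].
by exists N; rewrite !expnM; split=> //; rewrite size_map -!expnM in szN; rewrite -expnM.
Qed.

(** * Counting factorizations *)

Section Numeric.
Local Open Scope nat_scope.

Lemma sqr_le_exp2 t : t * t <= 2 ^ t.+1.
Proof.
elim: t => // t IHt; rewrite expnS mul2n -addnn.
have := ltn_expl t (isT : 1 < 2); rewrite expnS in IHt *; lia.
Qed.

Lemma poly_exp_bound c t : t * (c + 2 * t) * 2 ^ t <= 2 * (c + 2) * 4 ^ t.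
Proof.
have -> : 4 ^ t = 2 ^ t * 2 ^ t by rewrite -expnMn.
rewrite mulnA leq_mul2r; apply/orP; right.
have := sqr_le_exp2 t; rewrite expnS => H.
have H1 : t <= t * t by case: (t) => // t'; rewrite leq_pmulr.
apply: leq_trans (_ : (c + 2) * (t * t) <= _); last by nia.
rewrite mulnDr mulnDl mulnCA leq_add2r mulnC leq_mul2l H1 orbT //.
Qed.

(* The exponents of [divisor_pairs] in terms of [l ~ log n] and [t ~ log l / 2]. *)
Lemma count_bound (c1 c2 Kd D l t X tl dv : nat) :
  4 ^ t <= l -> l <= 2 ^ (2 * t + 2) ->
  tl <= c1 * l -> dv ^ t <= (c2 * l).+1 ^ (t * 2 ^ t) * 2 ^ (c2 * l) ->
  X <= Kd * (tl.+1 * dv) ^ D ->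
  X ^ t <= 2 ^ ((Kd + D * (2 * (c1 + 5)) + D * (2 * (c2 + 5)) + D * c2) * l).
Proof.
move=> tl4 l4 le_tl le_dv leX.
have tl_ : t <= l by apply: leq_trans tl4; apply: ltnW; rewrite ltn_expl.
have l0 : 0 < l by apply: leq_trans tl4; rewrite expn_gt0.
have lin c : (c * l).+1 <= 2 ^ (c + 3 + 2 * t).
  apply: leq_trans (_ : c.+1 * l <= _); first by rewrite mulSn -addn1 addnC leq_add2r.
  apply: leq_trans (leq_mul (ltnW (ltn_expl c.+1 (isT : 1 < 2))) l4) _.
  by rewrite -expnD leq_pexp2l //; lia.
have expo c : (c * l).+1 ^ (t * 2 ^ t) <= 2 ^ (2 * (c + 5) * l).
  apply: leq_trans (_ : (2 ^ (c + 3 + 2 * t)) ^ (t * 2 ^ t) <= _).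
    by case: (t * 2 ^ t) => // e; rewrite leq_exp2r.
  rewrite -expnM leq_pexp2l // mulnA [(_ + _) * t]mulnC.
  apply: leq_trans (poly_exp_bound (c + 3) t) _.
  by rewrite -addnA leq_mul2l tl4 orbT.
have powt e x y : x <= y -> x ^ e <= y ^ e by case: e => // e le; rewrite leq_exp2r.
have pw e : 2 ^ (D * e) = (2 ^ e) ^ D by rewrite -expnM mulnC.
apply: leq_trans (powt t _ _ leX) _.
rewrite expnMn -expnM [D * t]mulnC expnM expnMn expnMn.
rewrite !mulnDl !expnD -!mulnA !pw; apply: leq_mul.
  apply: leq_trans (powt t _ _ (ltnW (ltn_expl Kd (isT : 1 < 2)))) _.
  by rewrite -expnM leq_pexp2l // leq_mul2l tl_ orbT.
apply: leq_mul.
  apply: (powt D); rewrite mulnA; apply: leq_trans (expo c1).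
  apply: leq_trans (_ : (c1 * l).+1 ^ t <= _); first by apply: (powt t).
  by rewrite leq_pexp2l // leq_pmulr // expn_gt0.
rewrite -expnMn; apply: (powt D); apply: leq_trans le_dv _.
by rewrite leq_mul2r mulnA expo orbT.
Qed.
End Numeric.

(** With [l] about [log n] and [4 ^ t] about [l], the exponent [t * 2 ^ t] is about
    [sqrt l * log l], so the small primes still contribute only [2 ^ O(l)]; the [t]-th root of this
    is [exp(O(log n / log log n))]. *)
Lemma factor_bound_nat (C k : nat) : exists c0 Cb, forall p (A : {set 'F_p}),
  prime p -> (2 <= #|A|)%N -> (#|sumset A A| <= C * #|A|)%N -> (#|A| ^ c0 < p)%N ->
  exists S : 'F_p * algC -> Prop, [/\ S 0, S 1 & S (-1)] /\ [/\
    forall m : int, (`|m| <= #|A|)%N -> S (m%:~R, m%:~R),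
    forall a, a \in A -> exists alpha, S (a, alpha)
  & forall (m : 'F_p) (xs : seq 'F_p), m != 0 -> uniq xs ->
    (forall x, x \in xs -> exists y xi eta,
       [/\ lev S k (x, xi), lev S k (y, eta) & x * y = m]) ->
    (size xs ^ trunc_log 4 (trunc_log 2 #|A|).+1
      <= 2 ^ (Cb * (trunc_log 2 #|A|).+1))%N].
Proof.
have [D [c [c0 [cpos mod]]]] := model_of_small_doubling C (k + 2).
have [Kd HKd] := divisor_pairs D k.
pose e := (2 ^ k + 2 * 3 ^ k)%N.
pose c1 := (c * (e * (2 * D + 2)))%N; pose c2 := (c * (e * (2 * D)) * D`!)%N.
exists c0, (Kd + D * (2 * (c1 + 5)) + D * (2 * (c2 + 5)) + D * c2)%N.
move=> p A pr_p A2 leC ltp; have [S [gS Sint SA]] := mod p A pr_p A2 leC ltp.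
set n := #|A| in A2 leC ltp gS Sint *.
have n0 : (0 < n)%N by apply: leq_trans A2.
have b2 : (2 <= n ^ c)%N by apply: (leq_trans A2); rewrite -[X in (X <= _)%N]expn1 leq_pexp2l.
exists S; split; first by split; [apply: (good0 gS)|apply: (good1 gS)|apply: (goodN1 gS)].
split=> // m xs m0 uxs Hxs; set l := (trunc_log 2 n).+1.
have [N [N0 leN szN]] := HKd _ S (k + 2)%N (n ^ c)%N b2 gS (leqnn _) m xs m0 uxs Hxs.
have /andP[_ ltn2] := trunc_log_bounds (isT : (1 < 2)%N) n0.
have l0 : (0 < l)%N by [].
have powle x : ((n ^ c) ^ x <= 2 ^ (c * x * l))%N.
  have -> : (2 ^ (c * x * l) = (2 ^ l) ^ (c * x))%N by rewrite -expnM mulnC.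
  by rewrite -expnM; case: (c * x)%N => // z; rewrite leq_exp2r // ltnW.
have /andP[t1 t2] := trunc_log_bounds (isT : (1 < 4)%N) l0.
have l4 : (l <= 2 ^ (2 * trunc_log 4 l + 2))%N.
  by apply: leq_trans (ltnW t2) _; rewrite -[4%N]/(2 ^ 2)%N -expnM mulnS addnC.
apply: (@count_bound c1 c2 Kd D l _ _ _ _ t1 l4 _ _ szN).
- rewrite -[X in (_ <= X)%N](@trunc_expnK 2 (c1 * l)) //.
  by apply: leq_trunc_log; apply: powle.
- apply: divisor_bound; first by rewrite expn_gt0 N0.
  apply: leq_trans (_ : ((n ^ c) ^ (e * (2 * D))) ^ D`! <= _)%N.
    by rewrite leq_exp2r // fact_gt0.
  by rewrite -expnM; apply: leq_trans (powle _) _; rewrite leq_pexp2l // /c2 mulnA.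
Qed.

(** * From integer exponents to real logarithms *)

Section RealBound.
Variable R : realType.

(** Makes [ln (ln n)] positive from [n = 3] on. From [expR (- (1 / 6)) >= 5 / 6] follows
    [e <= (6 / 5) ^ 6 < 3]. *)
Lemma ln3_gt1 : 1 < ln (3 : R).
Proof.
suff e3 : expR 1 < 3 :> R.
  by rewrite -[X in X < _](expRK (1 : R)) ltr_ln ?posrE ?expR_gt0 ?ltr0n.
have h : 5 / 6 <= expR (- (1 / 6)) :> R.
  by apply: le_trans (expR_ge1Dx _); lra.
have -> : expR 1 = (expR (- (1 / 6)))^-1 ^+ 6 :> R.
  by rewrite -expRN opprK -expRM_natl; congr expR; field.
apply: le_lt_trans (_ : (5 / 6)^-1 ^+ 6 < 3).
  by rewrite lerXn2r ?nnegrE ?invr_ge0 ?expR_ge0 ?lef_pV2 ?posrE ?expR_gt0 //; lra.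
have -> : (5 / 6)^-1 = 6 / 5 :> R by field.
by rewrite !exprS expr0; lra.
Qed.

Lemma ln2_itv : 0 < ln (2 : R) <= 1.
Proof.
rewrite ln_gt0 ?ltr1n //=.
have -> : (2 : R) = 1 + 1 by lra.
by apply: le_ln1Dx; lra.
Qed.

Lemma lnln_gt0 (n : nat) : (3 <= n)%N -> 0 < ln (ln (n%:R : R)).
Proof.
move=> n3; apply: ln_gt0; apply: lt_le_trans ln3_gt1 _.
by rewrite ler_ln ?posrE ?ltr0n ?ler_nat // (leq_trans _ n3).
Qed.

Lemma ln_lnln_ge1 (n : nat) : (3 <= n)%N -> 1 <= ln (n%:R : R) / ln (ln n%:R).
Proof.
move=> n3; have := lnln_gt0 n3; have := @ln_sublinear R (ln n%:R).
have y0 : 0 < ln (n%:R : R) by apply: ln_gt0; rewrite ltr1n (leq_trans _ n3).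
move=> /(_ y0)/ltW lely ly0.
by rewrite ler_pdivlMr // mul1r.
Qed.

(** The constant 8 is the product of those in [l * ln 2 <= 2 * ln n] and [ln (ln n) <= 4 * t];
    [n >= 8] ensures [l >= 4], hence [t >= 1]. *)
Lemma count_real (n X Cb : nat) : let l := (trunc_log 2 n).+1 in (8 <= n)%N ->
  (X ^ trunc_log 4 l <= 2 ^ (Cb * l))%N ->
  X%:R <= expR (8 * Cb%:R * (ln n%:R / ln (ln n%:R))) :> R.
Proof.
move=> l n8 leX; have [->|X0] := posnP X; first exact: expR_ge0.
set t := trunc_log 4 l in leX; set y := ln (n%:R : R).
have n3 : (3 <= n)%N by apply: leq_trans n8.
have n0 : (0 < n)%N by apply: leq_trans n8.
have ly0 := lnln_gt0 n3; have /andP[ln20 ln21] := ln2_itv.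
have /andP[n1 n2] := trunc_log_bounds (isT : (1 < 2)%N) n0.
have l4 : (4 <= l)%N by rewrite ltnS; apply: trunc_log_max.
have l0 : (0 < l)%N by [].
have /andP[t1 t2] := trunc_log_bounds (isT : (1 < 4)%N) l0.
have t0 : (1 <= t)%N by apply: trunc_log_max.
have y1 : l%:R * ln 2 <= 2 * y :> R.
  have : (l.-1)%:R * ln 2 <= y :> R.
    rewrite mulr_natl -lnXn // -natrX ler_ln ?posrE ?ltr0n ?expn_gt0 //.
    by rewrite ler_nat.
  have : (l%:R : R) <= 2 * (l.-1)%:R by rewrite -natrM ler_nat; move: l4; lia.
  by move: ln20; set a := ln 2; set c := (l.-1)%:R; set d := l%:R; nra.
have y2 : y <= l%:R.
  apply: le_trans (_ : ln ((2 ^ l)%:R : R) <= _).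
    by rewrite ler_ln ?posrE ?ltr0n ?expn_gt0 ?ler_nat // ltnW.
  by rewrite natrX lnXn // -[X in X <= _]mulr_natl ler_piMr.
have y0 : 0 < y by apply: ln_gt0; rewrite ltr1n (leq_trans _ n3).
have ly1 : ln y <= 4 * t%:R.
  apply: le_trans (_ : ln (l%:R : R) <= _); first by rewrite ler_ln ?posrE ?ltr0n.
  apply: le_trans (_ : ln ((4 ^ t.+1)%:R : R) <= _).
    by rewrite ler_ln ?posrE ?ltr0n ?expn_gt0 ?ler_nat // ltnW.
  rewrite natrX lnXn // -[X in X <= _]mulr_natl.
  have -> : (4 : R) = 2 ^+ 2 by rewrite -natrX.
  rewrite lnXn // mulr2n -natr1.
  have : 1 <= (t%:R : R) by rewrite (ler_nat _ 1).
  by move: ln20 ln21; set a := ln 2; set c := t%:R; rewrite -natrX; nra.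
have X1 : 1 <= (X%:R : R) by rewrite (ler_nat _ 1).
have lX0 : 0 <= ln (X%:R : R) by apply: ln_ge0.
have lX : t%:R * ln (X%:R : R) <= Cb%:R * (l%:R * ln 2).
  rewrite mulr_natl -lnXn ?ltr0n // -natrX mulrA -natrM [X in _ <= X]mulr_natl -lnXn //.
  by rewrite -natrX ler_ln ?posrE ?ltr0n ?expn_gt0 ?X0 // ler_nat.
rewrite -[X%:R]lnK ?posrE ?ltr0n // ler_expR mulrA ler_pdivlMr //.
have Cb0 : 0 <= (Cb%:R : R) by [].
apply: le_trans (_ : ln X%:R * (4 * t%:R) <= _); first by rewrite ler_wpM2l.
have : Cb%:R * (l%:R * ln 2) <= Cb%:R * (2 * y) by rewrite ler_wpM2l.
by move: lX; set a := ln X%:R; set c := Cb%:R * (_ * _); lra.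
Qed.

Lemma logb_gt_nat (B z : R) (c : nat) : 2 <= B -> c%:R < logb B z -> (2 ^ c)%:R < z.
Proof.
move=> B2; have /andP[ln20 _] := ln2_itv.
have lnB : ln 2 <= ln B by rewrite ler_ln ?posrE ?ltr0n // (lt_le_trans _ B2) ?ltr0n.
have lnB0 : 0 < ln B by apply: lt_le_trans lnB.
rewrite /logb ltr_pdivlMr // => lt1.
have lt2 : c%:R * ln 2 < ln z by apply: le_lt_trans lt1; rewrite ler_wpM2l.
(* For [z <= 0] the logarithm takes the default value 0, and [c * ln 2 < 0] is impossible. *)
have z0 : 0 < z.
  rewrite ltNge; apply/negP => z0; move: lt2; rewrite (ln0 z0) ltNge.
  by rewrite mulr_ge0 // ltW.
move: lt2; rewrite mulr_natl -lnXn // ltr_ln ?posrE ?exprn_gt0 //.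
by rewrite natrX.
Qed.

Lemma tower_gt (B1 B2 : R) (p n : nat) : 2 <= B1 -> 2 <= B2 ->
  n%:R < logb 2 (logb B1 (logb B2 p%:R)) - 1 -> (2 ^ (2 ^ n) < p)%N.
Proof.
move=> h1 h2; rewrite ltrBrDr natr1 => /(logb_gt_nat (lexx _)) H.
have := logb_gt_nat h2 (logb_gt_nat h1 H); rewrite ltr_nat; apply: leq_ltn_trans.
by rewrite !leq_pexp2l // (leq_trans (ltnW (ltn_expl n (isT : 1 < 2)%N))) // leq_pexp2l.
Qed.
End RealBound.

(** * Lower bounds for the sumsets *)

Lemma card_sum_fibers (I V : finType) (P : {set I}) (g : I -> V) (S : {set V}) :
  (forall i, i \in P -> g i \in S) ->
  #|P| = (\sum_(c in S) #|[set i in P | g i == c]|)%N.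
Proof.
move=> gS; rewrite -sum1_card (partition_big g (mem S)) //=.
apply: eq_bigr => c _; rewrite -sum1_card; apply: eq_bigl => i.
by rewrite inE.
Qed.

Lemma Cauchy_Schwarz_nat (I : finType) (S : {set I}) (f : I -> nat) :
  ((\sum_(i in S) f i) ^ 2 <= #|S| * \sum_(i in S) f i ^ 2)%N.
Proof.
rewrite -(leq_pmul2l (isT : (0 < 2)%N)) -mulnn big_distrlr /= big_distrr /=.
have -> : (2 * (#|S| * \sum_(i in S) f i ^ 2) =
    \sum_(i in S) \sum_(j in S) (f i ^ 2 + f j ^ 2))%N.
  rewrite [RHS](eq_bigr (fun i => #|S| * f i ^ 2 + \sum_(j in S) f j ^ 2)%N).
    by rewrite big_split /= sum_nat_const -big_distrr /= addnn mul2n.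
  by move=> i _; rewrite big_split /= sum_nat_const.
apply: leq_sum => i _; rewrite big_distrr /=; apply: leq_sum => j _.
exact: (nat_Cauchy (f i) (f j)).
Qed.

Lemma card_roots_le (F : finFieldType) (P : {poly F}) (B : {set F}) k :
  P != 0 -> (size P <= k.+1)%N -> (forall b, b \in B -> root P b) -> (#|B| <= k)%N.
Proof.
move=> P0 szP rB; rewrite -ltnS; apply: leq_trans szP; rewrite cardE.
apply: max_poly_roots; rewrite ?enum_uniq //.
by apply/allP => b; rewrite mem_enum => /rB.
Qed.

Section FinalReal.
Variable R : realType.
Implicit Types u a d Q : R.

(** For small [n]: [expR (C' * u)] exceeds [C'], hence [n ^ 2], so a nonempty sumset is already
    large enough. *)
Lemma trivial_bound (C' u : R) (n N s : nat) : 1 <= u -> N%:R <= C' ->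
  (n ^ 2 <= N)%N -> (0 < s)%N -> expR (- C' * u) * n%:R ^+ 2 < s%:R.
Proof.
move=> u1 NC nN s0; have C0 : 0 <= C' by apply: le_trans NC.
rewrite mulNr expRN mulrC ltr_pdivrMr ?expR_gt0 //.
apply: lt_le_trans (_ : expR (C' * u) <= _); last first.
  by rewrite ler_peMl ?expR_ge0 // (ler_nat _ 1).
have H := expR_ge1Dx (C' * u).
have H2 : n%:R ^+ 2 <= (N%:R : R) by rewrite -natrX ler_nat.
have H3 : C' <= C' * u by rewrite ler_peMr.
by move: (expR _) H H2 H3 => e; lra.
Qed.

(** The constant factor [Q] is absorbed into the exponent, since [expR (d * u) > d >= Q]. *)
Lemma main_bound (a d u Q : R) (n s : nat) : 1 <= u -> Q <= d -> 0 <= d -> (0 < s)%N ->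
  n%:R ^+ 2 <= s%:R * (Q * expR (a * u)) -> expR (- (a + d) * u) * n%:R ^+ 2 < s%:R.
Proof.
move=> u1 Qd d0 s0 le_n.
have s0' : 0 < (s%:R : R) by rewrite ltr0n.
rewrite mulNr expRN mulrC ltr_pdivrMr ?expR_gt0 // mulrDl expRD.
apply: le_lt_trans le_n _; rewrite ltr_pM2l // mulrC ltr_pM2l ?expR_gt0 //.
have H := expR_ge1Dx (d * u).
have H3 : d <= d * u by rewrite ler_peMr.
by move: (expR _) H H3 => e; lra.
Qed.
End FinalReal.

Lemma exp_lt_of_tower (n c0 p : nat) : (2 * c0 <= n)%N -> (2 ^ (2 ^ n) < p)%N -> (n ^ c0 < p)%N.
Proof.
move=> cn; apply: leq_ltn_trans.
apply: leq_trans (_ : (2 ^ n) ^ c0 <= _)%N.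
  by case: c0 {cn} => // c; rewrite leq_exp2r // ltnW // ltn_expl.
rewrite -expnM leq_pexp2l // -(leq_pmul2l (isT : (0 < 2)%N)) -expnS.
apply: leq_trans (sqr_le_exp2 n); rewrite mulnCA leq_mul2l cn orbT //.
Qed.

Lemma inverse_sumset_large (R : realType) (C : nat) : exists C' : R,
  forall (p n : nat) (A : {set 'F_p}), prime p -> #|A| = n -> (3 <= n)%N ->
  (#|sumset A A| <= C * n)%N -> (2 ^ (2 ^ n) < p)%N -> 0 \notin A ->
  expR (- C' * (ln n%:R / ln (ln n%:R))) * n%:R ^+ 2
    < #|sumset (invset A) (invset A)|%:R.
Proof.
(* Level 3 is that of [(a0 + b0) * a - a0 * b0]. *)
have [c0 [Cb HF]] := factor_bound_nat C 3.
(* From [n3] on, [count_real] applies and [n ^ c0 < p] holds; in [d], 2 is the factor [Q] of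
   [main_bound] and [n3 ^ 2] covers the smaller [n]. *)
pose n3 := (8 + 2 * c0)%N; pose d : R := 2 + (n3 ^ 2)%:R.
exists (8 * Cb%:R + d) => p n A pr_p cardA n_ge3 leC ltp A0.
set u := ln n%:R / ln (ln n%:R); have u1 : 1 <= u := ln_lnln_ge1 R n_ge3.
set S' := sumset (invset A) (invset A).
have Cb0 : 0 <= (Cb%:R : R) by [].
have d0 : 0 <= d by rewrite /d addr_ge0.
have S'0 : (0 < #|S'|)%N.
  have [a aA] : exists a, a \in A.
    by apply/set0Pn; rewrite -card_gt0 cardA (leq_trans _ n_ge3).
  by rewrite card_gt0; apply/set0Pn; exists (a^-1 + a^-1); rewrite mem_sumset ?imset_f.
have [ltn3|len3] := ltnP n n3.
  apply: (@trivial_bound R _ _ _ (n3 ^ 2)) => //; last by rewrite leq_exp2r // ltnW.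
  by rewrite /d; lra.
have n2 : (2 <= #|A|)%N by rewrite cardA (leq_trans _ n_ge3).
have ltp0 : (#|A| ^ c0 < p)%N.
  by rewrite cardA; apply: exp_lt_of_tower ltp; apply: leq_trans len3; rewrite leq_addl.
have leCA : (#|sumset A A| <= C * #|A|)%N by rewrite cardA.
have [S [[S0 S1 SN1] [Sint SA HS]]] := HF p A pr_p n2 leCA ltp0.
set E := expR (8 * Cb%:R * u).
have E1 : 1 <= E.
  rewrite /E -[X in X <= _]expR0 ler_expR.
  by apply: mulr_ge0; [exact: mulr_ge0 | exact: le_trans u1].
pose r c := [set ab in setX A A | ab.1^-1 + ab.2^-1 == c].
have nzA a : a \in A -> a != 0 by move=> aA; apply: contraNneq A0 => <-.
have r_nz c : c != 0 -> (#|r c|)%:R <= E.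
  move=> c0'; have [->|[[a0 b0]]] := set_0Vmem (r c); first by rewrite cards0 (le_trans _ E1).
  rewrite !inE /= => /andP[/andP[a0A b0A] /eqP Ec].
  have [a0n b0n] := (nzA _ a0A, nzA _ b0A).
  pose s := a0 + b0; pose t := a0 * b0.
  have t0 : t != 0 by rewrite mulf_neq0.
  have Ecst : c = s / t.
    by rewrite -Ec /s /t; field; rewrite a0n b0n.
  have s0 : s != 0 by apply: contraNneq c0' => sE; rewrite Ecst sE mul0r.
  have pairP ab : ab \in r c -> [/\ ab.1 \in A, ab.2 \in A &
      (s * ab.1 - t) * (s * ab.2 - t) = t * t].
    case: ab => a b; rewrite !inE /= => /andP[/andP[aA bA] /eqP Eab]; split=> //.
    have [an bn] := (nzA _ aA, nzA _ bA).
    have E2 : s * (a * b) = t * (a + b).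
      have : c * (t * (a * b)) = (a^-1 + b^-1) * (t * (a * b)) by rewrite Eab.
      have -> : (a^-1 + b^-1) * (t * (a * b)) = t * (a + b) by field; rewrite an bn.
      by rewrite Ecst [s / t * _]mulrA (divfK t0).
    have -> : (s * a - t) * (s * b - t) = s * (s * (a * b)) - s * (t * (a + b)) + t * t by ring.
    by rewrite E2 subrr add0r.
  pose xs := [seq s * ab.1 - t | ab <- enum (r c)].
  have inj_xs : {in enum (r c) &, injective (fun ab : 'F_p * 'F_p => s * ab.1 - t)}.
    move=> [a b] [a' b']; rewrite !mem_enum !inE /= => /andP[_ /eqP E3] /andP[_ /eqP E4].
    move=> /addIr/(mulfI s0) Ea; congr (_, _) => //.
    by move: E3; rewrite -E4 Ea => /addrI/invr_inj.
  have szxs : size xs = #|r c| by rewrite size_map -cardE.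
  rewrite -szxs; apply: count_real; first by apply: leq_trans len3; rewrite leq_addr.
  rewrite -cardA; apply: (HS (t * t)).
  - by rewrite mulf_neq0.
  - by rewrite map_inj_in_uniq ?enum_uniq.
  move=> x /mapP[[a b]]; rewrite mem_enum => /pairP[/= aA bA Eab] ->.
  have [[al0 Sa0] [be0 Sb0]] := (SA _ a0A, SA _ b0A).
  have [[al Sa] [be Sb]] := (SA _ aA, SA _ bA).
  have L0 (z : 'F_p * algC) : S z -> lev S 1 z by apply: (@lev_leq _ S S0 S1 SN1 0).
  have L3 (z : 'F_p * algC) : S z ->
      lev S 3 (((a0, al0) + (b0, be0)) * z - (a0, al0) * (b0, be0)).
    move=> Sz; apply: levB => //.
      by apply: levM => //; [apply: levD|apply: L0].
    by apply: (@lev_leq _ S S0 S1 SN1 1) => //; apply: levM.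
  exists (s * b - t), ((al0 + be0) * al - al0 * be0), ((al0 + be0) * be - al0 * be0).
  by split; [exact: (L3 _ Sa)|exact: (L3 _ Sb)|].
(* At [c = 0] the factorization degenerates because [s = 0]; there [a] alone determines the pair. *)
have r_0 : (#|r 0%R| <= n)%N.
  rewrite -cardA -(card_in_imset (f := fst) (D := r 0)).
    apply/subset_leq_card/subsetP => z /imsetP[[a b]].
    by rewrite !inE /= => /andP[/andP[aA _] _] ->.
  move=> [a b] [a' b']; rewrite !inE /= => /andP[_ /eqP E3] /andP[_ /eqP E4] Ea.
  by congr (_, _) => //; move: E3; rewrite -E4 Ea => /addrI/invr_inj.
have cover : (n ^ 2 = \sum_(c in S') #|r c|)%N.
  rewrite -cardA -mulnn -cardsX; apply: card_sum_fibers => -[a b] /setXP[aA bA] /=.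
  by rewrite mem_sumset ?imset_f.
have le_n : n%:R ^+ 2 <= n%:R + #|S'|%:R * E :> R.
  rewrite -natrX cover natr_sum (bigID (fun c => c == 0)) /=; apply: lerD.
    apply: le_trans (_ : (#|r 0|)%:R <= _); last by rewrite ler_nat.
    have [S0'|S0'] := boolP (0 \in S').
      rewrite (bigD1 0) /= ?S0' ?eqxx // big1 ?addr0 // => c /andP[/andP[_ /eqP ->]].
      by rewrite eqxx.
    by rewrite big1 // => c /andP[cS /eqP c0']; rewrite c0' (negPf S0') in cS.
  apply: le_trans (_ : \sum_(c in S') E <= _); last by rewrite sumr_const mulr_natl.
  rewrite [X in _ <= X](bigID (fun c => c == 0)) /=.
  apply: le_trans (_ : \sum_(c in S' | c != 0) E <= _).
    by apply: ler_sum => c /andP[_]; apply: r_nz.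
  by rewrite lerDr sumr_ge0 // => c _; apply: le_trans E1.
apply: (@main_bound R _ d u 2) => //; first by rewrite /d lerDl.
rewrite -/E; have n3R : 3 <= (n%:R : R) by rewrite (ler_nat _ 3).
move: le_n n3R; move: (n%:R) (#|S'|%:R) => x s; nra.
Qed.

(** * Images under a polynomial *)

(** The divided difference of [f], expanded without division so that it is an expression over any
    commutative ring, in particular over the pairs ['F_p * algC]. *)
Definition diff_quotient (T : comNzRingType) (f : {poly int}) (a b : T) : T :=
  \sum_(i < size f) (f`_i)%:~R * \sum_(j < i) a ^+ (i.-1 - j) * b ^+ j.

Lemma diff_quotientP (T : comNzRingType) (f : {poly int}) (a b : T) :
  (map_poly intr f).[a] - (map_poly intr f).[b] = (a - b) * diff_quotient f a b.
Proof.
have szf : (size (map_poly intr f : {poly T}) <= size f)%N by apply: size_poly.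
rewrite !(horner_coef_wide _ szf) -sumrB /diff_quotient mulr_sumr.
apply: eq_bigr => i _; rewrite coef_map_id0 // -mulrBr subrXX mulrCA.
by congr (_ * (_ * _)).
Qed.

Lemma rmorph_diff_quotient (T T' : comNzRingType) (g : {rmorphism T -> T'}) f a b :
  g (diff_quotient f a b) = diff_quotient f (g a) (g b).
Proof.
rewrite rmorph_sum; apply: eq_bigr => i _; rewrite rmorphM rmorph_int rmorph_sum.
by congr (_ * _); apply: eq_bigr => j _; rewrite rmorphM !rmorphXn.
Qed.

Lemma lev_diff_quotient (T : comNzRingType) (S : T -> Prop) (f : {poly int}) k a b :
  S 0 -> S 1 -> S (-1) -> (size f <= k.+1)%N ->
  (forall i, (i < size f)%N -> S (f`_i)%:~R) -> S a -> S b ->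
  lev S (3 * k + 3) (diff_quotient f a b).
Proof.
move=> S0 S1 SN1 szf Sf Sa Sb.
apply: (@lev_leq _ S S0 S1 SN1 ((2 * k + 2) + size f)); first by lia.
apply: lev_sum => // i; rewrite addn2; apply: levM => //.
  by apply: (@lev_leq _ S S0 S1 SN1 0) => //; apply: Sf.
have ltik : (i <= k)%N by have := ltn_ord i; lia.
apply: (@lev_leq _ S S0 S1 SN1 (k.+1 + i)); first by lia.
apply: lev_sum => // j; have ltji := ltn_ord j.
apply: levM => //.
  by apply: (@lev_leq _ S S0 S1 SN1 (0 + (i.-1 - j))); [lia|apply: levX].
by apply: (@lev_leq _ S S0 S1 SN1 (0 + j)); [lia|apply: levX].
Qed.

(* A polynomial with constant [h]-difference agrees with an affine function
   on all of ['F_p]. *)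
Lemma shift_diff_neq0 (p : nat) (g : {poly 'F_p}) (h m : 'F_p) : prime p ->
  h != 0 -> (2 < size g)%N -> (size g <= p)%N ->
  (g \Po ('X + h%:P)) - g - m%:P != 0.
Proof.
move=> pr_p h0 g2 gp; apply/eqP => E0.
have step x : g.[x + h] = g.[x] + m.
  have := congr1 (horner^~ x) E0; rewrite !hornerE horner_comp !hornerE.
  by move=> /subr0_eq <-; rewrite [RHS]addrC subrK.
have steps j : g.[j%:R * h] = g.[0] + j%:R * m.
  elim: j => [|j IHj]; first by rewrite !mul0r addr0.
  by rewrite -natr1 !mulrDl !mul1r step IHj addrA.
pose l := (m / h) *: 'X + (g.[0])%:P.
have szl : (size l < size g)%N.
  apply: leq_ltn_trans g2; apply: leq_trans (size_polyD _ _) _; rewrite geq_max.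
  rewrite (leq_trans (size_scale_leq _ _)) ?size_polyX //.
  by rewrite (leq_trans (size_polyC_leq1 _)).
have szq : size (g - l) = size g by rewrite size_polyDl // size_polyN.
have q0 : g - l != 0 by rewrite -size_poly_gt0 szq; lia.
have := @card_roots_le _ (g - l) [set: 'F_p] p.-1 q0; rewrite szq cardsT card_Fp //.
have p0 := prime_gt0 pr_p.
suff H y : root (g - l) y by move=> /(_ _ (fun y _ => H y)); lia.
have Ey : y = (y / h : 'F_p)%:R * h by rewrite natr_Zp divfK.
rewrite /root /l !hornerE {1}Ey steps natr_Zp.
by apply/eqP; ring.
Qed.

(** Additive energy may be counted by sums or by differences: exchanging two coordinates of a
    quadruple moves one term across the equation. Cauchy-Schwarz produces sums, while only
    differences of values of [f] factor. *)
Lemma energy_swap (I : finType) (V : zmodType) (A : {set I}) (F : I -> V) :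
  (\sum_(x in setX A A) #|[set y in setX A A | (F y.1 + F y.2 == F x.1 + F x.2)%R]|
   = \sum_(x in setX A A) #|[set y in setX A A | (F y.1 - F y.2 == F x.1 - F x.2)%R]|)%N.
Proof.
have E (Q : I * I -> I * I -> bool) :
    (\sum_(x in setX A A) #|[set y in setX A A | Q x y]| =
     \sum_(z | [&& z.1 \in setX A A, z.2 \in setX A A & Q z.1 z.2]) 1)%N.
  rewrite -(pair_big_dep (fun x => x \in setX A A)
    (fun x y => (y \in setX A A) && Q x y) (fun _ _ => 1%N)) /=.
  by apply: eq_bigr => x _; rewrite -sum1_card; apply: eq_bigl => y; rewrite inE.
rewrite !E; pose h (z : (I * I) * (I * I)) := ((z.1.1, z.2.2), (z.2.1, z.1.2)).
have hh z : h (h z) = z by case: z => [[a b] [c d]].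
rewrite (reindex h) /=; last by exists h => z _.
apply: eq_bigl => -[[a b] [c d]]; rewrite !inE /=.
have -> : (F c + F b == F a + F d) = (F c - F d == F a - F b).
  rewrite -subr_eq0 -[RHS]subr_eq0 opprB opprD !addrA.
  by rewrite [F c - F d + _]addrAC [in RHS]addrAC.
by case: (a \in A); case: (b \in A); case: (c \in A); case: (d \in A).
Qed.

Lemma sum_sqr_energy (I V : finType) (P : {set I}) (g : I -> V) (S : {set V}) :
  (forall i, i \in P -> g i \in S) ->
  (\sum_(c in S) #|[set i in P | g i == c]| ^ 2 =
   \sum_(x in P) #|[set y in P | g y == g x]|)%N.
Proof.
move=> gS; rewrite [RHS](partition_big g (mem S)) //=.
apply: eq_bigr => c _; rewrite [RHS](eq_bigr (fun=> #|[set i in P | g i == c]|)).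
  rewrite sum_nat_const -mulnn; congr (_ * _)%N.
  by rewrite -!sum1_card; apply: eq_bigl => i; rewrite inE.
by move=> i /andP[_ /eqP ->].
Qed.

Lemma card_le_fibers (I V : finType) (P : {set I}) (g : I -> V) (S : {set V}) k :
  (forall i, i \in P -> g i \in S) ->
  (forall c, c \in S -> #|[set i in P | g i == c]| <= k)%N -> (#|P| <= #|S| * k)%N.
Proof.
move=> gS le_k; rewrite (card_sum_fibers gS) -sum_nat_const.
exact: leq_sum.
Qed.

Lemma kbounded_coef k f i : kbounded k f -> (absz (f`_i)%R <= k)%N.
Proof.
move=> /andP[sumk _]; have [lti|lei] := ltnP i (size f); last by rewrite nth_default.
apply: leq_trans sumk; rewrite (bigD1 (Ordinal lti)) //=; exact: leq_addr.
Qed.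

Lemma poly_sumset_large (R : realType) (C k : nat) : (0 < k)%N -> exists C' : R,
  forall (p n : nat) (A : {set 'F_p}) (f : {poly int}),
  prime p -> #|A| = n -> (3 <= n)%N -> (#|sumset A A| <= C * n)%N ->
  kbounded k f -> (2 < size f)%N -> (2 ^ (2 ^ n) < p)%N ->
  expR (- C' * (ln n%:R / ln (ln n%:R))) * n%:R ^+ 2
    < #|sumset (polyset f A) (polyset f A)|%:R.
Proof.
(* The level is that of [diff_quotient] in [lev_diff_quotient]. *)
move=> k0; have [c0 [Cb HF]] := factor_bound_nat C (3 * k + 3).
(* The summand [k] in [n3] gives [k <= n < p], so that the coefficients of [f] belong to the model
   and [f] keeps its degree modulo [p]. *)
pose n3 := (8 + 2 * c0 + k)%N; pose d : R := (2 * k ^ 2)%:R + (n3 ^ 2)%:R.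
exists (8 * Cb%:R + d) => p n A f pr_p cardA n_ge3 leC fk f2 ltp.
set u := ln n%:R / ln (ln n%:R); have u1 : 1 <= u := ln_lnln_ge1 R n_ge3.
set S' := sumset (polyset f A) (polyset f A).
pose g : {poly 'F_p} := map_poly intr f.
have FS a b : a \in A -> b \in A -> g.[a] + g.[b] \in S'.
  by move=> aA bA; rewrite mem_sumset // imset_f.
have Cb0 : 0 <= (Cb%:R : R) by [].
have d0 : 0 <= d by rewrite /d addr_ge0.
have S'0 : (0 < #|S'|)%N.
  have [a aA] : exists a, a \in A.
    by apply/set0Pn; rewrite -card_gt0 cardA (leq_trans _ n_ge3).
  by rewrite card_gt0; apply/set0Pn; exists (g.[a] + g.[a]); apply: FS.
have [ltn3|len3] := ltnP n n3.
  apply: (@trivial_bound R _ _ _ (n3 ^ 2)) => //; last by rewrite leq_exp2r // ltnW.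
  rewrite /d addrA lerDr addr_ge0 ?mulr_ge0 //.
have n2 : (2 <= #|A|)%N by rewrite cardA (leq_trans _ n_ge3).
have lekn : (k <= n)%N by apply: leq_trans len3; rewrite leq_addl.
have ltnp : (n < p)%N.
  apply: leq_trans (ltnW ltp); apply: leq_trans (ltn_expl n (isT : 1 < 2)%N) _.
  by rewrite ltnW // ltn_expl.
have ltp0 : (#|A| ^ c0 < p)%N.
  by rewrite cardA; apply: exp_lt_of_tower ltp; rewrite /n3 in len3; lia.
have leCA : (#|sumset A A| <= C * #|A|)%N by rewrite cardA.
have [S [[S0 S1 SN1] [Sint SA HS]]] := HF p A pr_p n2 leCA ltp0.
have szfk : (size f <= k.+1)%N by case/andP: fk.
have szg : size g = size f.
  apply: size_map_poly_id0; rewrite intr_Fp_eq0 // ?lead_coef_eq0 -?size_poly_gt0 //.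
    exact: ltn_trans f2.
  by apply: leq_ltn_trans (kbounded_coef _ fk) (leq_ltn_trans lekn ltnp).
set E := expR (8 * Cb%:R * u).
have E1 : 1 <= E.
  rewrite /E -[X in X <= _]expR0 ler_expR.
  by apply: mulr_ge0; [exact: mulr_ge0 | exact: le_trans u1].
pose rho m := [set ab in setX A A | g.[ab.1] - g.[ab.2] == m].
have rhoP m a b : (a, b) \in rho m -> [/\ a \in A, b \in A & g.[a] - g.[b] = m].
  by rewrite !inE /= => /andP[/andP[aA bA] /eqP].
have rho_nz m : m != 0 -> (#|rho m|)%:R <= k%:R * E.
  (* Pairs are grouped by [h = a - b], a factor of [m]; for fixed [h] the equation
     [g(b + h) - g(b) = m] is a nonzero polynomial in [b] with at most [k] roots. *)
  move=> m0; pose H := [set ab.1 - ab.2 | ab in rho m].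
  have leH : (#|rho m| <= #|H| * k)%N.
    apply: (@card_le_fibers _ _ _ (fun ab => ab.1 - ab.2)) => [ab|h]; first exact: imset_f.
    case/imsetP => -[a0 b0] /rhoP[_ _ Em] /= Eh.
    have h0 : h != 0.
      apply: contraNneq m0 => h0; rewrite -Em.
      by move/eqP: Eh; rewrite h0 eq_sym subr_eq0 => /eqP ->; rewrite subrr.
    have inj2 : {in [set i in rho m | i.1 - i.2 == h] &, injective snd}.
      move=> [a b] [a' b']; rewrite !inE /= => /andP[_ /eqP E3] /andP[_ /eqP E4] Eb.
      by congr (_, _) => //; move: E3; rewrite -E4 Eb => /addIr.
    rewrite -(card_in_imset inj2).
    apply: (card_roots_le (P := (g \Po ('X + h%:P)) - g - m%:P)).
    - apply: shift_diff_neq0; rewrite ?szg //.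
      by apply: leq_trans szfk _; apply: leq_ltn_trans ltnp.
    - have sz1 : (size (g \Po ('X + h%:P)) <= k.+1)%N.
        apply: leq_trans (size_comp_poly_leq _ _) _.
        by rewrite size_XaddC muln1 ltnS szg -ltnS prednK // (ltn_trans _ f2).
      apply: leq_trans (size_polyD _ _) _; rewrite size_polyN geq_max.
      rewrite (leq_trans (size_polyC_leq1 _)) // andbT.
      apply: leq_trans (size_polyD _ _) _; rewrite size_polyN geq_max sz1.
      by rewrite szg szfk.
    move=> z /imsetP[[a b]]; rewrite inE => /andP[/rhoP[_ _ Eab] /= /eqP Eh'] ->.
    have Ea : b + h = a by rewrite -Eh' addrC subrK.
    by rewrite /root !hornerE horner_comp !hornerE Ea Eab subrr.
  apply: le_trans (_ : k%:R * #|H|%:R <= _); first by rewrite -natrM ler_nat mulnC.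
  rewrite ler_wpM2l //.
  have -> : #|H| = size (enum H) by rewrite -cardE.
  apply: count_real; first by apply: leq_trans len3; rewrite /n3; lia.
  rewrite -cardA; apply: (HS m _ m0 (enum_uniq _)) => x.
  rewrite mem_enum => /imsetP[[a b] /rhoP[aA bA Em] ->] /=.
  have [[al Sa] [be Sb]] := (SA _ aA, SA _ bA).
  have LQ := @lev_diff_quotient _ S f k _ _ S0 S1 SN1 szfk _ Sa Sb.
  pose q := diff_quotient f (a, al) (b, be).
  exists q.1, (al - be), q.2; split.
  - apply: (@lev_leq _ S S0 S1 SN1 1); first by rewrite addnC.
    exact: (@levB _ S S0 S1 SN1 0 (a, al) (b, be)).
  - rewrite -surjective_pairing; apply: LQ => i _.
    have -> : ((f`_i)%:~R : 'F_p * algC) = ((f`_i)%:~R, (f`_i)%:~R).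
      rewrite [LHS]surjective_pairing; congr (_, _).
        exact: (rmorph_int (@fst 'F_p algC)).
      exact: (rmorph_int (@snd 'F_p algC)).
    by apply: Sint; rewrite cardA; apply: leq_trans (kbounded_coef _ fk) lekn.
  - rewrite -Em /q (rmorph_diff_quotient (@fst 'F_p algC)) /=.
    by rewrite diff_quotientP.
have rho_0 : (#|rho 0%R| <= n * k)%N.
  rewrite -cardA; apply: (@card_le_fibers _ _ _ snd) => [[a b] /rhoP[]//|c cA].
  have inj1 : {in [set i in rho 0 | i.2 == c] &, injective fst}.
    move=> [a b] [a' b']; rewrite !inE /= => /andP[_ /eqP ->] /andP[_ /eqP ->] -> //.
  rewrite -(card_in_imset inj1).
  have szc : (size (- (g.[c])%:P)%R < size g)%N.
    by rewrite size_polyN szg; apply: leq_ltn_trans (size_polyC_leq1 _) (ltn_trans _ f2).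
  apply: (card_roots_le (P := g - (g.[c])%:P)).
  - by rewrite -size_poly_gt0 size_polyDl // szg (ltn_trans _ f2).
  - by rewrite size_polyDl // szg.
  move=> z /imsetP[[a b]]; rewrite inE => /andP[/rhoP[_ _ Eab] /= /eqP Eb] ->.
  by rewrite /root !hornerE -Eb Eab.
have gS ab : ab \in setX A A -> g.[ab.1] + g.[ab.2] \in S'.
  by case: ab => a b /setXP[aA bA]; apply: FS.
have cardAA : #|setX A A| = (n ^ 2)%N by rewrite cardsX cardA.
have CS : ((n ^ 2) ^ 2 <= #|S'| * \sum_(x in setX A A) #|rho (g.[x.1] - g.[x.2])%R|)%N.
  rewrite -cardAA (card_sum_fibers gS); apply: leq_trans (Cauchy_Schwarz_nat _ _) _.
  by rewrite (sum_sqr_energy gS) (energy_swap A (fun a => g.[a])).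
have le_energy : (\sum_(x in setX A A) #|rho (g.[x.1] - g.[x.2])%R|)%N%:R
    <= (n * k * (n * k))%:R + (n ^ 2)%:R * (k%:R * E) :> R.
  rewrite natr_sum (bigID (fun x => g.[x.1] - g.[x.2] == 0)) /=; apply: lerD.
    rewrite (eq_bigr (fun=> (#|rho 0|)%:R)); last by move=> x /andP[_ /eqP ->].
    rewrite -natr_sum ler_nat sum_nat_const.
    apply: leq_mul (rho_0); apply: leq_trans (rho_0).
    by rewrite -!sum1_card; apply: eq_leq; apply: eq_bigl => x; rewrite inE.
  apply: le_trans (_ : \sum_(x in setX A A) k%:R * E <= _); last first.
    by rewrite sumr_const cardAA -[X in X <= _]mulr_natl.
  rewrite [X in _ <= X](bigID (fun x => g.[x.1] - g.[x.2] == 0)) /=.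
  apply: le_trans (_ : \sum_(x in setX A A | g.[x.1] - g.[x.2] != 0) k%:R * E <= _).
    by apply: ler_sum => c /andP[_]; apply: rho_nz.
  by rewrite lerDr sumr_ge0 // => c _; rewrite mulr_ge0 // (le_trans _ E1).
(* The energy is at most [k ^ 2 * n ^ 2 + k * E * n ^ 2], hence at most [2 * k ^ 2 * E * n ^ 2]. *)
apply: (@main_bound R _ d u (2 * k ^ 2)%:R) => //; first by rewrite /d lerDl.
rewrite -/E.
have nR : 0 < (n%:R : R) ^+ 2 by rewrite exprn_gt0 // ltr0n (leq_trans _ n_ge3).
have kR : 1 <= (k%:R : R) by rewrite (ler_nat _ 1).
have CSR : (n%:R ^+ 2) ^+ 2 <= #|S'|%:R *
    (\sum_(x in setX A A) #|rho (g.[x.1] - g.[x.2])%R|)%N%:R :> R.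
  by rewrite -!natrX -natrM ler_nat.
have sR : 0 <= (#|S'|%:R : R) by [].
rewrite -(ler_pM2r nR); apply: le_trans (_ : (n%:R ^+ 2) ^+ 2 <= _).
  by rewrite [X in _ <= X]expr2.
apply: le_trans CSR _; rewrite -mulrA ler_wpM2l //; apply: le_trans le_energy _.
rewrite !natrM; move: (n%:R : R) (k%:R : R) nR kR => x y nR kR.
rewrite [X in X <= _](_ : _ = (y * y + y * E) * x ^+ 2); last by ring.
rewrite [X in _ <= X](_ : _ = (y * y * E + y * y * E) * x ^+ 2); last by ring.
rewrite ler_pM2r //; apply: lerD.
  by rewrite ler_peMr // mulr_ge0 // (le_trans _ kR).
by rewrite ler_wpM2r ?(le_trans _ E1) // ler_peMr // (le_trans _ kR).
Qed.

(* [3 <= n] is what makes [log log n] defined and positive. *)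
Theorem theorem4p4 (R : realType) (C : R) (hC : 0 < C) :
  (exists C' : R,
     forall (p n : nat) (A : {set 'F_p}),
       prime p -> #|A| = n -> (3 <= n)%N ->
       #|sumset A A|%:R <= C * n%:R ->
       2 * n%:R < logb (2 : R) (logb 8 (logb 32 p%:R)) - 1 ->
       0 \notin A ->
       #|sumset (invset A) (invset A)|%:R >
         expR (- C' * (ln n%:R / ln (ln n%:R))) * n%:R ^+ 2)
  /\
  (forall k : nat, (0 < k)%N ->
   exists C' : R,
     forall (p n : nat) (A : {set 'F_p}) (f : {poly int}),
       prime p -> #|A| = n -> (3 <= n)%N ->
       #|sumset A A|%:R <= C * n%:R ->
       kbounded k f -> (2 < size f)%N ->
       n%:R < logb (2 : R) (logb (8 * k%:R) (logb (32 * k%:R ^+ 2) p%:R)) - 1 ->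
       #|sumset (polyset f A) (polyset f A)|%:R >
         expR (- C' * (ln n%:R / ln (ln n%:R))) * n%:R ^+ 2).
Proof.
(* The combinatorial lemmas take a natural doubling constant, so [C] is replaced by a larger
   integer. *)
pose Cn := (Num.trunc C).+1.
have leCn s n : s%:R <= C * n%:R -> (s <= Cn * n)%N.
  move=> les; rewrite -(ler_nat R) natrM; apply: le_trans les _.
  by rewrite ler_wpM2r // ltW // truncnS_gt.
split=> [|k k0].
  have [C' HC'] := inverse_sumset_large R Cn.
  exists C' => p n A pr_p cardA n3 /leCn leC ltp A0; apply: HC' => //.
  apply: (@tower_gt R 8 32) => //; rewrite ?(ler_nat _ 2) //.
  by apply: le_lt_trans ltp; rewrite ler_peMl // (ler_nat _ 1).
have [C' HC'] := poly_sumset_large R Cn k0.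
exists C' => p n A f pr_p cardA n3 /leCn leC fk f2 ltp; apply: HC' => //.
apply: (@tower_gt R (8 * k%:R) (32 * k%:R ^+ 2)) => //.
  by rewrite -natrM (ler_nat _ 2); lia.
by rewrite -natrX -natrM (ler_nat _ 2); nia.
Qed.
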